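(* For every integer $n\ge 3$: $$I_n(1,H)\sim (2H)^n,\qquad R_n(1,H)\asymp H^{n-1},$$ $$I_n(2,H)\asymp H^{n-1/2},\qquad R_n(2,H)\asymp H^{n-3/2}.$$ Moreover, $$I_3(3,H)\sim 2H,\qquad R_3(3,H)\asymp H^{2/3},$$ $$I_4(3,H)=0,\qquad R_4(3,H)\asymp H\log H,$$ $$I_4(4,H)\asymp H^{3/2},\qquad R_4(4,H)\asymp H.$$ Here the equality $I_4(3,H)=0$ and all relations $\asymp$ hold for every integer $H\ge1$, except that $R_4(3,H)\asymp H\log H$ is for every integer $H\ge 2$; the relations $\sim$ are as $H\to\infty$.
   Context: For a polynomial $f$ of degree $n \ge 1$ over $\mathbb{C}$ with roots $\alpha_1,\dots,\alpha_n$ (listed with multiplicity), put $r(f)=\max_{1\le i\le n}|\alpha_i|$. The roots of $f$ of maximal modulus are the roots of modulus $r(f)$; they are always counted with multiplicity. The height of $f$ is the maximum of the absolute values of its coefficients (including the leading one). For positive integers $k\le n$ and $H$, $I_n(k,H)$ (resp. $R_n(k,H)$) denotes the number of monic integer polynomials $f$ of degree $n$ and height at most $H$ that are irreducible (resp. reducible) in $\mathbb{Z}[x]$ and have exactly $k$ roots of maximal modulus. Notation: $U\asymp V$ means that there are constants $c_1,c_2>0$, which may depend on $n$ and $k$ but not on $H$, with $c_1V\le U\le c_2V$ for all $H$ in the indicated range; $U\sim V$ means $\lim_{H\to\infty}U/V=1$. *)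

(* Defs.v *)
From mathcomp Require Import all_boot all_order all_algebra.
From mathcomp Require Import all_classical all_reals all_analysis.
From mathcomp Require Import finmap complex.

Set Implicit Arguments.
Unset Strict Implicit.
Unset Printing Implicit Defensive.

Import Order.TTheory GRing.Theory Num.Theory.
Import numFieldNormedType.Exports.

Local Open Scope classical_set_scope.
Local Open Scope ring_scope.

(* The field of complex numbers is R[i], for R : realType. *)

Definition croots (R : realType) (f : {poly R[i]}) : seq R[i] :=
  sval (closed_field_poly_normal f).

Lemma crootsE (R : realType) (f : {poly R[i]}) :
  f = lead_coef f *: \prod_(z <- croots f) ('X - z%:P).
Proof. exact: (svalP (closed_field_poly_normal f)). Qed.

Definition cmod (R : realType) (z : R[i]) : R := ComplexField.Normc.normc z.

Lemma cmodE (R : realType) (z : R[i]) : (cmod z)%:C%C = `|z|.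
Proof. by []. Qed.

(* The default value 0 only matters for constant polynomials. *)
Definition maxmod (R : realType) (f : {poly R[i]}) : R :=
  \big[Num.max/0]_(z <- croots f) cmod z.

Definition nb_maxmod_roots (R : realType) (f : {poly R[i]}) : nat :=
  count (fun z => cmod z == maxmod f) (croots f).

Definition polyZC (R : realType) (f : {poly int}) : {poly R[i]} :=
  map_poly (fun c : int => c%:~R) f.

Definition height (f : {poly int}) : nat := \max_(i < size f) absz (f`_i)%R.

(* [irreducible_poly] relies on pseudo-divisibility, hence is about Q[x];
   irreducibility in Z[x] is stated with the units of the ring {poly int}. *)
Definition irreducibleZ (f : {poly int}) : Prop :=
  [/\ f != 0, f \isn't a GRing.unit &
      forall g h : {poly int}, f = g * h ->
        g \is a GRing.unit \/ h \is a GRing.unit].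

Definition reducibleZ (f : {poly int}) : Prop :=
  [/\ f != 0, f \isn't a GRing.unit & ~ irreducibleZ f].

Definition monic_height_le (n H : nat) : set {poly int} :=
  [set f | [/\ f \is monic, size f = n.+1 & (height f <= H)%N]].

(* [fset_set] is the expected finite set only for finite sets. *)
Lemma finite_monic_height_le n H : finite_set (monic_height_le n H).
Proof.
pose F (c : {ffun 'I_n.+1 -> 'I_(H + H).+1}) : {poly int} :=
  \poly_(i < n.+1) ((c (inord i) : nat)%:Z - H%:Z).
apply: (@sub_finite_set _ _ (F @` setT)); last first.
  exact/finite_image/finite_finset.
move=> f [_ sf hf].
have bd i : (absz (f`_i)%R <= H)%N.
  have [lti|lei] := ltnP i (size f); last by rewrite nth_default.
  apply: leq_trans hf.
  exact: (leq_bigmax (F := fun i : 'I_(size f) => absz (f`_i)%R) (Ordinal lti)).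
have bdZ i : - H%:Z <= f`_i <= H%:Z by rewrite -ler_norml -abszE lez_nat.
exists [ffun i : 'I_n.+1 => inord (absz (f`_i + H%:Z))] => //.
apply/polyP => i; rewrite coef_poly; case: ltnP => [lti|lei]; last first.
  by rewrite nth_default // sf.
have /andP[lo hi] := bdZ i.
have ge0 : 0 <= f`_i + H%:Z by rewrite -lerBlDr sub0r.
have bnd : (absz (f`_i + H%:Z)%R < (H + H).+1)%N.
  by rewrite ltnS -lez_nat gez0_abs // PoszD lerD2r.
by rewrite ffunE (inordK lti) (inordK bnd) gez0_abs // addrK.
Qed.

Definition nb_irreducible (R : realType) (n k H : nat) : nat :=
  #|` fset_set [set f | [/\ monic_height_le n H f, irreducibleZ f
                          & nb_maxmod_roots (polyZC R f) = k]]|%fset.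

Definition nb_reducible (R : realType) (n k H : nat) : nat :=
  #|` fset_set [set f | [/\ monic_height_le n H f, reducibleZ f
                          & nb_maxmod_roots (polyZC R f) = k]]|%fset.

Definition same_order_from (R : realType) (H0 : nat) (U : nat -> nat)
    (V : R -> R) : Prop :=
  exists c1 c2 : R, [/\ 0 < c1, 0 < c2 &
    forall H : nat, (H0 <= H)%N ->
      c1 * V H%:R <= (U H)%:R /\ (U H)%:R <= c2 * V H%:R].

Definition asymp_equivalent (R : realType) (U : nat -> nat)
    (V : R -> R) : Prop :=
  (fun H : nat => (U H)%:R / V H%:R) @ \oo --> (1 : R).

(* Main.v *)
(** Dividing X^n + a_(n-1) X^(n-1) + ... + a_0 by X - z, with z a root of maximal
    modulus, bounds the coefficients of the quotient by O(H / |z|). If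
    |a_(n-1)| >> sqrt H, then |z| >> sqrt H and z dominates all other roots; hence
    two roots of maximal modulus force a_(n-1) = O(sqrt H). Conversely, if
    |a_(n-1)| <= sqrt H and H / 2 <= a_(n-2), then the two roots of maximal modulus
    are complex conjugates. For small H one needs a single irreducible polynomial
    of height 1 with two roots of maximal modulus, X^n - X^2 + (-1)^(n+1).

    Since height(g) height(h) = O(height(g h)), reducible polynomials are counted
    through pairs of factors, dyadically in height(g). If g h has two roots of
    maximal modulus, then either both belong to the same factor, or each factor
    has a single one, which is real, and the two factors share it up to sign.

    When n = 3, 4, roots of modulus r satisfy conj z = r^2 / z, so conjugation
    relates the elementary symmetric functions of the roots. An irreducible cubic
    with all roots of the same modulus is X^3 + w, a quartic with this property
    satisfies a_1^2 = |a_0| a_3^2. A quartic with three roots of maximal modulus has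
    a real root whose square is the product of two other roots; Galois conjugation
    would transport this relation to the root of smaller modulus, so the quartic
    is reducible, and it is X + b times X^3 + w or a product of a linear and a
    quadratic polynomial with the same root modulus. Counting the pairs (b, w)
    with |b w| <= H gives H log H. *)

Require Import Defs.
From mathcomp Require Import all_boot all_order all_algebra.
From mathcomp Require Import all_classical all_reals all_analysis.
From mathcomp Require Import finmap complex separable zify ring lra.

Set Implicit Arguments.
Unset Strict Implicit.
Unset Printing Implicit Defensive.

Import Order.TTheory GRing.Theory Num.Theory.
Import numFieldNormedType.Exports.

Local Open Scope classical_set_scope.
Local Open Scope ring_scope.

(** * Bounding cardinalities by lists *)

Section Counting.
Variables (R : realType) (T : choiceType).
Implicit Types (A B : set T) (x y : R).

(** The orders must hold from H = 1 (or 2) on, so every family needs a member of height 1. Powers of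
    X, possibly times X - 1, X^2 + 1 or X^3 + 1, serve in the reducible cases. An irreducible
    polynomial of height 1 is harder to certify, since Eisenstein's criterion never applies to it
    directly; a trinomial is chosen because the sum of the squares of its coefficients is only 3,
    which all but determines the polynomials having the same product with their reversal.

    In the dyadic count, if there are O(T^a) first factors of height at most T and O(T^b) second
    ones, the blocks form a geometric series of ratio 2^(a - b). No logarithm arises as long as a
    and b differ, so exponents are kept at half-integers against integers; for n >= 3 the target
    exponents leave room for the 1/2 that is given away.

    For k = 1, 2 the irreducible polynomials are bounded from below by subtraction, the reducible
    ones being fewer by a factor of order at least sqrt H; the reducible polynomials in the lower
    bounds simply have constant coefficient 0. *)

Definition card_at_most A x :=
  exists s : seq T, (forall t, A t -> t \in s) /\ (size s)%:R <= x.

(** Lists replace cardinals: for an upper bound the list may contain repetitions and extra elements,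
    so parametrisations need not be injective; only lower bounds require [uniq]. *)
Definition card_at_least A x :=
  exists s : seq T, [/\ uniq s, forall t, t \in s -> A t & x <= (size s)%:R].

Lemma card_at_most_fset_set A x :
  card_at_most A x -> (#|` fset_set A|)%:R <= x.
Proof.
move=> [s [As]]; apply: le_trans; rewrite ler_nat.
have finA : finite_set A.
  by apply: (sub_finite_set _ (finite_seq s)) => t /As.
by apply: uniq_leq_size => // t; rewrite in_fset_set // => /set_mem/As.
Qed.

Lemma card_at_least_fset_set A x :
  finite_set A -> card_at_least A x -> x <= (#|` fset_set A|)%:R.
Proof.
move=> finA [s [us sA sx]]; apply: le_trans sx _; rewrite ler_nat.
by apply: uniq_leq_size => // t /sA At; rewrite in_fset_set //; apply: mem_set.
Qed.

Lemma card_at_most_sub A B x y :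
  A `<=` B -> x <= y -> card_at_most B x -> card_at_most A y.
Proof.
by move=> AB xy [s [Bs sx]]; exists s; split=> [t /AB/Bs //|]; apply: le_trans xy.
Qed.

Lemma card_at_mostU A B x y :
  card_at_most A x -> card_at_most B y -> card_at_most (A `|` B) (x + y).
Proof.
move=> [s [As sx]] [s' [Bs sy]]; exists (s ++ s'); split.
  by move=> t [/As|/Bs] ts; rewrite mem_cat ts ?orbT.
by rewrite size_cat natrD lerD.
Qed.

Lemma card_at_most_bigcup n (F : nat -> set T) (x : nat -> R) :
  (forall i, (i < n)%N -> card_at_most (F i) (x i)) ->
  card_at_most (\bigcup_(i in [set i | (i < n)%N]) F i) (\sum_(i < n) x i).
Proof.
elim: n => [|n IH] Fx.
  by rewrite big_ord0; exists [::]; split=> // t [].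
rewrite big_ord_recr /=.
apply: (@card_at_most_sub _ _ _ _ _ (lexx _)); last first.
  apply: card_at_mostU; first by apply: IH => i lin; apply: Fx; apply: leqW.
  exact: (Fx n).
move=> t [i /= lin Ft]; move: lin; rewrite ltnS leq_eqVlt => /orP[/eqP <-|lin].
  by right.
by left; exists i.
Qed.

Lemma card_at_least_sub A B x y :
  A `<=` B -> y <= x -> card_at_least A x -> card_at_least B y.
Proof.
move=> AB xy [s [us sA sx]]; exists s; split=> //; last exact: le_trans sx.
by move=> t /sA/AB.
Qed.

Lemma card_at_leastD A B x y :
  card_at_least A x -> card_at_most B y -> card_at_least (A `\` B) (x - y).
Proof.
move=> [s [us sA sx]] [s' [Bs sy]]; exists [seq t <- s | t \notin s']; split.
- exact: filter_uniq.
- by move=> t; rewrite mem_filter => /andP[ts /sA At]; split => // /Bs; apply/negP.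
- rewrite lerBlDr (le_trans sx) // (le_trans _ (lerD (lexx _) sy)) //.
  rewrite -natrD ler_nat -(count_predC (fun t => t \notin s')) size_filter.
  rewrite leq_add2l -size_filter uniq_leq_size ?filter_uniq //.
  by move=> t; rewrite mem_filter /= negbK => /andP[].
Qed.

Lemma card_at_least1 A t : A t -> card_at_least A 1.
Proof. by move=> At; exists [:: t]; split=> // t'; rewrite inE => /eqP ->. Qed.

End Counting.

Lemma card_at_most_image (R : realType) (S T : choiceType) (F : S -> T) A B (x : R) :
  (forall t, B t -> exists2 s, A s & t = F s) ->
  card_at_most A x -> card_at_most B x.
Proof.
move=> AB [s [As sx]]; exists (map F s); rewrite size_map; split=> // t.
by move=> /AB[u /As us ->]; apply: map_f.
Qed.

Definition fiber (S T : Type) (A : set (S * T)) (a : S) : set T :=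
  [set b | A (a, b)].

Lemma card_at_most_pair (R : realType) (S T : choiceType) (A : set (S * T))
    (B : set S) (x y : R) :
  (forall p, A p -> B p.1) -> card_at_most B x -> 0 <= y ->
  (forall a, B a -> card_at_most (fiber A a) y) ->
  card_at_most A (x * y).
Proof.
move=> AB [s [Bs sx]] y0 Ay.
(* The list s may contain elements outside B, whose fibers are not controlled; they receive the
   empty list. *)
pose l a : seq T := if pselect (B a) is left Ba then sval (cid (Ay a Ba)) else [::].
exists [seq (a, b) | a <- s, b <- l a]; split.
  move=> [a b] Aab; apply/allpairsPdep; exists a, b; split => //.
    exact/Bs/(AB _ Aab).
  rewrite /l; case: pselect => [Ba|nBa]; last by case: nBa; exact: (AB _ Aab).
  by case: (cid _) => /= u [+ _]; apply.
apply: (@le_trans _ _ ((size s)%:R * y)); last by rewrite ler_wpM2r.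
rewrite size_allpairs_dep sumnE big_map natr_sum -sum1_size natr_sum mulr_suml.
apply: ler_sum => a _; rewrite mul1r /l; case: pselect => [Ba|_] //.
by case: (cid _) => /= u [_].
Qed.

(** * Monic polynomials with coefficients in prescribed lists *)

Definition int_range (R : realType) (x : R) : seq int :=
  [seq i%:Z - (Num.trunc x)%:Z | i <- iota 0 (Num.trunc x).*2.+1].

Lemma int_range_uniq (R : realType) (x : R) : uniq (int_range x).
Proof. by rewrite map_inj_uniq ?iota_uniq // => i j; lia. Qed.

Lemma mem_int_range (R : realType) (x : R) (a : int) : 0 <= x ->
  (a \in int_range x) = (`|a|%:~R <= x).
Proof.
move=> x0; have -> : (`|a|%:~R <= x) = (`|a|%N <= Num.trunc x)%N.
  by rewrite truncn_ge_nat // -abszE.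
rewrite /int_range; move: (Num.trunc x) => n; apply/mapP/idP => [[j]|an].
  by rewrite mem_iota; lia.
by exists (absz (a + n%:Z)); rewrite ?mem_iota; lia.
Qed.

Lemma size_int_range (R : realType) (x : R) :
  size (int_range x) = (Num.trunc x).*2.+1.
Proof. by rewrite size_map size_iota. Qed.

Lemma size_int_range_le (R : realType) (x : R) : 0 <= x ->
  (size (int_range x))%:R <= 2 * x + 1.
Proof.
move=> x0; rewrite size_int_range -addn1 natrD -mul2n natrM lerD2r.
by rewrite ler_wpM2l // truncn_le.
Qed.

Lemma size_int_range_le3 (R : realType) (x : R) : 1 <= x ->
  (size (int_range x))%:R <= 3 * x.
Proof. by move=> x1; have := @size_int_range_le R x; lra. Qed.

Lemma size_int_range_nat (R : realType) (n : nat) :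
  size (int_range (n%:R : R)) = n.*2.+1.
Proof. by rewrite size_int_range natrK. Qed.

Definition box (S : seq (seq int)) : set {poly int} :=
  [set f | [/\ f \is monic, size f = (size S).+1 &
               forall i, (i < size S)%N -> f`_i \in nth [::] S i]].

Definition box_seq : seq (seq int) -> seq {poly int} :=
  foldr (fun s t => [seq cons_poly c p | c <- s, p <- t]) [:: 1].

Lemma cons_poly_inj (A : nzRingType) (c d : A) (p q : {poly A}) :
  cons_poly c p = cons_poly d q -> c = d /\ p = q.
Proof.
move=> e; split; first by have /(congr1 (coefp 0)) := e; rewrite /= !coef_cons.
by apply/polyP => i; have /(congr1 (coefp i.+1)) := e; rewrite /= !coef_cons.
Qed.

Lemma cons_poly_eq (A : nzRingType) (f : {poly A}) :
  f = cons_poly f`_0 (\poly_(i < (size f).-1) f`_i.+1).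
Proof.
apply/polyP => i; rewrite coef_cons coef_poly; case: i => [|i] //=.
by case: ltnP => // h; rewrite nth_default //; case: (size f) h.
Qed.

Lemma monic_cons_poly (A : nzRingType) (c : A) (p : {poly A}) : p \is monic ->
  cons_poly c p \is monic /\ size (cons_poly c p) = (size p).+1.
Proof.
move=> pm; have p0 := monic_neq0 pm.
have sz : size (cons_poly c p) = (size p).+1.
  by rewrite size_cons_poly nil_poly (negPf p0).
by split => //; rewrite monicE lead_coefE sz coef_cons polySpred //= -monicE.
Qed.

Lemma monic_uncons_poly (A : nzRingType) n (f : {poly A}) :
    f \is monic -> size f = n.+2 ->
  (\poly_(i < n.+1) f`_i.+1 \is monic) /\ size (\poly_(i < n.+1) f`_i.+1) = n.+1.
Proof.
move=> /monicP fm sf; move: fm; rewrite lead_coefE sf /= => fm.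
have sz : size (\poly_(i < n.+1) f`_i.+1) = n.+1.
  by rewrite size_poly_eq // fm oner_eq0.
by rewrite monicE lead_coefE sz coef_poly ltnSn fm.
Qed.

Lemma mem_box_seq S f : reflect (box S f) (f \in box_seq S).
Proof.
elim: S f => [|s S IH] f /=.
  rewrite inE; apply: (iffP eqP) => [->|[fm sf _]].
    by split; rewrite ?monic1 ?size_poly1.
  by move/eqP/size_poly1P: sf fm => [c _ ->]; rewrite monicE lead_coefC => /eqP ->.
apply: (iffP allpairsP) => [[[c p] /= [cs /IH [pm sp Hp] ->]]|[fm sf Hf]].
  have [m sz] := monic_cons_poly c pm; split => //; first by rewrite sz sp.
  by case=> [|i] /= iS; rewrite coef_cons //=; apply: Hp.
have [m sz] := monic_uncons_poly fm sf.
exists (f`_0, \poly_(i < (size S).+1) f`_i.+1); split => /=.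
- exact: (Hf 0%N).
- apply/IH; split => // i iS; rewrite coef_poly ltnS (ltnW iS).
  exact: (Hf i.+1).
- by rewrite {1}[f]cons_poly_eq sf.
Qed.

Lemma box_seq_uniq S : all uniq S -> uniq (box_seq S).
Proof.
elim: S => [|s S IH] //= /andP[us uS]; apply: allpairs_uniq; rewrite ?IH //.
by move=> [c p] [d q] _ _ /= /cons_poly_inj [-> ->].
Qed.

Lemma size_box_seq S : size (box_seq S) = (\prod_(s <- S) size s)%N.
Proof.
by elim: S => [|s S IH] /=; rewrite ?big_nil // size_allpairs IH big_cons.
Qed.

Lemma card_at_most_box (R : realType) S :
  card_at_most (box S) (\prod_(s <- S) (size s)%:R : R).
Proof.
exists (box_seq S); split; first by move=> f /mem_box_seq.
by rewrite size_box_seq natr_prod.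
Qed.

Lemma card_at_least_box (R : realType) S : all uniq S ->
  card_at_least (box S) (\prod_(s <- S) (size s)%:R : R).
Proof.
exists (box_seq S); split; [exact: box_seq_uniq|by move=> f /mem_box_seq|].
by rewrite size_box_seq natr_prod.
Qed.

(** * Roots of maximal modulus *)

Section Modulus.
Variable R : realType.
Implicit Types (z w : R[i]) (f g h : {poly R[i]}) (s t : seq R[i]).

Lemma cmod_ge0 z : 0 <= cmod z.
Proof. by rewrite -ler0c cmodE normr_ge0. Qed.

Lemma cmod0 : cmod (0 : R[i]) = 0.
Proof. by apply: complexI; rewrite cmodE normr0. Qed.

Lemma cmod1 : cmod (1 : R[i]) = 1.
Proof. by apply: complexI; rewrite cmodE normr1. Qed.

Lemma cmodM z w : cmod (z * w) = cmod z * cmod w.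
Proof. by apply: complexI; rewrite rmorphM /= !cmodE normrM. Qed.

Lemma cmodN z : cmod (- z) = cmod z.
Proof. by apply: complexI; rewrite !cmodE normrN. Qed.

Lemma cmodX z n : cmod (z ^+ n) = cmod z ^+ n.
Proof. by apply: complexI; rewrite rmorphXn /= !cmodE normrX. Qed.

Lemma cmodJ z : cmod (z^*)%C = cmod z.
Proof. by apply: complexI; rewrite !cmodE normcJ. Qed.

Lemma cmod_eq0 z : (cmod z == 0) = (z == 0).
Proof. by rewrite -(inj_eq (@complexI R)) cmodE rmorph0 normr_eq0. Qed.

Lemma ler_cmodD z w : cmod (z + w) <= cmod z + cmod w.
Proof. by rewrite -lecR rmorphD /= !cmodE ler_normD. Qed.

Lemma ler_cmodB z w : cmod (z - w) <= cmod z + cmod w.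
Proof. by rewrite -(cmodN w) ler_cmodD. Qed.

Lemma cmod_int (c : int) : cmod (c%:~R : R[i]) = `|c|%:~R.
Proof.
by apply: complexI; rewrite cmodE -intr_norm -(rmorph_int (real_complex R)).
Qed.

Lemma cmod_real (x : R) : cmod x%:C%C = `|x|.
Proof. by apply: complexI; rewrite cmodE normc_def /= expr0n addr0 sqrtr_sqr. Qed.

Lemma cmod_sqr z : ((cmod z) ^+ 2)%:C%C = z * (z^*)%C.
Proof. by rewrite rmorphXn /= cmodE sqr_normc. Qed.

Lemma ler_cmod_sum (I : Type) (r : seq I) (P : pred I) (F : I -> R[i]) :
  cmod (\sum_(i <- r | P i) F i) <= \sum_(i <- r | P i) cmod (F i).
Proof.
apply: (big_ind2 (fun x y => cmod x <= y)); rewrite ?cmod0 // => x1 x2 y1 y2 h1 h2.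
by apply: (le_trans (ler_cmodD _ _)); apply: lerD.
Qed.

Lemma cmod_prod (I : Type) (r : seq I) (P : pred I) (F : I -> R[i]) :
  cmod (\prod_(i <- r | P i) F i) = \prod_(i <- r | P i) cmod (F i).
Proof. by apply: (big_morph _ cmodM); rewrite cmod1. Qed.

Definition prod_roots s : {poly R[i]} := \prod_(z <- s) ('X - z%:P).

Lemma prod_roots_monic s : prod_roots s \is monic.
Proof. exact: monic_prod_XsubC. Qed.

Lemma size_prod_roots s : size (prod_roots s) = (size s).+1.
Proof. exact: size_prod_XsubC. Qed.

Lemma prod_roots_cons z s : prod_roots (z :: s) = ('X - z%:P) * prod_roots s.
Proof. exact: big_cons. Qed.

Lemma prod_roots_cat s t : prod_roots (s ++ t) = prod_roots s * prod_roots t.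
Proof. exact: big_cat. Qed.

Lemma prod_roots_perm s t : perm_eq s t -> prod_roots s = prod_roots t.
Proof. exact: perm_big. Qed.

Lemma croots_monic f : f \is monic -> f = prod_roots (croots f).
Proof. by move=> /monicP fm; rewrite {1}[f]crootsE fm scale1r. Qed.

Lemma croots_prod_roots s : perm_eq (croots (prod_roots s)) s.
Proof.
by apply: prod_XsubC_eq; apply: esym (croots_monic (prod_roots_monic s)).
Qed.

Lemma perm_croots f s : f = prod_roots s -> perm_eq s (croots f).
Proof. by move=> ->; rewrite perm_sym croots_prod_roots. Qed.

Lemma size_croots f : f \is monic -> size (croots f) = (size f).-1.
Proof. by move=> fm; rewrite {2}(croots_monic fm) size_prod_roots. Qed.

Lemma croots_mul f g : f \is monic -> g \is monic ->
  perm_eq (croots f ++ croots g) (croots (f * g)).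
Proof.
by move=> fm gm; apply: perm_croots; rewrite prod_roots_cat -!croots_monic.
Qed.

Lemma mem_croots f z : f \is monic -> (z \in croots f) = root f z.
Proof. by move=> fm; rewrite {2}(croots_monic fm) root_prod_XsubC. Qed.

Lemma maxmod_ge f z : z \in croots f -> cmod z <= maxmod f.
Proof. by move=> zf; rewrite /maxmod; apply: (@le_bigmax_seq _ _ _ _ _ _ xpredT). Qed.

Lemma maxmod_attained f : f \is monic -> (1 < size f)%N ->
  exists2 z, z \in croots f & cmod z = maxmod f.
Proof.
move=> fm sf; have: croots f != [::].
  by rewrite -size_eq0 size_croots //; case: (size f) sf => [|[|]].
rewrite /maxmod; elim: (croots f) => // z s IH _; rewrite big_cons.
have [->|/IH [w ws mw]] := eqVneq s [::].
  by exists z; rewrite ?mem_head // big_nil; apply/esym/max_idPl/cmod_ge0.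
rewrite -mw; have [le|lt] := leP (cmod z) (cmod w).
  by exists w; rewrite ?inE ?ws ?orbT.
by exists z; rewrite ?mem_head.
Qed.

Lemma maxmod_nb_unique f s t r : perm_eq (s ++ t) (croots f) ->
    s != [::] -> {in s, forall z, cmod z = r} -> {in t, forall z, cmod z < r} ->
  maxmod f = r /\ nb_maxmod_roots f = size s.
Proof.
move=> pst s0 sr tr.
have mf : maxmod f = r.
  case: s s0 sr pst => // z s _ sr pst; have zr := sr z (mem_head _ _).
  apply/eqP; rewrite eq_le -{2}zr maxmod_ge; last first.
    by rewrite -(perm_mem pst) mem_cat mem_head.
  rewrite andbT /maxmod big_seq; apply: bigmax_le => [|w].
    by rewrite -zr cmod_ge0.
  by rewrite -(perm_mem pst) mem_cat => /orP[/sr -> |/tr /ltW].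
split => //; rewrite /nb_maxmod_roots mf -(permP pst) count_cat.
have -> : count (fun z => cmod z == r) t = 0%N.
  by apply/eqP; rewrite -leqn0 leqNgt -has_count; apply/hasPn => z /tr /lt_eqF ->.
rewrite addn0; apply/eqP; rewrite -all_count; apply/allP => z /sr ->.
exact: eqxx.
Qed.

Lemma nb_maxmod_unique f s t r : perm_eq (s ++ t) (croots f) ->
    s != [::] -> {in s, forall z, cmod z = r} -> {in t, forall z, cmod z < r} ->
  nb_maxmod_roots f = size s.
Proof. by move=> pst s0 sr tr; case: (maxmod_nb_unique pst s0 sr tr). Qed.

Lemma maxmod_split f : exists s t,
  [/\ perm_eq (s ++ t) (croots f), {in s, forall z, cmod z = maxmod f},
      {in t, forall z, cmod z < maxmod f} & size s = nb_maxmod_roots f].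
Proof.
pose P := [pred z | cmod z == maxmod f].
exists (seq.filter P (croots f)), (seq.filter (predC P) (croots f)); split.
- by apply/permPl/perm_filterC.
- by move=> z; rewrite mem_filter => /andP[/eqP].
- move=> z; rewrite mem_filter lt_neqAle => /andP[/= zP /maxmod_ge ->].
  by rewrite zP.
- by rewrite size_filter.
Qed.

Lemma nb_maxmod_gt0 f : f \is monic -> (1 < size f)%N -> (0 < nb_maxmod_roots f)%N.
Proof.
move=> fm sf; have [z zf mz] := maxmod_attained fm sf.
by rewrite -has_count; apply/hasP; exists z => //; apply/eqP.
Qed.

(** * Coefficients of a quotient by a linear factor *)

Lemma coef_XsubC_mul z g i :
  (('X - z%:P) * g)`_i = (if i is j.+1 then g`_j else 0) - z * g`_i.
Proof. by rewrite mulrBl coefB coefXM coefCM; case: i. Qed.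

(* The coefficients are computed from the constant one upwards, dividing by z
   at each step. *)
Lemma quotient_coef_large z g i (M : R) : 2 <= cmod z ->
    (forall j, (j <= i)%N -> cmod (('X - z%:P) * g)`_j <= M) ->
  cmod z * cmod g`_i <= 2 * M.
Proof.
move=> z2; have step j : cmod z * cmod g`_j <=
    cmod (if j is k.+1 then g`_k else 0) + cmod (('X - z%:P) * g)`_j.
  by rewrite -cmodM coef_XsubC_mul (le_trans _ (ler_cmodB _ _)) // opprB addrC subrK.
elim: i => [|i IH] HM; apply: (le_trans (step _)).
  by rewrite cmod0 add0r; have := HM 0%N isT; have := cmod_ge0 (('X - z%:P) * g)`_0; lra.
have h1 := HM i.+1 (leqnn _); have h2 : cmod z * cmod g`_i <= 2 * M.
  by apply: IH => j ji; apply: HM; apply: leqW.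
have := cmod_ge0 g`_i; nra.
Qed.

(** For |z| <= 2 the division runs downwards from the leading coefficient: with f the product, g_i =
    f_(i+1) + z g_(i+1). Each step doubles the bound and adds M, whence (2^k - 1) M after k
    steps. *)
Lemma quotient_coef_small z g n i (M : R) : cmod z <= 2 ->
    (size g <= n)%N -> (forall j, cmod (('X - z%:P) * g)`_j <= M) ->
  cmod g`_i <= 2 ^+ n * M.
Proof.
move=> z2 sg HM; have M0 : 0 <= M by apply: le_trans (HM 0%N); apply: cmod_ge0.
suff H k : (i + k >= n)%N -> cmod g`_i <= (2 ^+ k - 1) * M.
  by apply: (le_trans (H n _)); rewrite ?leq_addl // ler_wpM2r // lerBlDr lerDl.
elim: k i => [|k IH] i; first by rewrite addn0 => ni;
  rewrite nth_default ?cmod0 ?subrr ?mul0r // (leq_trans sg).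
rewrite addnS -addSn => /IH IHi.
have -> : g`_i = (('X - z%:P) * g)`_i.+1 + z * g`_i.+1.
  by rewrite coef_XsubC_mul subrK.
rewrite (le_trans (ler_cmodD _ _)) // cmodM.
have := HM i.+1; have := cmod_ge0 g`_i.+1; rewrite exprS; nra.
Qed.

(** The Mahler measure of [prod_roots s]. It mediates between two factors: it bounds the
    coefficients of one of them, and dividing a product by the roots of that one gains this same
    quantity on the other. *)
Definition mahler s : R := \prod_(z <- s) Num.max 1 (cmod z).

Lemma quotient_coef z g n i (M : R) :
    (size g <= n)%N -> (forall j, cmod (('X - z%:P) * g)`_j <= M) ->
  Num.max 1 (cmod z) * cmod g`_i <= 2 ^+ n.+1 * M.
Proof.
move=> sg HM; have M0 : 0 <= M by apply: le_trans (HM 0%N); apply: cmod_ge0.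
have p1 : 1 <= 2 ^+ n :> R by rewrite exprn_ege1 // ler1n.
have [z2|z2] := leP (cmod z) 2.
  have := @quotient_coef_small z g n i M z2 sg HM; have := cmod_ge0 g`_i.
  have : Num.max 1 (cmod z) <= 2 by rewrite ge_max z2; lra.
  by rewrite exprS; nra.
have := @quotient_coef_large z g i M (ltW z2) (fun j _ => HM j).
have -> : Num.max 1 (cmod z) = cmod z by apply/max_idPr; lra.
by move=> /le_trans; apply; rewrite exprS ler_wpM2r //; lra.
Qed.

Lemma coef_prod_roots_le s i : cmod (prod_roots s)`_i <= 2 ^+ size s * mahler s.
Proof.
rewrite /prod_roots /mahler; elim: s i => [|z s IH] i.
  by rewrite !big_nil expr0 mulr1 coef1; case: (i == _); rewrite ?cmod1 ?cmod0.
rewrite !big_cons coef_XsubC_mul (le_trans (ler_cmodB _ _)) // cmodM.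
set P := \prod_(_ <- s) _ in IH *; set Q := \prod_(_ <- s) _ in IH *.
set m := Num.max 1 (cmod z); have m1 : 1 <= m by rewrite le_max lexx.
have mz : cmod z <= m by rewrite le_max lexx orbT.
have h1 : cmod (if i is j.+1 then P`_j else 0) <= 2 ^+ size s * Q.
  by case: i => [|j]; rewrite ?cmod0 // (le_trans (cmod_ge0 P`_0)).
have -> : 2 ^+ (size s).+1 * (m * Q) = m * (2 ^+ size s * Q) + m * (2 ^+ size s * Q).
  by rewrite exprS; ring.
have D0 : 0 <= 2 ^+ size s * Q := le_trans (cmod_ge0 _) (IH 0%N).
apply: lerD; first by rewrite (le_trans h1) // ler_peMl.
by apply: ler_pM; rewrite ?cmod_ge0.
Qed.

(** The roots in s are divided out one at a time; each division multiplies the bound on the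
    coefficients by 2^(n+1) / max(1, |z|). *)
Lemma mahler_mul_coef s h n i (M : R) : (size (prod_roots s * h)%R <= n.+1)%N ->
    (forall j, cmod (prod_roots s * h)`_j <= M) ->
  mahler s * cmod h`_i <= 2 ^+ (n.+1 * size s) * M.
Proof.
elim: s h i M => [|z s IH] h i M; rewrite /mahler.
  by rewrite /prod_roots !big_nil !mul1r muln0 expr0 mul1r => _ /(_ i).
rewrite prod_roots_cons -mulrA big_cons => sz HM.
have [->|h0] := eqVneq h 0.
  rewrite coef0 cmod0 mulr0 mulr_ge0 ?exprn_ge0 //.
  by apply: le_trans (HM 0%N); apply: cmod_ge0.
have ph0 : prod_roots s * h != 0 by rewrite mulf_neq0 // monic_neq0 ?prod_roots_monic.
have sg : (size (prod_roots s * h)%R <= n)%N.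
  by move: sz; rewrite size_proper_mul ?lead_coefXsubC ?mul1r ?lead_coef_eq0 // size_XsubC.
set m := Num.max 1 (cmod z); have m0 : 0 < m by rewrite lt_max ltr01.
have q j : cmod (prod_roots s * h)`_j <= 2 ^+ n.+1 * M / m.
  by rewrite ler_pdivlMr // mulrC; apply: quotient_coef.
have := IH h i _ (leqW sg) q; rewrite -/(mahler s) mulnS exprD.
by rewrite mulrA ler_pdivlMr //; nra.
Qed.

End Modulus.

(** * Criteria for one dominant root and for a dominant conjugate pair *)

Section MaxmodCriteria.
Variable R : realType.
Implicit Types (z w : R[i]) (f g h : {poly R[i]}) (s t : seq R[i]).

Lemma croots_factor f z : f \is monic -> root f z ->
  exists g, [/\ g \is monic, f = ('X - z%:P) * g & perm_eq (z :: croots g) (croots f)].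
Proof.
move=> fm; rewrite -mem_croots // => zf.
exists (prod_roots (rem z (croots f))); split; first exact: prod_roots_monic.
  rewrite -prod_roots_cons {1}(croots_monic fm); apply: prod_roots_perm.
  exact: perm_to_rem.
rewrite perm_sym (permPl (perm_to_rem zf)) perm_cons perm_sym.
exact: croots_prod_roots.
Qed.

Lemma size_monic_factor f g z n : g \is monic -> f = ('X - z%:P) * g ->
  size f = n.+1 -> size g = n.
Proof.
move=> gm ->; rewrite size_proper_mul ?lead_coefXsubC ?mul1r ?lead_coef_eq0 ?monic_neq0 //.
by rewrite size_XsubC /= => -[].
Qed.

Lemma coef_monic_top f n : f \is monic -> size f = n.+1 -> f`_n = 1.
Proof. by move=> /monicP <- sf; rewrite lead_coefE sf. Qed.

(** The bound |z| |g_i| <= 2 M on the quotient g by X - z, applied to its leading coefficient 1,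
    bounds z itself. *)
Lemma root_cmod_le f z n (M : R) : f \is monic -> size f = n.+2 ->
    (forall j, (j <= n)%N -> cmod f`_j <= M) -> root f z ->
  cmod z <= Num.max 2 (2 * M).
Proof.
move=> fm sf HM rz; rewrite le_max; have [//|/ltW z2] := leP (cmod z) 2.
have [g [gm fE _]] := croots_factor fm rz.
have sg := size_monic_factor gm fE sf.
have /= := @quotient_coef_large R z g n M z2.
rewrite -fE (coef_monic_top gm sg) cmod1 mulr1.
by apply.
Qed.

Lemma coef_prod_roots_le_maxmod s (r : R) i : (i <= size s)%N ->
    {in s, forall z, cmod z <= r} ->
  cmod (prod_roots s)`_i <= 2 ^+ size s * r ^+ (size s - i).
Proof.
rewrite /prod_roots; elim: s i => [|z s IH] i.
  by rewrite !big_nil expr0 mul1r leqn0 => /eqP -> _; rewrite coef1 cmod1 subnn.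
rewrite big_cons coef_XsubC_mul /= => lei zr.
have zr' : cmod z <= r by apply: zr; rewrite mem_head.
have r0 : 0 <= r by apply: le_trans zr'; apply: cmod_ge0.
have {}IH i' : (i' <= size s)%N ->
    cmod (prod_roots s)`_i' <= 2 ^+ size s * r ^+ (size s - i').
  by move=> h; apply: IH => // w ws; apply: zr; rewrite inE ws orbT.
rewrite exprS mulrDl mulrDl !mul1r (le_trans (ler_cmodB _ _)) //; apply: lerD.
  case: i lei => [|i] lei; last by rewrite subSS; apply: IH.
  by rewrite cmod0 mulr_ge0 ?exprn_ge0.
rewrite cmodM; move: lei; rewrite leq_eqVlt => /orP[/eqP ->|lei].
  rewrite nth_default; last by rewrite size_prod_roots.
  by rewrite cmod0 mulr0 mulr_ge0 ?exprn_ge0.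
rewrite subSn // exprS mulrCA; apply: ler_pM; rewrite ?cmod_ge0 //.
exact: IH.
Qed.

Lemma coef_le_maxmod f n i : f \is monic -> size f = n.+1 -> (i <= n)%N ->
  cmod f`_i <= 2 ^+ n * maxmod f ^+ (n - i).
Proof.
move=> fm sf lei; have sc : size (croots f) = n by rewrite size_croots // sf.
rewrite {1}(croots_monic fm) -sc; apply: coef_prod_roots_le_maxmod; rewrite ?sc //.
by move=> z; apply: maxmod_ge.
Qed.

Lemma cmod_subleading_le f n : f \is monic -> size f = n.+2 ->
  cmod f`_n <= n.+1%:R * maxmod f.
Proof.
move=> fm sf; have sc : size (croots f) = n.+1 by rewrite size_croots // sf.
rewrite {1}(croots_monic fm) /prod_roots.
have -> : n = (size (croots f)).-1 by rewrite sc.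
rewrite coefPn_prod_XsubC ?sc // cmodN (le_trans (ler_cmod_sum _ _ _)) //.
rewrite -sc -sum1_size natr_sum mulr_suml big_seq [leRHS]big_seq.
by apply: ler_sum => z zf; rewrite mul1r maxmod_ge.
Qed.

(** The subleading coefficient is at most n + 2 times the largest modulus, so some root z has |z| >
    4 sqrt H. The lower coefficients of the quotient by X - z are then at most 2 H / |z| <= sqrt H /
    2, and all other roots have modulus at most max(2, sqrt H) < |z|. *)
Lemma nb_maxmod_dominant n f (H : R) : f \is monic -> size f = n.+3 -> 1 <= H ->
    (forall i, (i <= n)%N -> cmod f`_i <= H) ->
    4 * n.+2%:R * Num.sqrt H < cmod f`_n.+1 ->
  nb_maxmod_roots f = 1%N.
Proof.
move=> fm sf H1 HH big; have [|z zf mz] := maxmod_attained fm; first by rewrite sf.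
have [g [gm fE pg]] := croots_factor fm (etrans (esym (mem_croots z fm)) zf).
have sg := size_monic_factor gm fE sf.
set p := Num.sqrt H in big; have p2 : p * p = H by rewrite -expr2 sqr_sqrtr //; lra.
have p1 : 1 <= p by rewrite -[1]sqrtr1 ler_wsqrtr.
have pz : 4 * p < cmod z.
  rewrite mz -(ltr_pM2l (_ : 0 < n.+2%:R :> R)) ?ltr0n //.
  by apply: lt_le_trans (cmod_subleading_le fm sf); rewrite mulrCA mulrA.
apply: (@maxmod_nb_unique _ _ [:: z] (croots g) (cmod z) pg _ _ _).2 => //.
  by move=> w; rewrite inE => /eqP ->.
move=> w; rewrite mem_croots // => rw.
have gb j : (j <= n)%N -> cmod g`_j <= p / 2.
  move=> jn; have : cmod z * cmod g`_j <= 2 * H.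
    apply: quotient_coef_large => [|k kj]; first by lra.
    by rewrite -fE HH // (leq_trans kj).
  rewrite -p2; have := cmod_ge0 g`_j; nra.
have := root_cmod_le gm sg gb rw; rewrite le_max => /orP[] ?; lra.
Qed.

(* The two roots of largest modulus are close to the roots of X^2 + a X + b,
   which are not real because a^2 < 4 b. *)
Lemma nb_maxmod_conj_pair n f (H a b : R) : f \is monic -> size f = n.+4 ->
    (forall z, root f z -> root f (z^*)%C) ->
    f`_n.+2 = a%:C%C -> f`_n.+1 = b%:C%C -> H / 2 <= b <= H -> a ^+ 2 <= H ->
    (forall i, (i <= n)%N -> cmod f`_i <= H) -> 2 ^+ (3 * n.+3 + 9) < H ->
  nb_maxmod_roots f = 2%N.
Proof.
move=> fm sf fJ fa fb /andP[Hb bH] aH HH; set d := n.+3 => bigH.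
have [|z zf mz] := maxmod_attained fm; first by rewrite sf.
have rz : root f z by rewrite -mem_croots.
have [g [gm fE pg]] := croots_factor fm rz.
have sg := size_monic_factor gm fE sf.
set r := cmod z; have r0 : 0 <= r := cmod_ge0 z.
(* The threshold on H is 512 D^3 = 2 D (16 D)^2: together with H <= 2 D r^2, obtained below from H /
   2 <= b, it gives r > 16 D. *)
set D : R := 2 ^+ d; have D1 : 1 <= D by rewrite exprn_ege1 // ler1n.
have HD : 512 * (D * D * D) < H.
  move: bigH; rewrite exprD mulnC exprM -/D (_ : 2 ^+ 9 = 512); last by ring.
  by rewrite !exprS expr0; nra.
have Hr : H <= 2 * D * (r * r).
  have := coef_le_maxmod fm sf (_ : n.+1 <= n.+3)%N; rewrite fb cmod_real.
  rewrite subSS subSn ?leqnSn // subSnn.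
  have := ler_norm b; rewrite -mz -/r -/d -/D expr2 => h1 h2.
  have {}h2 : `|b| <= D * (r * r) := h2 (leqW (leqnSn _)).
  lra.
have rD : 16 * D < r.
  rewrite ltNge; apply/negP => rD.
  have h : r * r <= (16 * D) * (16 * D) by apply: ler_pM.
  have D2 : 0 <= 2 * D by lra.
  have {}h := ler_wpM2l D2 h.
  have e : 2 * D * (16 * D * (16 * D)) = 512 * (D * D * D) by ring.
  by have := lt_le_trans HD (le_trans Hr h); rewrite e ltxx.
have gb j : (j <= n.+1)%N -> r * cmod g`_j <= 2 * H.
  move=> jn; apply: quotient_coef_large => [|k kj]; first by rewrite -/r; lra.
  rewrite -fE; have := leq_trans kj jn; rewrite leq_eqVlt => /orP[/eqP ->|kn].
    by rewrite fb cmod_real ger0_norm //; lra.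
  exact: HH.
(* If z were a real number x, the quotient coefficient g_n = x^2 + a x + b would be at least b - a^2
   / 4 >= H / 4, against r |g_n| <= 2 H and r > 16. *)
have zJ : z != (z^*)%C.
  apply/negP => /eqP zJ; have [x zx] : exists x : R, z = x%:C%C.
    by case: z zJ {zf mz rz fE pg r r0 Hr rD gb} => x y [] /eqP; rewrite -addr_eq0;
      move=> h; exists x; rewrite (_ : y = 0) //; lra.
  have gn : g`_n = (b + a * x + x * x)%:C%C.
    have := congr1 (coefp n.+1) fE; have := congr1 (coefp n.+2) fE.
    rewrite /= !coef_XsubC_mul (coef_monic_top gm sg) fa fb zx => h1 h2.
    rewrite !rmorphD !rmorphM /= h1 h2; ring.
  have := gb n (leqnSn n); rewrite gn cmod_real.
  have := ler_norm (b + a * x + x * x); have := sqr_ge0 (a + 2 * x).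
  rewrite !expr2 in aH *; nra.
have gJ : root g (z^*)%C.
  have := fJ _ rz; rewrite fE rootM root_XsubC => /orP[/eqP h|//].
  by rewrite h eqxx in zJ.
have [q [qm gE pq]] := croots_factor gm gJ.
have sq := size_monic_factor qm gE sg.
(* Dividing by both z and its conjugate leaves |q_j| <= 4 H / r^2 <= 8 D, so the remaining roots
   have modulus at most 16 D < r. *)
have qb j : (j <= n)%N -> cmod q`_j <= 8 * D.
  move=> jn; have : cmod (z^*)%C * cmod q`_j <= 2 * (2 * H / r).
    apply: quotient_coef_large => [|k kj].
      by rewrite cmodJ -/r; lra.
    rewrite -gE ler_pdivlMr; last by lra.
    by rewrite mulrC; apply: gb; rewrite (leq_trans kj) // ltnW.
  have r1 : 0 < r by lra.
  rewrite cmodJ -/r mulrA ler_pdivlMr // => h; have := cmod_ge0 q`_j => q0.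
  rewrite leNgt; apply/negP => lt.
  have : 8 * D * (r * r) < cmod q`_j * (r * r) by rewrite ltr_pM2r // mulr_gt0.
  nra.
have pzz : perm_eq ([:: z; (z^*)%C] ++ croots q) (croots f).
  by rewrite (permPr (_ : perm_eq _ (z :: croots g))) ?perm_cons // perm_sym.
apply: (@maxmod_nb_unique _ _ [:: z; (z^*)%C] (croots q) r pzz _ _ _).2 => //.
  by move=> w; rewrite !inE => /orP[] /eqP ->; rewrite ?cmodJ.
move=> w; rewrite mem_croots // => rw.
have := root_cmod_le qm sq qb rw; rewrite le_max => /orP[] ?; lra.
Qed.

End MaxmodCriteria.

(** * Integer polynomials *)

Lemma coef_polyZC (R : realType) (f : {poly int}) i :
  (polyZC R f)`_i = (f`_i)%:~R.
Proof. exact: coef_map. Qed.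

Lemma polyZC_monic (R : realType) (f : {poly int}) :
  f \is monic -> polyZC R f \is monic.
Proof. exact: monic_map. Qed.

Lemma size_polyZC (R : realType) (f : {poly int}) : size (polyZC R f) = size f.
Proof. by apply: size_map_inj_poly => //; apply: intr_inj. Qed.

Lemma polyZC_mul (R : realType) (f g : {poly int}) :
  polyZC R (f * g) = polyZC R f * polyZC R g.
Proof. exact: rmorphM. Qed.

Lemma root_polyZC_conj (R : realType) (f : {poly int}) z :
  root (polyZC R f) z -> root (polyZC R f) (z^*)%C.
Proof.
rewrite -complex_root_conj; congr (root _ z).
by apply/polyP => i; rewrite coef_polyZC coef_map /= coef_polyZC rmorph_int.
Qed.

Lemma coef_le_height (f : {poly int}) i : (absz (f`_i)%R <= height f)%N.
Proof.
have [lti|lei] := ltnP i (size f); last by rewrite nth_default.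
exact: (leq_bigmax (F := fun i : 'I_(size f) => absz (f`_i)%R) (Ordinal lti)).
Qed.

Lemma height_leP (f : {poly int}) H :
  reflect (forall i, (absz (f`_i)%R <= H)%N) (height f <= H)%N.
Proof.
apply: (iffP idP) => [fH i|fH]; first exact: leq_trans (coef_le_height f i) fH.
by apply/bigmax_leqP => i _; apply: fH.
Qed.

Lemma height_attained (f : {poly int}) : exists i, absz (f`_i)%R = height f.
Proof.
have [s0|s0] := posnP (size f).
  by exists 0%N; rewrite /height s0 big_ord0 nth_default // s0.
have [|i Hi] := @bigop.eq_bigmax _ (fun i : 'I_(size f) => absz (f`_i)%R); first by rewrite card_ord.
by exists i.
Qed.

Lemma height_monic_gt0 (f : {poly int}) : f \is monic -> (0 < height f)%N.
Proof.
by move=> /monicP fm; apply: leq_trans (coef_le_height f (size f).-1);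
  rewrite -lead_coefE fm.
Qed.

Lemma cmod_coef_polyZC (R : realType) (f : {poly int}) i :
  cmod (polyZC R f)`_i = (absz (f`_i)%R)%:R.
Proof. by rewrite coef_polyZC cmod_int -abszE. Qed.

Lemma cmod_coef_le_height (R : realType) (f : {poly int}) H i :
  (height f <= H)%N -> cmod (polyZC R f)`_i <= H%:R.
Proof. by move=> /height_leP fH; rewrite cmod_coef_polyZC ler_nat. Qed.

Lemma size_monic_mul (g h : {poly int}) m e : g \is monic -> h \is monic ->
  size g = m.+1 -> size h = e.+1 -> size (g * h) = (m + e).+1.
Proof. by move=> gm hm sg sh; rewrite size_Mmonic ?monic_neq0 // sg sh addnS. Qed.

(** A crude constant for Gelfond's inequality on the heights of factors: 2^n compares coefficients
    with the Mahler measure, and 2^((n+1) n) is the cost of dividing by at most n roots. *)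
Definition gelfond n := (2 ^ (n + n.+1 * n))%N.

(** With M the Mahler measure of g, the coefficients of g are O(M), and M |h_j| is O(height of g h);
    M cancels in the product of the two bounds. *)
Lemma height_mul_le (R : realType) (g h : {poly int}) n : g \is monic -> h \is monic ->
  size (g * h) = n.+1 -> (height g * height h <= gelfond n * height (g * h))%N.
Proof.
move=> gm hm sgh.
have [i <-] := height_attained g; have [j <-] := height_attained h.
set s := croots (polyZC R g); pose M : R := (height (g * h))%:R.
have gE : polyZC R g = prod_roots s by apply/croots_monic/polyZC_monic.
have sn : (size s <= n)%N.
  rewrite size_croots ?polyZC_monic // size_polyZC.
  have : (size g <= size (g * h)%R)%N.
    by rewrite size_Mmonic ?monic_neq0 // (polySpred (monic_neq0 hm)) addnS leq_addr.
  by rewrite sgh; case: (size g).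
have h1 : cmod (polyZC R g)`_i <= 2 ^+ size s * mahler s.
  by rewrite gE coef_prod_roots_le.
have h2 : mahler s * cmod (polyZC R h)`_j <= 2 ^+ (n.+1 * size s) * M.
  apply: mahler_mul_coef => [|k]; rewrite -gE -polyZC_mul ?size_polyZC ?sgh //.
  exact: cmod_coef_le_height.
have h3 : 2 ^+ (size s + n.+1 * size s) <= 2 ^+ (n + n.+1 * n) :> R.
  by rewrite ler_weXn2l ?ler1n // leq_add // leq_mul.
have M0 : 0 <= M by [].
rewrite !cmod_coef_polyZC in h1 h2.
rewrite -(ler_nat R) !natrM natrX (le_trans _ (ler_wpM2r M0 h3)) //.
apply: le_trans (_ : 2 ^+ size s * mahler s * (absz (h`_j)%R)%:R <= _).
  by rewrite ler_wpM2r.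
by rewrite exprD -!mulrA ler_wpM2l // exprn_ge0.
Qed.

Lemma size_monic_unit (f : {poly int}) : f \is monic -> (1 < size f)%N ->
  f \isn't a GRing.unit.
Proof. by move=> fm sf; rewrite poly_unitE; case: (size f) sf => [|[|]]. Qed.

Lemma reducibleZ_mul (g h : {poly int}) : g \is monic -> h \is monic ->
  (1 < size g)%N -> (1 < size h)%N -> reducibleZ (g * h).
Proof.
move=> gm hm sg sh; have ghm : g * h \is monic by rewrite monicMl.
split; first exact: monic_neq0.
  apply: size_monic_unit => //; rewrite size_Mmonic ?monic_neq0 //.
  by lia.
case=> _ _ /(_ g h erefl)[]; apply/negP; exact: size_monic_unit.
Qed.

Lemma nonirreducibleZ_factor (f : {poly int}) : f \is monic -> (1 < size f)%N ->
    ~ irreducibleZ f -> exists g h : {poly int},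
  [/\ g \is monic, h \is monic, (1 < size g)%N, (1 < size h)%N & f = g * h].
Proof.
move=> fm sf nirr.
have [g [h [fE gu hu]]] : exists g h : {poly int},
    [/\ f = g * h, g \isn't a GRing.unit & h \isn't a GRing.unit].
  apply/not_existsP => H; apply: nirr; split; [exact: monic_neq0|exact: size_monic_unit|].
  move=> g h fE; have [gu|gu] := boolP (g \is a GRing.unit); first by left.
  right; apply/negP => /negP hu; apply: (H g); by exists h.
have lgh : lead_coef g * lead_coef h = 1.
  by rewrite -lead_coefM -fE; apply/monicP.
have lg2 : lead_coef g ^+ 2 = 1.
  have : lead_coef g \is a GRing.unit by apply/unitrP; exists (lead_coef h);
    rewrite mulrC lgh.
  by rewrite unfold_in => /orP[] /eqP ->.
have lhE : lead_coef h = lead_coef g.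
  by rewrite -[LHS]mul1r -lg2 expr2 -mulrA lgh mulr1.
have szl (p : {poly int}) : lead_coef p ^+ 2 = 1 -> p \isn't a GRing.unit -> (1 < size p)%N.
  move=> lp; rewrite poly_unitE; apply: contraR; rewrite -leqNgt => sp.
  have p0 : p != 0 by apply/eqP => p0; rewrite p0 lead_coef0 expr0n in lp.
  have s1 : size p = 1%N by apply/eqP; rewrite eqn_leq sp size_poly_gt0.
  rewrite s1 eqxx /=; apply/unitrP; exists (p`_0).
  by move: lp; rewrite lead_coefE s1 expr2.
have lg0 : lead_coef g != 0 by apply/eqP => e; rewrite e expr0n in lg2.
(* Both leading coefficients are the same sign; multiplying both factors by it makes them monic and
   leaves the product unchanged. *)
exists (lead_coef g *: g), (lead_coef g *: h); split.
- by rewrite monicE lead_coefZ -expr2 lg2.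
- by rewrite monicE lead_coefZ lhE -expr2 lg2.
- by rewrite size_scale // szl.
- by rewrite size_scale // szl // lhE.
- by rewrite -scalerAl -scalerAr scalerA -expr2 lg2 scale1r.
Qed.

Lemma reducibleZ_factor (f : {poly int}) n : f \is monic -> size f = n.+1 ->
    reducibleZ f -> exists (g h : {poly int}) m e,
  [/\ [/\ g \is monic, h \is monic & f = g * h], size g = m.+1, size h = e.+1,
      (0 < m <= e)%N & n = (m + e)%N].
Proof.
move=> fm sf [_ fu /(nonirreducibleZ_factor fm)] []; last move=> g [h].
  rewrite sf; case: n sf => // sf; move: fu; rewrite poly_unitE sf /=.
  by move/monicP: fm; rewrite lead_coefE sf /= => ->.
move=> [gm hm sg sh fE].
wlog le : g h gm hm sg sh fE / (size g <= size h)%N => [W|].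
  case: (leqP (size g) (size h)) => [|/ltnW] le; first exact: (W g h).
  by apply: (W h g) => //; rewrite mulrC.
exists g, h, (size g).-1, (size h).-1; split => //.
- by case: (size g) sg.
- by case: (size h) sh.
- by lia.
- apply/succn_inj; rewrite -sf fE size_Mmonic ?monic_neq0 //.
  by lia.
Qed.

Lemma irreducibleZ_monic (f : {poly int}) : f \is monic -> (1 < size f)%N ->
    (forall g h : {poly int}, g \is monic -> h \is monic ->
       (1 < size g)%N -> (1 < size h)%N -> f <> g * h) ->
  irreducibleZ f.
Proof.
move=> fm sf H; apply: contrapT => /(nonirreducibleZ_factor fm sf)[g [h [gm hm sg sh]]].
exact: H.
Qed.

Lemma irreducibleZ_nonfactor (f g h : {poly int}) : irreducibleZ f ->
  g \is monic -> h \is monic -> (1 < size g)%N -> (1 < size h)%N -> f <> g * h.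
Proof.
move=> [_ _ irr] gm hm sg sh /irr[] /idP; apply/negP; exact: size_monic_unit.
Qed.

(** * Families of sets with polynomially bounded cardinality *)

Section PolynomialGrowth.
Variables (R : realType) (T : choiceType).
Implicit Types (A B : nat -> set T) (a b s : R).

Definition growth_le A s := exists2 C : R, 0 < C &
  forall n, (0 < n)%N -> card_at_most (A n) (C * n%:R `^ s).

Lemma powR_nat_ge1 (n : nat) s : (0 < n)%N -> 0 <= s -> 1 <= (n%:R : R) `^ s.
Proof.
move=> n0 s0; have n1 : 1 <= n%:R :> R by rewrite ler1n.
by have := ler_powR n1 s0; rewrite powRr0.
Qed.

Lemma ler_powR_nat (n : nat) a b : (0 < n)%N -> a <= b -> (n%:R : R) `^ a <= n%:R `^ b.
Proof. by move=> n0 ab; apply: ler_powR; rewrite ?ler1n. Qed.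

Lemma growth_le_sub A B a b : (forall n, (0 < n)%N -> A n `<=` B n) -> a <= b ->
  growth_le B a -> growth_le A b.
Proof.
move=> AB ab [C C0 HC]; exists C => // n n0.
apply: (card_at_most_sub (AB n n0) _ (HC n n0)).
by rewrite ler_pM2l // ler_powR_nat.
Qed.

Lemma growth_leU A B s : growth_le A s -> growth_le B s ->
  growth_le (fun n => A n `|` B n) s.
Proof.
move=> [C C0 HC] [D D0 HD]; exists (C + D); first exact: addr_gt0.
by move=> n n0; rewrite mulrDl; apply: card_at_mostU; [exact: HC|exact: HD].
Qed.

Lemma growth_le_bigcup k (F : nat -> nat -> set T) s :
  (forall i, (i < k)%N -> growth_le (F i) s) ->
  growth_le (fun n => \bigcup_(i in [set i | (i < k)%N]) F i n) s.
Proof.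
move=> H; have {}H i : {C : R | 0 < C & (i < k)%N ->
    forall n, (0 < n)%N -> card_at_most (F i n) (C * n%:R `^ s)}.
  apply: cid2; have [/H [C C0 HC]|ki] := ltnP i k; first by exists C.
  by exists 1.
exists (1 + \sum_(i < k) sval (sig_of_sig2 (H i))).
  rewrite ltr_pwDl // sumr_ge0 // => i _; case: (H i) => /= C C0 _; exact: ltW.
move=> n n0; rewrite mulrDl mulr_suml.
apply: (@card_at_most_sub _ _ _ _ _ _ (@subset_refl _ _)); last first.
  apply: card_at_most_bigcup => i lik.
  exact: (s2valP' (H i)) lik n n0.
by rewrite lerDr mul1r powR_ge0.
Qed.

End PolynomialGrowth.

(** * Growth of families given by ranges for the coefficients *)

Section Boxes.
Variable R : realType.

Lemma monic_height_le_box m T :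
  monic_height_le m T `<=` box (nseq m (int_range (T%:R : R))).
Proof.
move=> f [fm sf /height_leP fT]; split; rewrite ?size_nseq // => i im.
rewrite nth_nseq im mem_int_range // -abszE.
exact: (etrans (ler_nat _ _ _) (fT i)).
Qed.

Lemma box_monic_height_le m T : (0 < T)%N ->
  box (nseq m (int_range (T%:R : R))) `<=` monic_height_le m T.
Proof.
move=> T0 f [fm]; rewrite size_nseq => sf Hf; split => //; apply/height_leP => i.
case: (ltngtP i m) => [im|im|->].
- by have := Hf i im; rewrite nth_nseq im mem_int_range // -abszE => h; rewrite -(ler_nat R).
- by rewrite nth_default // sf.
- by move/monicP: fm; rewrite lead_coefE sf /= => ->.
Qed.

Lemma prod_nseq_size m (s : seq int) :
  \prod_(t <- nseq m s) ((size t)%:R : R) = (size s)%:R ^+ m.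
Proof. by rewrite big_nseq; elim: m => [|m IH] //=; rewrite IH exprS. Qed.

Lemma natr_doubleS T : (T.*2.+1)%:R = 2 * T%:R + 1 :> R.
Proof. by rewrite -[T.*2.+1]addn1 natrD -mul2n natrM. Qed.

Lemma card_at_most_monic m T :
  card_at_most (monic_height_le m T) ((2 * T%:R + 1 : R) ^+ m).
Proof.
apply: card_at_most_sub (@monic_height_le_box m T) _ (card_at_most_box _ _).
by rewrite prod_nseq_size size_int_range_nat natr_doubleS.
Qed.

Lemma card_at_least_monic m T : (0 < T)%N ->
  card_at_least (monic_height_le m T) ((2 * T%:R + 1 : R) ^+ m).
Proof.
move=> T0; apply: card_at_least_sub (@box_monic_height_le m T T0) _ (card_at_least_box _ _).
  by rewrite prod_nseq_size size_int_range_nat natr_doubleS.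
by apply/allP => s /nseqP[-> _]; apply: int_range_uniq.
Qed.

Lemma growth_monic m : growth_le (monic_height_le m) (m%:R : R).
Proof.
exists (3 ^+ m); first by rewrite exprn_gt0.
move=> n n0; apply: card_at_most_sub (@subset_refl _ _) _ (card_at_most_monic m n).
rewrite powR_mulrn // -exprMn lerXn2r ?nnegrE ?addr_ge0 ?mulr_ge0 //.
have : 1 <= n%:R :> R by rewrite ler1n.
lra.
Qed.

Lemma powR_half (x : R) m : 0 < x -> x ^+ m * Num.sqrt x = x `^ (m.+1%:R - 1 / 2).
Proof.
move=> x0; rewrite -powR12_sqrt ?ltW // -powR_mulrn ?ltW // -powRD; last first.
  by rewrite (gt_eqF x0) implybT.
by congr (_ `^ _); rewrite -[m.+1]addn1 natrD; lra.
Qed.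

(* If two or more roots have maximal modulus, then the subleading coefficient is
   O(sqrt(height)), by [nb_maxmod_dominant]. *)
Lemma growth_subleading_sqrt m (c : R) : 1 <= c ->
  growth_le (fun n => [set f | monic_height_le m.+2 n f /\
     `|f`_m.+1|%:~R <= c * Num.sqrt n%:R]) (m.+2%:R - 1 / 2 : R).
Proof.
move=> c1; exists (3 ^+ m.+1 * (3 * c)); first by rewrite mulr_gt0 ?exprn_gt0 //; lra.
move=> n n0; have n1 : 1 <= n%:R :> R by rewrite ler1n.
have s1 : 1 <= Num.sqrt n%:R :> R by rewrite -[leLHS]sqrtr1 ler_wsqrtr.
set S := rcons (nseq m.+1 (int_range (n%:R : R))) (int_range (c * Num.sqrt n%:R)).
apply: card_at_most_sub (_ : _ `<=` box S) _ (card_at_most_box _ _).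
  move=> f [fn fs]; have [fm sf fH] := monic_height_le_box fn.
  rewrite size_nseq in sf fH; split; rewrite ?size_rcons ?size_nseq // => i.
  rewrite ltnS leq_eqVlt nth_rcons size_nseq => /orP[/eqP ->|im].
    by rewrite ltnn eqxx mem_int_range // mulr_ge0 ?sqrtr_ge0 //; lra.
  rewrite im nth_nseq im; have := fH i (leqW im).
  by rewrite nth_nseq (leqW im).
rewrite /S -cats1 big_cat big_seq1 prod_nseq_size -powR_half; last by lra.
have cs : 1 <= c * Num.sqrt n%:R by apply: mulr_ege1.
rewrite [leRHS](_ : _ = (3 * n%:R) ^+ m.+1 * (3 * (c * Num.sqrt n%:R))); last first.
  by rewrite exprMn; ring.
apply: ler_pM; rewrite ?exprn_ge0 //.
  by rewrite lerXn2r ?nnegrE //; apply: size_int_range_le3.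
exact: size_int_range_le3.
Qed.

Lemma multiple_maxmod_subleading m n (f : {poly int}) : (0 < n)%N ->
    monic_height_le m.+2 n f -> nb_maxmod_roots (polyZC R f) != 1%N ->
  `|f`_m.+1|%:~R <= 4 * m.+2%:R * Num.sqrt n%:R :> R.
Proof.
move=> n0 [fm sf fn]; apply: contraR; rewrite -ltNge => big.
apply/eqP/(@nb_maxmod_dominant _ m _ n%:R).
- exact: polyZC_monic.
- by rewrite size_polyZC.
- by rewrite ler1n.
- by move=> i _; apply: cmod_coef_le_height.
- by rewrite coef_polyZC cmod_int.
Qed.

Lemma growth_multiple_maxmod m :
  growth_le (fun n => [set f | monic_height_le m.+2 n f /\
     nb_maxmod_roots (polyZC R f) != 1%N]) (m.+2%:R - 1 / 2 : R).
Proof.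
apply: growth_le_sub (lexx _) (@growth_subleading_sqrt m (4 * m.+2%:R) _).
  by move=> n n0 f [fn nb]; split => //; apply: multiple_maxmod_subleading.
have : 1 <= m.+2%:R :> R by rewrite ler1n.
lra.
Qed.

(* The constant coefficient is determined by the other ones and the root. *)
Lemma card_at_most_root e n (z : R[i]) : (0 < n)%N ->
  card_at_most [set h | monic_height_le e.+1 n h /\ root (polyZC R h) z]
    ((3 * n%:R : R) ^+ e).
Proof.
move=> n0; pose F (p : {poly int}) := cons_poly
  (xget 0 [set c : int | root (polyZC R (cons_poly c p)) z]) p.
apply: (@card_at_most_image _ _ _ F (monic_height_le e n)).
  move=> h [[hm sh /height_leP hn] hz].
  have [m sz] := monic_uncons_poly hm sh.
  exists (\poly_(i < e.+1) h`_i.+1).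
    split => //; apply/height_leP => i; rewrite coef_poly.
    by case: ifP => _ //; rewrite absz0.
  have hE := cons_poly_eq h; rewrite sh /= in hE.
  rewrite {1}hE /F; congr (cons_poly _ _); set S := [set _ | _].
  have S0 : S h`_0 by rewrite /S /= -hE.
  have := xgetPex 0 (ex_intro _ _ S0); set c := xget _ _ => Sc.
  have e1 (d : int) : S d -> d%:~R = - ((polyZC R (\poly_(i < e.+1) h`_i.+1)).[z] * z).
    rewrite /S /= /polyZC cons_poly_def rmorphD rmorphM /= map_polyX map_polyC rootE.
    by rewrite !hornerE addrC addr_eq0 => /eqP.
  by apply: (@intr_inj R[i]); rewrite (e1 _ S0) (e1 _ Sc).
apply: card_at_most_sub (@subset_refl _ _) _ (card_at_most_monic e n).
rewrite lerXn2r ?nnegrE ?addr_ge0 ?mulr_ge0 //.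
have : 1 <= n%:R :> R by rewrite ler1n.
lra.
Qed.

End Boxes.

(** * Counting products by the heights of the factors *)

Section Pairs.
Variable R : realType.

Lemma sum_geom_lt1 (q : R) n : 0 <= q < 1 -> \sum_(i < n) q ^+ i <= (1 - q)^-1.
Proof.
move=> /andP[q0 q1]; rewrite -[leRHS]mul1r ler_pdivlMr ?subr_gt0 //.
have := subrX1 q n; have := exprn_ge0 n q0; set S := \sum_(_ < _) _ => h e; nra.
Qed.

Lemma sum_geom_gt1 (q : R) n : 1 < q -> \sum_(i < n) q ^+ i <= q ^+ n / (q - 1).
Proof.
move=> q1; rewrite ler_pdivlMr ?subr_gt0 //.
have := subrX1 q n; set S := \sum_(_ < _) _ => e; lra.
Qed.

(* Dyadic decomposition according to the height of the first factor. *)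
Lemma growth_le_products (P : {poly int} -> {poly int} -> Prop) (a b s D : R) K :
    a != b -> 0 <= b -> a <= s -> b <= s -> 0 < D -> (0 < K)%N ->
    (forall g h, P g h -> g \is monic /\ h \is monic) ->
    growth_le (fun n => [set g | (height g <= n)%N /\ exists h, P g h]) a ->
    (forall g n, (0 < n)%N ->
      card_at_most [set h | (height h <= n)%N /\ P g h] (D * n%:R `^ b)) ->
  growth_le (fun n => [set f | exists g h, [/\ P g h, f = g * h &
    (height g * height h <= K * n)%N]]) s.
Proof.
move=> ab b0 as_ bs D0 K0 Pm [C C0 HC] HD.
(* With X = K n, the block of height(g) about 2^i contributes (2^i)^a (X / 2^i)^b = X^b q^i up to a
   constant, and q is not 1 because a and b differ. If q < 1 the first block dominates and the sum
   is O(X^b); if q > 1 the last one, with 2^i about X, gives O(X^a). *)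
pose q : R := 2 `^ (a - b); have q0 : 0 < q by rewrite powR_gt0.
pose M : R := if q < 1 then (1 - q)^-1 else q / (q - 1).
have two1 : 1 <= 2 :> R by rewrite ler1n.
have qn1 : q != 1.
  rewrite powR_eq1 subr_eq0 (negPf ab) orbF; apply/negP => /orP[/eqP|] ?; lra.
have M0 : 0 < M.
  rewrite /M; case: (ltP q 1) => q1; first by rewrite invr_gt0 subr_gt0.
  by rewrite divr_gt0 // subr_gt0 lt_neqAle eq_sym qn1.
exists (C * D * 2 `^ a * M * K%:R `^ s).
  by rewrite !mulr_gt0 ?powR_gt0 ?ltr0n.
move=> n n0; set X := (K * n)%N; have X0 : (0 < X)%N by rewrite muln_gt0 K0.
have Xr : 1 <= X%:R :> R by rewrite ler1n.
set L := trunc_log 2 X; have /andP[LX _] := trunc_log_bounds (isT : 1 < 2)%N X0.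
have X0r : 0 < X%:R :> R by lra.
have qX : X%:R `^ b * (\sum_(i < L.+1) q ^+ i) <= M * X%:R `^ s.
  rewrite /M; case: (ltP q 1) => q1.
    rewrite mulrC; apply: ler_pM; rewrite ?powR_ge0 //.
    - by apply: sumr_ge0 => i _; rewrite exprn_ge0 ?ltW.
    - by apply: sum_geom_lt1; rewrite q1 ltW.
    - exact: ler_powR_nat.
  have {}q1 : 1 < q by rewrite lt_neqAle eq_sym qn1.
  have ba : 0 <= a - b.
    rewrite leNgt; apply/negP => /ltW /(ler_powR two1).
    by rewrite powRr0 leNgt q1.
  have qL : q ^+ L <= X%:R `^ (a - b).
    rewrite -powR_mulrn ?(ltW q0) // /q -powRrM mulrC powRrM powR_mulrn // -natrX.
    by apply: (ge0_ler_powR ba); rewrite ?nnegrE ?ler_nat.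
  have q10 : 0 <= q / (q - 1) by rewrite divr_ge0 ?subr_ge0 ?(ltW q0) ?(ltW q1).
  have h : \sum_(i < L.+1) q ^+ i <= q / (q - 1) * X%:R `^ (a - b).
    by rewrite (le_trans (sum_geom_gt1 L.+1 q1)) // exprS mulrAC ler_wpM2l.
  have e : X%:R `^ a = X%:R `^ b * X%:R `^ (a - b) :> R.
    by rewrite -powRD ?(gt_eqF X0r) ?implybT //; congr (_ `^ _); lra.
  apply: le_trans (_ : q / (q - 1) * X%:R `^ a <= _).
    by rewrite e mulrCA ler_wpM2l ?powR_ge0.
  by rewrite ler_wpM2l // ler_powR_nat.
(* The lower bound 2^i <= height(g) is only used through its consequence height(h) <= X / 2^i. *)
pose F i := [set f | exists g h, [/\ P g h, f = g * h, (height g <= 2 ^ i.+1)%N &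
  (height h <= X %/ 2 ^ i)%N]].
have FX i : (i < L.+1)%N ->
    card_at_most (F i) (C * D * 2 `^ a * X%:R `^ b * q ^+ i : R).
  move=> iL; pose A := [set p : {poly int} * {poly int} |
    [/\ P p.1 p.2, (height p.1 <= 2 ^ i.+1)%N & (height p.2 <= X %/ 2 ^ i)%N]].
  have iX : (0 < X %/ 2 ^ i)%N.
    by rewrite divn_gt0 ?expn_gt0 // (leq_trans _ LX) // leq_exp2l.
  have pos2 : 0 < 2 ^+ i :> R by rewrite exprn_gt0.
  apply: (@card_at_most_image _ _ _ (fun p => p.1 * p.2) A).
    by move=> f [g [h [Pgh -> hg hh]]]; exists (g, h).
  apply: card_at_most_sub (@subset_refl _ _) _
    (@card_at_most_pair _ _ _ A [set g | (height g <= 2 ^ i.+1)%N /\ exists h, P g h]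
      (C * (2 ^ i.+1)%:R `^ a) (D * (X %/ 2 ^ i)%:R `^ b) _ _ _ _).
  - have -> : C * D * 2 `^ a * X%:R `^ b * q ^+ i =
      (C * (2 ^ i.+1)%:R `^ a) * (D * (X%:R / 2 ^+ i) `^ b).
      have -> : q ^+ i = (2 ^+ i) `^ a * (2 ^+ i) `^ (- b).
        rewrite -powRD ?(gt_eqF pos2) ?implybT // /q -powR_mulrn ?powR_ge0 //.
        by rewrite -powRrM mulrC powRrM powR_mulrn.
      rewrite expnS natrM natrX !powRM ?invr_ge0 ?exprn_ge0 //.
      by rewrite -[(2 ^+ i)^-1]powR_inv1 ?(ltW pos2) // -powRrM mulN1r; ring.
    rewrite ler_wpM2l ?mulr_ge0 ?powR_ge0 ?(ltW C0) // ler_wpM2l ?(ltW D0) //.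
    apply: (ge0_ler_powR b0); rewrite ?nnegrE ?divr_ge0 ?(ltW pos2) //.
    by rewrite ler_pdivlMr // -natrX -natrM ler_nat leq_trunc_div.
  - by move=> [g h] [/= Pgh hg hh]; split => //; exists h.
  - by apply: HC; rewrite expn_gt0.
  - by rewrite mulr_ge0 ?powR_ge0 // ltW.
  - move=> g _; apply: card_at_most_sub _ (lexx _) (HD g _ iX).
    by move=> h [/= Pgh hg hh].
apply: card_at_most_sub _ _ (card_at_most_bigcup FX).
  move=> f [g [h [Pgh fE hgh]]]; have [gm hm] := Pm _ _ Pgh.
  have g0 := height_monic_gt0 gm; have h0 := height_monic_gt0 hm.
  have /andP[lo hi] := trunc_log_bounds (isT : 1 < 2)%N g0.
  exists (trunc_log 2 (height g)).
    by rewrite /= ltnS leq_trunc_log // (leq_trans _ hgh) // leq_pmulr.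
  exists g, h; split => //; first exact: ltnW.
  by rewrite leq_divRL ?expn_gt0 // mulnC (leq_trans _ hgh) // leq_mul2r lo orbT.
rewrite -mulr_sumr -mulrA -mulrA [leRHS](_ : _ = C * D * 2 `^ a * (M * X%:R `^ s)).
  by rewrite -!mulrA !ler_pM2l ?powR_gt0 // mulrA.
by rewrite natrM powRM // -!mulrA.
Qed.
End Pairs.

(** * Reducible polynomials *)

Section Reducible.
Variable R : realType.

Lemma mem_maxmod_split (f : {poly R[i]}) s t z : perm_eq (s ++ t) (croots f) ->
    {in t, forall w, cmod w < maxmod f} -> z \in croots f ->
  cmod z = maxmod f -> z \in s.
Proof.
move=> pst tr; rewrite -(perm_mem pst) mem_cat => /orP[//|/tr zr] e.
by rewrite e ltxx in zr.
Qed.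

Lemma nb_maxmod_mul (g h : {poly R[i]}) : g \is monic -> h \is monic ->
    (1 < size g)%N -> (1 < size h)%N ->
  [\/ maxmod h < maxmod g /\ nb_maxmod_roots (g * h) = nb_maxmod_roots g,
      maxmod g < maxmod h /\ nb_maxmod_roots (g * h) = nb_maxmod_roots h
    | maxmod g = maxmod h /\
      nb_maxmod_roots (g * h) = (nb_maxmod_roots g + nb_maxmod_roots h)%N].
Proof.
wlog le : g h / maxmod h <= maxmod g => [W|] gm hm sg sh.
  have /orP[le|le] := le_total (maxmod h) (maxmod g); first exact: W.
  rewrite mulrC addnC; case: (W h g le hm gm sh sg) => [H|H|[e n]].
  - by constructor 2.
  - by constructor 1.
  - by constructor 3.
have pgh := croots_mul gm hm.
have [s [t [pst sr tr ns]]] := maxmod_split g.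
have [s' [t' [pst' sr' tr' ns']]] := maxmod_split h.
have s0 : s != [::] by rewrite -size_eq0 ns -lt0n nb_maxmod_gt0.
move: le; rewrite le_eqVlt => /orP[/eqP e|lt]; last first.
  constructor 1; split => //.
  rewrite -ns; apply: (nb_maxmod_unique (t := t ++ croots h) (r := maxmod g)) => //.
    by rewrite -(permPr pgh) catA perm_cat2r.
  move=> z; rewrite mem_cat => /orP[/tr //|/maxmod_ge zh].
  exact: le_lt_trans lt.
constructor 3; split => //; rewrite -ns -ns' -size_cat.
apply: (nb_maxmod_unique (t := t ++ t') (r := maxmod g)).
- by rewrite -(permPr pgh) perm_catACA /= perm_cat.
- by case: s s0 {pst sr ns}.
- by move=> z; rewrite mem_cat => /orP[/sr//|/sr' ->].
- by move=> z; rewrite mem_cat => /orP[/tr//|/tr']; rewrite e.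
Qed.

(** The conjugate of a root of maximal modulus is another one, so a single such root is real, hence
    plus or minus its modulus. *)
Lemma maxmod_root_real (f : {poly int}) : f \is monic -> (1 < size f)%N ->
    nb_maxmod_roots (polyZC R f) = 1%N ->
  root (polyZC R f) (maxmod (polyZC R f))%:C%C \/
  root (polyZC R f) (- (maxmod (polyZC R f))%:C%C).
Proof.
move=> fm sf nb; have fm' := polyZC_monic R fm.
have [|z zf mz] := maxmod_attained fm'; first by rewrite size_polyZC.
have rz : root (polyZC R f) z by rewrite -mem_croots.
have [s [t [pst sr tr ns]]] := maxmod_split (polyZC R f).
have zs := mem_maxmod_split pst tr zf mz.
have zJs : (z^*)%C \in s.
  apply: (mem_maxmod_split pst tr); last by rewrite cmodJ.
  by rewrite mem_croots //; apply: root_polyZC_conj.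
have zJ : (z^*)%C = z.
  rewrite nb in ns; case: s ns zs zJs {pst sr} => [|x [|]] //= _.
  by rewrite !inE => /eqP -> /eqP.
have [x zx] : exists x : R, z = x%:C%C.
  case: z zJ {zf mz rz zs zJs} => x y [] h; exists x.
  have y0 : y = 0 by lra.
  by rewrite y0.
rewrite -mz zx cmod_real; rewrite zx in rz.
have [x0|x0] := leP 0 x; first by left; rewrite ger0_norm.
by right; rewrite ltr0_norm // rmorphN opprK.
Qed.

Lemma growth_le_set0 (s : R) : growth_le (fun=> (set0 : set {poly int})) s.
Proof.
exists 1 => // n _; exists [::]; split => //.
by rewrite mul1r powR_ge0.
Qed.

Definition factor_degrees m e (g h : {poly int}) :=
  [/\ g \is monic, h \is monic, size g = m.+1 & size h = e.+1].

Lemma growth_le_degrees m e (Q : {poly int} -> {poly int} -> Prop) :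
  growth_le (fun n => [set g | (height g <= n)%N /\ exists h,
    factor_degrees m e g h /\ Q g h]) (m%:R : R).
Proof.
apply: growth_le_sub (lexx _) (growth_monic R m) => n n0 g [gn [h [[gm _ sg _] _]]].
by split.
Qed.

Lemma growth_le_prod_any m e (Q : {poly int} -> {poly int} -> Prop) (a s : R) N :
    a != e%:R -> a <= s -> e%:R <= s ->
    growth_le (fun n => [set g | (height g <= n)%N /\ exists h,
      factor_degrees m e g h /\ Q g h]) a ->
  growth_le (fun n => [set f | exists g h, [/\ factor_degrees m e g h /\ Q g h,
    f = g * h & (height g * height h <= gelfond N * n)%N]]) s.
Proof.
move=> ae as_ es Hg.
apply: (@growth_le_products R _ a e%:R s (3 ^+ e) (gelfond N) _ _ _ _ _ _ _ Hg) => //.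
- by rewrite /gelfond expn_gt0.
- by move=> g h [[]].
- move=> g n n0; apply: card_at_most_sub (@subset_refl _ _) _ _; last first.
    apply: card_at_most_sub _ (lexx _) (card_at_most_monic R e n).
    by move=> h [hn [[gm hm sg sh] _]].
  rewrite powR_mulrn // -exprMn lerXn2r ?nnegrE ?addr_ge0 ?mulr_ge0 //.
  have : 1 <= n%:R :> R by rewrite ler1n.
  lra.
Qed.

Lemma height_factors N n (f g h : {poly int}) : monic_height_le N n f ->
    f = g * h -> g \is monic -> h \is monic ->
  (height g * height h <= gelfond N * n)%N.
Proof.
move=> [_ sf fn] fE gm hm; rewrite fE in sf fn.
by apply: leq_trans (height_mul_le R gm hm sf) _; rewrite leq_mul2l fn orbT.
Qed.

Lemma growth_reducible N : (3 <= N)%N ->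
  growth_le (fun n => [set f | monic_height_le N n f /\ reducibleZ f]) (N%:R - 1 : R).
Proof.
move=> N3; pose F m n : set {poly int} := [set f | exists g h,
  [/\ factor_degrees m (N - m) g h /\ (0 < m <= N - m)%N, f = g * h &
      (height g * height h <= gelfond N * n)%N]].
apply: growth_le_sub (_ : forall n, (0 < n)%N -> _ `<=`
    \bigcup_(m in [set m | (m < N)%N]) F m n) (lexx _) (growth_le_bigcup _).
  move=> n n0 f [fn red]; have [fm sf _] := fn.
  have [g [h [m [e [[gm hm fE] sg sh me NE]]]]] := reducibleZ_factor fm sf red.
  exists m; first by rewrite /=; lia.
  exists g, h; split => //; last exact: height_factors fn fE gm hm.
  by rewrite NE addKn.
move=> m mN; have [me|me] := boolP (0 < m <= N - m)%N; last first.
  apply: growth_le_sub (lexx _) (growth_le_set0 _) => n n0 f [g [h [[_ mm] _ _]]].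
  by rewrite mm in me.
have Nm : N%:R = m%:R + (N - m)%:R :> R by rewrite -natrD subnKC // ltnW.
have mr : 1 <= m%:R :> R by rewrite ler1n; case/andP: me.
have mer : m%:R <= (N - m)%:R :> R by rewrite ler_nat; case/andP: me.
have N3r : 3%:R <= N%:R :> R by rewrite ler_nat.
(* The first factors are O(n^m), but m may equal N - m; the weaker exponent m + 1/2 never does, and
   it is still at most N - 1 because m <= N / 2 and N >= 3. *)
apply: (@growth_le_prod_any m (N - m) (fun _ _ => (0 < m <= N - m)%N) (m%:R + 1 / 2)).
- apply/eqP => e; have : m.*2.+1%:R = (N - m).*2%:R :> R.
    by rewrite natr_doubleS -mul2n natrM -e; lra.
  by move/eqP; rewrite eqr_nat => /eqP; lia.
- lra.
- lra.
- by apply: (growth_le_sub (fun n _ => @subset_refl _ _) _ (growth_le_degrees _ _ _)); lra.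
Qed.

Lemma nat_neq_half m e : m%:R - 1 / 2 != e%:R :> R.
Proof.
apply/eqP => h; have : m.*2%:R = e.*2.+1%:R :> R.
  by rewrite natr_doubleS -mul2n natrM; lra.
by move/eqP; rewrite eqr_nat => /eqP; lia.
Qed.

(** There are O(n^(m - 1/2)) polynomials g with two roots of maximal modulus and O(n^e) polynomials
    h; a half-integer never equals e. Both exponents are at most m + e - 3/2, as e >= 1 and two
    roots force m >= 2. *)
Lemma growth_prod_two_maxmod m e : (0 < e)%N ->
  growth_le (fun n => [set f | exists g h, [/\ factor_degrees m e g h /\
      nb_maxmod_roots (polyZC R g) = 2%N, f = g * h &
      (height g * height h <= gelfond (m + e) * n)%N]]) ((m + e)%:R - 3 / 2 : R).
Proof.
move=> e0; have er : 1 <= e%:R :> R by rewrite ler1n.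
have [m2|m2] := leqP m 1; last first.
  have mr : 2%:R <= m%:R :> R by rewrite ler_nat.
  apply: (@growth_le_prod_any m e (fun g _ => nb_maxmod_roots (polyZC R g) = 2%N)
    (m%:R - 1 / 2)); rewrite ?nat_neq_half ?natrD //; try lra.
  case: m m2 {mr} => [|[|m]] // _.
  apply: growth_le_sub (lexx _) (growth_multiple_maxmod R m).
  by move=> n n0 g [gn [h [[gm _ sg _] nb]]]; split => /=; [split|rewrite nb].
apply: growth_le_sub (lexx _) (growth_le_set0 _).
move=> n n0 f [g [h [[[gm _ sg _] nb] _ _]]].
have : (nb_maxmod_roots (polyZC R g) <= m)%N.
  by rewrite (leq_trans (count_size _ _)) // size_croots ?polyZC_monic // size_polyZC sg.
by rewrite nb ltnNge m2.
Qed.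

(* When each factor has one root of maximal modulus, it is real, and the two
   are equal up to sign. *)
Lemma growth_prod_shared_root m e : (0 < m <= e)%N -> (3 <= m + e)%N ->
  growth_le (fun n => [set f | exists g h, [/\ factor_degrees m e g h /\
      (root (polyZC R h) (maxmod (polyZC R g))%:C%C \/
       root (polyZC R h) (- (maxmod (polyZC R g))%:C%C)), f = g * h &
      (height g * height h <= gelfond (m + e) * n)%N]]) ((m + e)%:R - 3 / 2 : R).
Proof.
move=> /andP[m0 me] me3; set Q := fun g h => root (polyZC R h) (maxmod (polyZC R g))%:C%C \/
  root (polyZC R h) (- (maxmod (polyZC R g))%:C%C).
case: e me me3 => [|e] me me3; first by lia.
have mr : 1 <= m%:R :> R by rewrite ler1n.
have mer : m%:R <= e.+1%:R :> R by rewrite ler_nat.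
have e2r : 2%:R <= e.+1%:R :> R by rewrite ler_nat; lia.
have eE : e.+1%:R = e%:R + 1 :> R by rewrite -addn1 natrD.
rewrite natrD.
(* Once g is known, a prescribed root leaves O(n^e) polynomials h of degree e + 1; the factor 2
   accounts for the two signs of the root, and the exponent of g is again weakened to m + 1/2 to
   avoid a tie. *)
apply: (@growth_le_products R (fun g h => factor_degrees m e.+1 g h /\ Q g h)
  (m%:R + 1 / 2) e%:R _ (2 * 3 ^+ e) (gelfond (m + e.+1))).
- have := nat_neq_half m.+1 e; rewrite -[m.+1]addn1 natrD => h.
  by apply: contra_neq h => <-; lra.
- exact: ler0n.
- lra.
- lra.
- by rewrite mulr_gt0 ?exprn_gt0.
- by rewrite /gelfond expn_gt0.
- by move=> g h [[]].
- by apply: (growth_le_sub (fun n _ => @subset_refl _ _) _ (growth_le_degrees _ _ _)); lra.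
- move=> g n n0; rewrite powR_mulrn // -mulrA -exprMn mulr_natl mulr2n.
  apply: card_at_most_sub _ (lexx _) (card_at_mostU (card_at_most_root e _ n0)
    (card_at_most_root e _ n0)).
  move=> h [hn [[gm hm sg sh] rh]].
  by case: rh => rh; [left|right]; split; try exact: rh; split.
Qed.

Lemma growth_reducible_two_maxmod N : (3 <= N)%N ->
  growth_le (fun n => [set f | [/\ monic_height_le N n f, reducibleZ f &
    nb_maxmod_roots (polyZC R f) = 2%N]]) (N%:R - 3 / 2 : R).
Proof.
move=> N3.
pose A m n : set {poly int} := [set f | (0 < N - m)%N /\ exists g h,
  [/\ factor_degrees m (N - m) g h /\ nb_maxmod_roots (polyZC R g) = 2%N, f = g * h &
      (height g * height h <= gelfond (m + (N - m)) * n)%N]].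
pose B m n : set {poly int} := [set f | (0 < m <= N - m)%N /\ exists g h,
  [/\ factor_degrees m (N - m) g h /\
      (root (polyZC R h) (maxmod (polyZC R g))%:C%C \/
       root (polyZC R h) (- (maxmod (polyZC R g))%:C%C)), f = g * h &
      (height g * height h <= gelfond (m + (N - m)) * n)%N]].
apply: growth_le_sub (_ : forall n, (0 < n)%N -> _ `<=`
    \bigcup_(m in [set m | (m < N)%N]) (A m n `|` B m n)) (lexx _) (growth_le_bigcup _).
  move=> n n0 f [fn red nb]; have [fm sf _] := fn.
  have [g [h [m [e [[gm hm fE] sg sh me NE]]]]] := reducibleZ_factor fm sf red.
  have hgh := height_factors fn fE gm hm.
  have Nm : (N - m = e)%N by lia.
  have Ne : (N - e = m)%N by lia.
  have [] := @nb_maxmod_mul (polyZC R g) (polyZC R h).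
  - exact: polyZC_monic.
  - exact: polyZC_monic.
  - by rewrite size_polyZC sg; lia.
  - by rewrite size_polyZC sh; lia.
  - rewrite -polyZC_mul -fE nb => -[_ nbg].
    exists m; first by rewrite /=; lia.
    left; split; first by lia.
    by exists g, h; rewrite Nm -NE; split.
  (* Here the factor of larger degree carries both roots: the factors are exchanged and the index of
     the family is its degree e. *)
  - rewrite -polyZC_mul -fE nb => -[_ nbh].
    exists e; first by rewrite /=; lia.
    left; split; first by lia.
    exists h, g; rewrite Ne addnC -NE; split => //; first by rewrite mulrC.
    by rewrite mulnC.
  - rewrite -polyZC_mul -fE nb => -[mgh nbgh].
    exists m; first by rewrite /=; lia.
    right; split; first by rewrite Nm.
    exists g, h; rewrite Nm -NE; split => //; split => //.
    rewrite mgh; apply: maxmod_root_real => //; first by rewrite sh; lia.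
    have := @nb_maxmod_gt0 _ (polyZC R g) (polyZC_monic R gm).
    have := @nb_maxmod_gt0 _ (polyZC R h) (polyZC_monic R hm).
    rewrite !size_polyZC sg sh.
    by lia.
move=> m mN; have mNE : (m + (N - m) = N)%N by rewrite subnKC // ltnW.
apply: growth_leU.
  have [e0|e0] := posnP (N - m)%N.
    by apply: growth_le_sub (lexx _) (growth_le_set0 _) => n n0 f []; rewrite e0.
  rewrite -{1}mNE; apply: growth_le_sub (lexx _) (growth_prod_two_maxmod m e0).
  by move=> n n0 f [].
have [me|me] := boolP (0 < m <= N - m)%N; last first.
  by apply: growth_le_sub (lexx _) (growth_le_set0 _) => n n0 f [mm]; rewrite mm in me.
rewrite -{1}mNE; apply: growth_le_sub (lexx _) (growth_prod_shared_root me _).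
  by move=> n n0 f [].
by rewrite mNE.
Qed.

End Reducible.

(** * From cardinality bounds to orders of growth *)

Section Asymptotics.
Variable R : realType.
Implicit Types (U : nat -> nat) (V : R -> R).

(** Below the threshold H1 only U >= 1 is available; V is monotone, hence at most w there, and V /
    (w + 1) <= 1 <= U. This is what the explicit members of small height are for. *)
Lemma same_order_from_intro H0 U V (c C : R) H1 : 0 < c -> 0 < C ->
    (forall H, (H0 <= H)%N -> 0 <= V H%:R) ->
    (forall H H', (H0 <= H)%N -> (H <= H')%N -> V H%:R <= V H'%:R) ->
    (forall H, (H0 <= H)%N -> (U H)%:R <= C * V H%:R) ->
    (forall H, (H1 <= H)%N -> c * V H%:R <= (U H)%:R) ->
    (forall H, (H0 <= H)%N -> (0 < U H)%N) ->
  same_order_from H0 U V.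
Proof.
move=> c0 C0 V0 Vm UC Uc U0; pose w := V (maxn H0 H1)%:R.
have w0 : 0 <= w by apply: V0; apply: leq_maxl.
have w1 : 0 < (w + 1)^-1 by rewrite invr_gt0; lra.
exists (Num.min c (w + 1)^-1), C; split => //; first by rewrite lt_min c0.
move=> H HH0; split; last exact: UC.
have [HH1|/ltnW HH1] := leqP H1 H.
  by apply: le_trans (Uc H HH1); rewrite ler_wpM2r ?V0 // ge_min lexx.
have VH : V H%:R <= w by apply: Vm => //; rewrite leq_max HH1 orbT.
apply: le_trans (_ : (w + 1)^-1 * V H%:R <= _).
  by rewrite ler_wpM2r ?V0 // ge_min lexx orbT.
apply: le_trans (_ : 1 <= _); last by rewrite ler1n U0.
by rewrite mulrC ler_pdivrMr ?mul1r; lra.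
Qed.

Lemma same_order_from_ext H0 U V V' : (forall H, (H0 <= H)%N -> V H%:R = V' H%:R) ->
  same_order_from H0 U V -> same_order_from H0 U V'.
Proof.
move=> VV [c [C [c0 C0 h]]]; exists c, C; split => // H HH0.
by rewrite -VV //; apply: h.
Qed.

Lemma same_order_from_powR n (A : nat -> set {poly int}) (s c : R) H1 : 0 <= s -> 0 < c ->
    (forall H, A H `<=` monic_height_le n H) ->
    growth_le A s ->
    (forall H, (H1 <= H)%N -> card_at_least (A H) (c * H%:R `^ s)) ->
    (forall H, (0 < H)%N -> exists f, A H f) ->
  same_order_from 1 (fun H => #|` fset_set (A H)|) (fun x : R => x `^ s).
Proof.
move=> s0 c0 An [C C0 AC] Ac A0.
have finA H : finite_set (A H) := sub_finite_set (An H) (finite_monic_height_le n H).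
apply: (@same_order_from_intro _ _ _ c C H1) => //.
- by move=> H H' _ HH; apply: (ge0_ler_powR s0); rewrite ?nnegrE ?ler_nat.
- by move=> H H0; apply: card_at_most_fset_set; apply: AC.
- by move=> H HH; apply: card_at_least_fset_set (finA H) _; apply: Ac.
- move=> H H0; have [f fA] := A0 H H0.
  rewrite -(ler_nat R); apply: card_at_least_fset_set (finA H) _.
  exact: card_at_least1 fA.
Qed.

(** The rate 1 / sqrt H is the bound on the proportion of polynomials with several roots of maximal
    modulus, the largest error that occurs. *)
Lemma asymp_equivalent_intro U V (C : R) : (forall H, (0 < H)%N -> 0 < V H%:R) ->
    (forall H, (0 < H)%N -> (1 - C / Num.sqrt H%:R) * V H%:R <= (U H)%:R) ->
    (forall H, (0 < H)%N -> (U H)%:R <= (1 + C / Num.sqrt H%:R) * V H%:R) ->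
  asymp_equivalent U V.
Proof.
move=> V0 lo hi; rewrite /asymp_equivalent.
have s0 : (fun H : nat => C / Num.sqrt H%:R : R) @ \oo --> (0 : R).
  rewrite -[X in _ --> X](mulr0 C); apply: cvgM; first exact: cvg_cst.
  apply/(@gtr0_cvgV0 R _ _ _ (fun H : nat => Num.sqrt H%:R)).
    near=> H; rewrite sqrtr_gt0 ltr0n; near: H; exact: nbhs_infty_gt.
  apply/cvgryPge => A; near=> H.
  have [A0|/ltW A0] := leP A 0; first by rewrite (le_trans A0) // sqrtr_ge0.
  rewrite -[A]ger0_norm // -sqrtr_sqr ler_wsqrtr //.
  near: H; exact: nbhs_infty_ger.
apply: (@squeeze_cvgr _ _ _ _ (fun H : nat => 1 - C / Num.sqrt H%:R)
  (fun H : nat => 1 + C / Num.sqrt H%:R)).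
- near=> H; have H0 : (0 < H)%N by near: H; exact: nbhs_infty_gt.
  by rewrite ler_pdivlMr ?V0 // ler_pdivrMr ?V0 // lo // hi.
- rewrite -[X in _ --> X]subr0; apply: cvgB => //; exact: cvg_cst.
- rewrite -[X in _ --> X]addr0; apply: cvgD => //; exact: cvg_cst.
Unshelve. all: by end_near. Qed.

End Asymptotics.

(** * Degree n at least three: one or two roots of maximal modulus *)

Section GeneralDegree.
Variable R : realType.

Definition irreducible_with n k H : set {poly int} :=
  [set f | [/\ monic_height_le n H f, irreducibleZ f & nb_maxmod_roots (polyZC R f) = k]].

Definition reducible_with n k H : set {poly int} :=
  [set f | [/\ monic_height_le n H f, reducibleZ f & nb_maxmod_roots (polyZC R f) = k]].

Lemma irreducible_with_sub n k H : irreducible_with n k H `<=` monic_height_le n H.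
Proof. by move=> f []. Qed.

Lemma reducible_with_sub n k H : reducible_with n k H `<=` monic_height_le n H.
Proof. by move=> f []. Qed.

Lemma finite_irreducible_with n k H : finite_set (irreducible_with n k H).
Proof. exact: sub_finite_set (@irreducible_with_sub n k H) (finite_monic_height_le n H). Qed.

Lemma finite_reducible_with n k H : finite_set (reducible_with n k H).
Proof. exact: sub_finite_set (@reducible_with_sub n k H) (finite_monic_height_le n H). Qed.

Lemma reducibleZ_dec (f : {poly int}) : f \is monic -> (1 < size f)%N ->
  irreducibleZ f \/ reducibleZ f.
Proof.
move=> fm sf; have [irr|irr] := pselect (irreducibleZ f); first by left.
by right; split => //; [exact: monic_neq0|exact: size_monic_unit].
Qed.

Lemma reducibleZ_coef0 (f : {poly int}) n : f \is monic -> size f = n.+3 ->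
  f`_0 = 0 -> reducibleZ f.
Proof.
move=> fm sf f0; have [pm sp] := monic_uncons_poly fm sf.
set p := \poly_(_ < _) _ in pm sp.
have -> : f = p * 'X.
  by rewrite [f]cons_poly_eq f0 sf cons_poly_def addr0.
apply: reducibleZ_mul; rewrite ?monicX ?size_polyX ?sp //.
Qed.

Lemma sqrt_nat_ge1 H : (0 < H)%N -> 1 <= Num.sqrt H%:R :> R.
Proof. by move=> H0; rewrite -[leLHS]sqrtr1 ler_wsqrtr // ler1n. Qed.

(* Convexity of x |-> (1 + x)^n on [0, 1]. *)
Lemma ler_binomial1 (x : R) n : 0 <= x <= 1 -> (1 + x) ^+ n <= 1 + (2 ^+ n - 1) * x.
Proof.
move=> /andP[x0 x1]; elim: n => [|n IH]; first by rewrite !expr0; lra.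
have a1 : 1 <= 2 ^+ n :> R by rewrite exprn_ege1 // ler1n.
rewrite !exprS; apply: le_trans (_ : (1 + x) * (1 + (2 ^+ n - 1) * x) <= _).
  by rewrite ler_wpM2l //; lra.
have : 0 <= (2 ^+ n - 1) * (x * (1 - x)) by rewrite !mulr_ge0 ?subr_ge0.
by move: (2 ^+ n) => t; lra.
Qed.

(** Almost all polynomials qualify: O(H^(n-1)) are reducible and O(H^(n-1/2)) have several roots of
    maximal modulus. From above, the full count (2 H + 1)^n is (2 H)^n up to a factor 1 + O(1 /
    H). *)
Lemma irreducible_one_maxmod n : (3 <= n)%N ->
  asymp_equivalent (nb_irreducible R n 1) (fun H : R => (2 * H) ^+ n).
Proof.
move=> n3; have [C1 C10 HC1] := growth_reducible R n3.
have [C2 C20 HC2] : growth_le (fun H => [set f | monic_height_le n H f /\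
    nb_maxmod_roots (polyZC R f) != 1%N]) (n%:R - 1 / 2 : R).
  by case: n n3 {C1 C10 HC1} => [|[|n]] // _; apply: growth_multiple_maxmod.
have p1 : 1 <= 2 ^+ n :> R by rewrite exprn_ege1 // ler1n.
apply: (@asymp_equivalent_intro R _ _ (C1 + C2 + 2 ^+ n)) => H H0.
- by rewrite exprn_gt0 // mulr_gt0 // ltr0n.
- have H1 : 1 <= H%:R :> R by rewrite ler1n.
  have s1 := sqrt_nat_ge1 H0.
  apply: card_at_least_fset_set (finite_irreducible_with n 1 H) _.
  apply: card_at_least_sub _ _ (card_at_leastD (card_at_least_monic R n H0)
    (card_at_mostU (HC1 H H0) (HC2 H H0))).
    move=> f [fn nf]; have [fm sf _] := fn; split => //.
      have [|//|red] := reducibleZ_dec fm; first by rewrite sf; lia.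
      by case: nf; left.
    by apply/eqP/negPn/negP => nb; apply: nf; right.
  have e : H%:R `^ (n%:R - 1 / 2) = H%:R ^+ n / Num.sqrt H%:R :> R.
    rewrite powRD; last by apply/implyP => _; lra.
    by rewrite powR_mulrn // powRN -powR12_sqrt // mul1r.
  have le1 : H%:R `^ (n%:R - 1) <= H%:R ^+ n / Num.sqrt H%:R :> R.
    by rewrite -e ler_powR_nat //; lra.
  rewrite e mulrBl mul1r lerB //.
    by rewrite lerXn2r ?nnegrE ?addr_ge0 ?mulr_ge0 //; lra.
  apply: le_trans (_ : (C1 + C2) * (H%:R ^+ n / Num.sqrt H%:R) <= _).
    by rewrite mulrDl lerD2r ler_wpM2l // ltW.
  rewrite exprMn [leRHS](_ : _ = (C1 + C2 + 2 ^+ n) * 2 ^+ n * (H%:R ^+ n / Num.sqrt H%:R)).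
    rewrite ler_wpM2r ?divr_ge0 ?exprn_ge0 ?sqrtr_ge0 //; nra.
  by ring.
- have H1 : 1 <= H%:R :> R by rewrite ler1n.
  have s1 := sqrt_nat_ge1 H0.
  apply: le_trans (_ : (2 * H%:R + 1) ^+ n <= _).
    apply: card_at_most_fset_set; apply: card_at_most_sub _ (lexx _) (card_at_most_monic R n H).
    exact: irreducible_with_sub.
  have -> : 2 * H%:R + 1 = (1 + (2 * H%:R)^-1) * (2 * H%:R) :> R.
    by field; rewrite (gt_eqF (lt_le_trans ltr01 H1)).
  rewrite exprMn ler_wpM2r ?exprn_ge0 ?mulr_ge0 //.
  apply: le_trans (ler_binomial1 n _) _.
    rewrite invr_ge0 mulr_ge0 //= invf_le1; lra.
  rewrite lerD2l; apply: le_trans (_ : 2 ^+ n / Num.sqrt H%:R <= _).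
    apply: le_trans (_ : 2 ^+ n * (2 * H%:R)^-1 <= _).
      by rewrite ler_wpM2r ?gerBl // invr_ge0 mulr_ge0.
    rewrite ler_wpM2l ?exprn_ge0 // lef_pV2 ?posrE; [|lra|lra].
    by rewrite -{2}(sqr_sqrtr (_ : 0 <= H%:R)) // expr2; nra.
  by rewrite ler_wpM2r ?invr_ge0 ?sqrtr_ge0 //; lra.
Qed.

Definition upper_half H : seq int := [seq H%:Z - i%:Z | i <- iota 0 H./2].

Lemma upper_half_uniq H : uniq (upper_half H).
Proof. by rewrite map_inj_uniq ?iota_uniq // => i j; lia. Qed.

Lemma mem_upper_half H (a : int) : a \in upper_half H ->
  H%:R / 2 <= (a%:~R : R) <= H%:R.
Proof.
rewrite /upper_half => /mapP[j]; rewrite mem_iota add0n => /andP[_ iH] ->.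
have h1 : (j.*2 <= H)%N by lia.
have : j.*2%:R <= H%:R :> R by rewrite ler_nat.
rewrite -mul2n natrM rmorphB /= -!pmulrn.
by have : 0 <= j%:R :> R by []; lra.
Qed.

Lemma size_upper_half H : (2 <= H)%N -> H%:R / 4 <= (size (upper_half H))%:R :> R.
Proof.
move=> H2; rewrite size_map size_iota ler_pdivrMr // -natrM ler_nat; lia.
Qed.

(** The threshold on H is the square of 8 (n + 2) < sqrt H, that is, 4 (n + 2) sqrt H < H / 2. *)
Lemma upper_half_dominant n (f : {poly int}) H : monic_height_le n.+2 H f ->
    f`_n.+1 \in upper_half H -> (64 * n.+2 ^ 2 < H)%N ->
  nb_maxmod_roots (polyZC R f) = 1%N.
Proof.
move=> [fm sf fH] fn bigH; have H0 : (0 < H)%N by apply: leq_ltn_trans bigH.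
apply: (@nb_maxmod_dominant _ n _ H%:R); rewrite ?size_polyZC ?polyZC_monic ?ler1n //.
  by move=> i _; apply: cmod_coef_le_height.
have /andP[lo _] := mem_upper_half fn.
rewrite coef_polyZC cmod_int intr_norm.
apply: lt_le_trans (ler_norm _); apply: lt_le_trans lo.
rewrite ltr_pdivlMr // -{2}(sqr_sqrtr (_ : 0 <= H%:R)) // expr2.
have s1 := sqrt_nat_ge1 H0; have s0 : 0 < Num.sqrt H%:R :> R by lra.
rewrite [ltLHS](_ : _ = (8 * n.+2%:R) * Num.sqrt H%:R); last by ring.
rewrite ltr_pM2r // -ltr_sqr ?nnegrE ?mulr_ge0 ?sqrtr_ge0 // sqr_sqrtr //.
rewrite exprMn (_ : 8 ^+ 2 = 64%:R); last by ring.
by rewrite -natrX -natrM ltr_nat.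
Qed.

(** Constant coefficient 0 gives divisibility by X, and a subleading coefficient of at least H / 2
    gives a dominant root; the other n + 1 coefficients are free. The factor 1/4 comes from
    [upper_half], which has at least H / 4 elements. *)
Lemma growth_reducible_one_maxmod_lower n H : (64 * n.+3 ^ 2 < H)%N ->
  card_at_least (reducible_with n.+3 1 H) (4^-1 * H%:R `^ (n.+2%:R) : R).
Proof.
move=> bigH; have H0 : (0 < H)%N by apply: leq_ltn_trans bigH.
have H1 : 1 <= H%:R :> R by rewrite ler1n.
pose S := [:: 0] :: rcons (nseq n.+1 (int_range (H%:R : R))) (upper_half H).
have uS : all uniq S.
  apply/allP => s; rewrite /S inE mem_rcons inE => /or3P[/eqP->|/eqP->|] //.
    exact: upper_half_uniq.
  by move/nseqP => [-> _]; apply: int_range_uniq.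
apply: card_at_least_sub _ _ (card_at_least_box R uS).
  move=> f [fm]; rewrite [size S]/= size_rcons size_nseq => sf Hf.
  have f0 : f`_0 = 0 by have := Hf 0%N isT; rewrite inE => /eqP.
  have {}Hf i : (i < n.+2)%N -> f`_i.+1 \in
      nth [::] (rcons (nseq n.+1 (int_range (H%:R : R))) (upper_half H)) i.
    exact: (Hf i.+1).
  have ftop : f`_n.+2 \in upper_half H.
    by have := Hf n.+1 (leqnn _); rewrite nth_rcons size_nseq ltnn eqxx.
  have fn : monic_height_le n.+3 H f.
    split => //; apply/height_leP => -[|i]; first by rewrite f0 absz0.
    case: (ltngtP i n.+1) => [im|im|->].
    - have := Hf i (ltnW im); rewrite nth_rcons size_nseq im nth_nseq im.
      by rewrite mem_int_range // -abszE -(ler_nat R).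
    - have [->|im'] := eqVneq i n.+2.
        by move/monicP: fm; rewrite lead_coefE sf /= => ->.
      by rewrite nth_default // sf; lia.
    - move: ftop => /mem_upper_half /andP[lo hi].
      by rewrite -(ler_nat R) natr_absz intr_norm ger0_norm //; lra.
  split => //; first exact: reducibleZ_coef0 fm sf f0.
  exact: upper_half_dominant fn ftop bigH.
rewrite /S big_cons -cats1 big_cat big_seq1 prod_nseq_size mul1r.
rewrite powR_mulrn // exprSr mulrCA.
apply: ler_pM; rewrite ?exprn_ge0 ?divr_ge0 ?mulr_ge0 //.
  rewrite lerXn2r ?nnegrE // size_int_range_nat ler_nat; lia.
rewrite mulrC; apply: size_upper_half; lia.
Qed.
End GeneralDegree.

(** * Lower bounds for two roots of maximal modulus *)

Section TwoMaxmod.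
Variable R : realType.

Lemma size_int_range_ge (x : R) : x <= (size (int_range x))%:R.
Proof.
by rewrite size_int_range (le_trans (ltW (truncnS_gt x))) // ler_nat ltnS -addnn leq_addr.
Qed.

Lemma upper_half_conj_pair n (f : {poly int}) H : monic_height_le n.+3 H f ->
    f`_n.+1 \in upper_half H -> f`_n.+2 \in int_range (Num.sqrt (H%:R : R)) ->
    (2 ^ (3 * n.+3 + 9) < H)%N ->
  nb_maxmod_roots (polyZC R f) = 2%N.
Proof.
move=> [fm sf fH] fn1 fn2 bigH; have H0 : (0 < H)%N by apply: leq_ltn_trans bigH.
apply: (@nb_maxmod_conj_pair R n _ H%:R (f`_n.+2)%:~R (f`_n.+1)%:~R).
- exact: polyZC_monic.
- by rewrite size_polyZC.
- by move=> z; apply: root_polyZC_conj.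
- by rewrite coef_polyZC rmorph_int.
- by rewrite coef_polyZC rmorph_int.
- exact: mem_upper_half.
- rewrite mem_int_range ?sqrtr_ge0 // intr_norm in fn2.
  rewrite -(sqr_sqrtr (_ : 0 <= H%:R)) // -(real_normK (num_real _)).
  by rewrite lerXn2r ?nnegrE ?sqrtr_ge0.
- by move=> i _; apply: cmod_coef_le_height.
- by rewrite -natrX ltr_nat.
Qed.

(** The ranges L of the low coefficients are left open: with constant coefficient 0 they yield
    reducible polynomials, with full ranges mostly irreducible ones. *)
Lemma box_conj_pair n (L : seq (seq int)) H : size L = n.+1 -> (2 ^ (3 * n.+3 + 9) < H)%N ->
    (forall s, s \in L -> {subset s <= int_range (H%:R : R)}) ->
  box (L ++ [:: upper_half H; int_range (Num.sqrt (H%:R : R))]) `<=`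
    [set f | monic_height_le n.+3 H f /\ nb_maxmod_roots (polyZC R f) = 2%N].
Proof.
move=> sL bigH LH f [fm]; rewrite size_cat sL addn2 => sf Hf.
have H0 : (0 < H)%N by apply: leq_ltn_trans bigH.
have f1 : f`_n.+1 \in upper_half H.
  by have := Hf n.+1 (ltnW (leqnn _)); rewrite nth_cat sL ltnn subnn.
have f2 : f`_n.+2 \in int_range (Num.sqrt (H%:R : R)).
  by have := Hf n.+2 (leqnn _); rewrite nth_cat sL ltnNge leqnSn /= subSnn.
have fn : monic_height_le n.+3 H f.
  split => //; apply/height_leP => i; rewrite -(ler_nat R) natr_absz.
  have [im|] := ltnP i n.+1.
    have Li : nth [::] L i \in L by rewrite mem_nth // sL.
    have lin : (i < n.+3)%N by lia.
    have := Hf i lin; rewrite nth_cat sL im => /(LH _ Li).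
    by rewrite mem_int_range.
  rewrite leq_eqVlt => /orP[/eqP <-|].
    by move: f1 => /(mem_upper_half R) /andP[lo hi]; rewrite intr_norm ger0_norm //; lra.
  rewrite leq_eqVlt => /orP[/eqP <-|].
    move: f2; rewrite mem_int_range ?sqrtr_ge0 // => /le_trans; apply.
    have s1 := sqrt_nat_ge1 R H0.
    by rewrite -[leRHS](sqr_sqrtr (_ : 0 <= H%:R)) // expr2; nra.
  rewrite leq_eqVlt => /orP[/eqP <-|im].
    by move/monicP: fm; rewrite lead_coefE sf /= => ->; rewrite ler1n.
  by rewrite nth_default ?normr0 // sf.
split => //; exact: upper_half_conj_pair fn f1 f2 bigH.
Qed.

Lemma size_conj_pair_box (L : seq (seq int)) k H (x : R) : (2 <= H)%N ->
    H%:R ^+ k <= \prod_(s <- L) (size s)%:R :> R -> x = k.+2%:R - 1 / 2 ->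
  4^-1 * H%:R `^ x <=
  \prod_(s <- L ++ [:: upper_half H; int_range (Num.sqrt (H%:R : R))]) (size s)%:R :> R.
Proof.
move=> H2 HL ->; rewrite big_cat big_cons big_seq1 /= -powR_half ?ltr0n; last by lia.
have h1 := size_upper_half R H2; have h2 := size_int_range_ge (Num.sqrt (H%:R : R)).
rewrite exprSr [leLHS](_ : _ = H%:R ^+ k * (H%:R / 4 * Num.sqrt H%:R)); last by ring.
apply: ler_pM; rewrite ?exprn_ge0 ?mulr_ge0 ?sqrtr_ge0 //.
by apply: ler_pM; rewrite ?sqrtr_ge0 ?divr_ge0.
Qed.

Lemma reducible_two_maxmod_lower n H : (2 ^ (3 * n.+3 + 9) < H)%N ->
  card_at_least (reducible_with R n.+3 2 H) (4^-1 * H%:R `^ (n.+3%:R - 3 / 2) : R).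
Proof.
move=> bigH; have H2 : (2 <= H)%N.
  apply: leq_trans bigH; rewrite (leq_trans (_ : 2 <= 2 ^ 1)%N) //.
  by apply: ltnW; rewrite ltnS leq_exp2l // addnS.
pose L := [:: 0] :: nseq n (int_range (H%:R : R)).
have uS : all uniq (L ++ [:: upper_half H; int_range (Num.sqrt (H%:R : R))]).
  apply/allP => s; rewrite mem_cat !inE => /orP[/orP[/eqP->|/nseqP[-> _]]|/orP[]/eqP->] //.
  - exact: int_range_uniq.
  - exact: upper_half_uniq.
  - exact: int_range_uniq.
apply: card_at_least_sub _ _ (card_at_least_box R uS).
  move=> f fS; have [] := @box_conj_pair n L H _ bigH _ f fS.
  - by rewrite /= size_nseq.
  - move=> s; rewrite inE => /orP[/eqP -> a|/nseqP[-> _] //].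
    by rewrite inE => /eqP ->; rewrite mem_int_range // normr0.
  - move=> [fm sf fH] nb; split => //.
    apply: reducibleZ_coef0 fm sf _.
    by case: fS => _ _ /(_ 0%N isT); rewrite inE => /eqP.
apply: (@size_conj_pair_box L n) => //.
  rewrite big_cons prod_nseq_size mul1r lerXn2r ?nnegrE //.
  rewrite size_int_range_nat ler_nat; lia.
by rewrite -addn1 natrD; lra.
Qed.

Lemma irreducible_two_maxmod_lower n : exists2 H1, forall H, (H1 <= H)%N ->
  card_at_least (irreducible_with R n.+3 2 H) (8^-1 * H%:R `^ (n.+3%:R - 1 / 2) : R)
  & (0 < H1)%N.
Proof.
have [C C0 HC] := @growth_reducible R n.+3 isT.
(* The second term ensures 8 C <= sqrt H. In degree d the reducible polynomials, at most C H^(d-1),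
   then take away at most half of the H^(d-1/2) / 4 polynomials of the box. *)
pose H1 := (2 ^ (3 * n.+3 + 9) + (Num.trunc ((8 * C) ^+ 2)).+1).+1.
exists H1 => // H H1H; have bigH : (2 ^ (3 * n.+3 + 9) < H)%N.
  by apply: leq_trans H1H; rewrite ltnS leq_addr.
have H2 : (2 <= H)%N.
  apply: leq_trans bigH; rewrite (leq_trans (_ : 2 <= 2 ^ 1)%N) //.
  by apply: ltnW; rewrite ltnS leq_exp2l // addnS.
have H0 : (0 < H)%N by apply: ltnW.
pose L := nseq n.+1 (int_range (H%:R : R)).
have uS : all uniq (L ++ [:: upper_half H; int_range (Num.sqrt (H%:R : R))]).
  apply/allP => s; rewrite mem_cat => /orP[/nseqP[-> _]|].
    exact: int_range_uniq.
  by rewrite !inE => /orP[]/eqP->; [exact: upper_half_uniq|exact: int_range_uniq].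
apply: card_at_least_sub _ _ (card_at_leastD (card_at_least_box R uS) (HC H H0)).
  move=> f [fS nred]; have [] := @box_conj_pair n L H _ bigH _ f fS.
  - by rewrite size_nseq.
  - by move=> s /nseqP[-> _].
  - move=> fn nb; split => //; have [fm sf _] := fn.
    have [|//|red] := reducibleZ_dec fm; first by rewrite sf.
    by case: nred.
rewrite lerBrDr; apply: le_trans (@size_conj_pair_box L n.+1 _ _ H2 _ (erefl _)).
  have e : H%:R `^ (n.+3%:R - 1 / 2) = H%:R `^ (n.+3%:R - 1) * Num.sqrt H%:R :> R.
    rewrite -powR12_sqrt // -powRD; first by congr (_ `^ _); lra.
    by apply/implyP => _; rewrite pnatr_eq0 -lt0n.
  have Cs : 8 * C <= Num.sqrt H%:R :> R.
    rewrite -[leLHS]ger0_norm ?mulr_ge0 ?(ltW C0) // -sqrtr_sqr ler_wsqrtr //.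
    apply: le_trans (ltW (truncnS_gt _)) _; rewrite ler_nat (leq_trans _ H1H) //.
    by rewrite ltnS (leq_trans (leqnSn _)) // leq_addl.
  rewrite e; have : 0 <= H%:R `^ (n.+3%:R - 1) * (Num.sqrt H%:R - 8 * C) :> R.
    by rewrite mulr_ge0 ?powR_ge0 // subr_ge0.
  by move: (H%:R `^ _) (Num.sqrt _) => u v; lra.
rewrite prod_nseq_size lerXn2r ?nnegrE //.
by rewrite size_int_range_nat ler_nat; lia.
Qed.

End TwoMaxmod.

(** * Ljunggren's trinomials X^n - X^2 + (-1)^(n+1) *)

Section ReciprocalPolynomial.
Variable A : comNzRingType.
Implicit Types p q : {poly A}.

(** The reversal X^n p(1/X). The formal degree n is a parameter, since reversing may lower the
    degree. *)
Definition revp n p : {poly A} := \poly_(i < n.+1) p`_(n - i).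

Lemma coef_revp n p i : (revp n p)`_i = if (i <= n)%N then p`_(n - i) else 0.
Proof. by rewrite coef_poly ltnS. Qed.

Lemma revpE n p : revp n p = \sum_(k < n.+1) p`_k *: 'X^(n - k).
Proof.
rewrite /revp poly_def (reindex_inj rev_ord_inj); apply: eq_bigr => k _ /=.
by rewrite subSS subKn // -ltnS.
Qed.

Lemma revp_sum n (I : Type) (r : seq I) (F : I -> {poly A}) :
  revp n (\sum_(i <- r) F i) = \sum_(i <- r) revp n (F i).
Proof.
apply/polyP => j; rewrite coef_revp !coef_sum; case: leqP => jn.
  by apply: eq_bigr => i _; rewrite coef_revp jn.
by rewrite big1 // => i _; rewrite coef_revp leqNgt jn.
Qed.

Lemma revp_mono n (a : A) k : (k <= n)%N -> revp n (a *: 'X^k) = a *: 'X^(n - k).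
Proof.
move=> kn; apply/polyP => j; rewrite coef_revp !coefZ !coefXn.
have [jn|jn] := leqP j n; first by congr (_ * _%:R); apply/eqP/eqP; lia.
by rewrite (_ : (j == n - k)%N = false) ?mulr0 //; lia.
Qed.

Lemma poly_sum_coef n p : (size p <= n)%N -> p = \sum_(k < n) p`_k *: 'X^k.
Proof.
move=> sp; rewrite -poly_def; apply/polyP => i; rewrite coef_poly.
by case: ltnP => // ni; rewrite nth_default // (leq_trans sp).
Qed.

Lemma revp_mul m e p q : (size p <= m.+1)%N -> (size q <= e.+1)%N ->
  revp (m + e) (p * q) = revp m p * revp e q.
Proof.
move=> sp sq; rewrite [in LHS](poly_sum_coef sp) [in LHS](poly_sum_coef sq).
rewrite big_distrlr /= revp_sum (revpE m) (revpE e) big_distrlr /=.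
apply: eq_bigr => i _; rewrite revp_sum; apply: eq_bigr => j _.
have im : (i <= m)%N by rewrite -ltnS.
have je : (j <= e)%N by rewrite -ltnS.
rewrite -scalerAl -scalerAr scalerA -exprD revp_mono ?leq_add //.
by rewrite -scalerAl -scalerAr scalerA -exprD; congr (_ *: 'X^_); lia.
Qed.

Lemma revpK n p : (size p <= n.+1)%N -> revp n (revp n p) = p.
Proof.
move=> sp; apply/polyP => i; rewrite coef_revp; case: leqP => ni.
  by rewrite coef_revp leq_subr subKn.
by rewrite nth_default // (leq_trans sp).
Qed.

Lemma coef_mul_revp n p : (p * revp n p)`_n = \sum_(k < n.+1) p`_k ^+ 2.
Proof.
rewrite coefM; apply: eq_bigr => k _.
by rewrite coef_revp leq_subr subKn // -ltnS.
Qed.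

End ReciprocalPolynomial.

Lemma horner_revp (F : fieldType) n (p : {poly F}) z : (size p <= n.+1)%N -> z != 0 ->
  (revp n p).[z^-1] * z ^+ n = p.[z].
Proof.
move=> sp z0; rewrite revpE [in RHS](poly_sum_coef sp) !horner_sum mulr_suml.
apply: eq_bigr => k _; rewrite !hornerZ !hornerXn -mulrA; congr (_ * _).
have kn : (k <= n)%N by rewrite -ltnS.
rewrite [X in _ * z ^+ X](_ : n = n - k + k)%N; last by rewrite subnK.
by rewrite exprD mulrA -exprMn mulVf // expr1n mul1r.
Qed.

Lemma map_revp (A B : comNzRingType) (f : {rmorphism A -> B}) n p :
  map_poly f (revp n p) = revp n (map_poly f p).
Proof.
apply/polyP => i; rewrite coef_map !coef_revp /=; case: ifP => _; last exact: rmorph0.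
by rewrite coef_map.
Qed.

(** The sign serves the count of extremal roots: for n odd the constant 1 excludes real roots of
    modulus at least 1, so that the extremal roots are a conjugate pair; for n even the constant -1
    produces a real root p > 1, accompanied by -p. *)
Definition ljunggren n : {poly int} := 'X^n - 'X^2 + ((-1) ^+ n.+1)%:P.

Section Ljunggren.
Variables (R : realType) (n : nat).
Hypothesis n3 : (3 <= n)%N.
Local Notation f := (ljunggren n).
Local Notation c := ((-1) ^+ n.+1 : int).

Let n2 : (n == 2%N) = false. Proof. by move: n3; case: n => [|[|[|]]]. Qed.
Let n0 : (n == 0%N) = false. Proof. by move: n3; case: n. Qed.

Lemma coef_ljunggren i :
  f`_i = (i == n)%:R - (i == 2%N)%:R + (i == 0%N)%:R * c.
Proof. by rewrite !coefD coefN !coefXn coefC; case: (i == 0%N); rewrite ?mul1r ?mul0r. Qed.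

Lemma size_ljunggren : size f = n.+1.
Proof.
rewrite /ljunggren -addrA size_polyDl size_polyXn //.
apply: leq_ltn_trans (size_polyD _ _) _; rewrite size_polyN size_polyXn.
by rewrite gtn_max (leq_ltn_trans (size_polyC_leq1 _)) //; lia.
Qed.

Lemma ljunggren_monic : f \is monic.
Proof.
by rewrite monicE lead_coefE size_ljunggren coef_ljunggren eqxx n2 n0 mul0r addr0 subr0.
Qed.

Lemma ljunggren_height : height f = 1%N.
Proof.
apply/eqP; rewrite eqn_leq height_monic_gt0 ?ljunggren_monic // andbT.
apply/height_leP => i; rewrite coef_ljunggren.
have [->|i2] := eqVneq i 2%N.
  by rewrite [(2%N == n)]eq_sym n2 /= mul0r.
have [->|i0] := eqVneq i 0%N.
  by rewrite [(0%N == n)]eq_sym n0 /= subrr add0r mul1r abszX exp1n.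
by rewrite mul0r; case: (i == n).
Qed.

Lemma horner_ljunggren z : (polyZC R f).[z] = z ^+ n - z ^+ 2 + (-1) ^+ n.+1.
Proof.
rewrite /polyZC /ljunggren !rmorphD rmorphN /= !map_polyXn map_polyC /=.
by rewrite !hornerE rmorphXn /= rmorphN1.
Qed.

Lemma root_ljunggren z : root (polyZC R f) z -> z ^+ n = z ^+ 2 - (-1) ^+ n.+1.
Proof. by rewrite rootE horner_ljunggren => /eqP h; apply/eqP; rewrite -subr_eq0 opprD opprK addrA h. Qed.

Lemma root_ljunggren_neq0 z : root (polyZC R f) z -> z != 0.
Proof.
move=> /root_ljunggren e; apply/eqP => z0; move: e; rewrite z0 !expr0n /=.
by rewrite n0 => /esym/eqP; rewrite subr_eq0 eq_sym signr_eq0.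
Qed.

(** With y = z^2 and d the constant coefficient, the two equations give z^(n-2) = d y and y^2 = d y
    - 1, hence y^3 = -d. For n odd, squaring the first equation gives y^(n-2) = y^2, for n even it
    reads y^(n/2 - 1) = -y; cubing yields 1 = -1 in both cases. *)
Lemma ljunggren_no_reciprocal_roots z :
  root (polyZC R f) z -> root (polyZC R f) z^-1 -> False.
Proof.
move=> rz rzi; have z0 := root_ljunggren_neq0 rz.
have e1 := root_ljunggren rz; have e2 := root_ljunggren rzi.
set d := (-1) ^+ n.+1 in e1 e2; have d2 : d ^+ 2 = 1 by rewrite sqrr_sign.
set w := z ^+ (n - 2).
have zn : z ^+ n = z ^+ 2 * w by rewrite -exprD subnKC //; lia.
have e3 : 1 = w - d * z ^+ n.
  have : z ^+ n * z^-1 ^+ n = 1 by rewrite -exprMn divff // expr1n.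
  rewrite e2 => <-; rewrite zn; field.
  exact: z0.
set y := z ^+ 2 in e1 zn.
have wE : w = d * y.
  apply/eqP; rewrite -subr_eq0 (_ : w - d * y = (w - d * z ^+ n - 1) + d * (z ^+ n - (y - d)) + (1 - d ^+ 2)).
    by rewrite -e3 e1 d2 !subrr mulr0 !addr0.
  ring.
have y2 : y ^+ 2 = d * y - 1.
  apply/eqP; rewrite -subr_eq0.
  rewrite (_ : _ - _ = d * (y * w - (y - d)) - d * y * (w - d * y) + (1 - d ^+ 2) * (y ^+ 2 + 1)).
    by rewrite -zn e1 wE d2 !subrr !mulr0 mul0r subrr addr0.
  ring.
have y3 : y ^+ 3 = - d by rewrite exprS y2 mulrBr mulr1 mulrCA -expr2 y2 mulrBr mulrA -expr2 d2 mul1r mulr1; ring.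
have absurd1 : (1 : R[i]) = -1 -> False by move/eqP; rewrite -subr_eq0 opprK -(natrD _ 1 1) pnatr_eq0.
have [on|on] := boolP (odd n).
  have d1 : d = 1 by rewrite /d -signr_odd /= on.
  rewrite d1 mul1r in wE y3.
  have h : y ^+ (n - 2) = y ^+ 2 by rewrite -[in RHS]wE /y -!exprM mulnC.
  have := congr1 (fun x => x ^+ 3) h; rewrite /= [LHS]exprAC [RHS]exprAC y3.
  by rewrite sqrrN expr1n -signr_odd oddB ?on /=; [rewrite expr1 => /esym/absurd1|lia].
have d1 : d = -1 by rewrite /d -signr_odd /= on.
rewrite d1 in wE y3.
have h : w = y ^+ (n./2 - 1).
  by rewrite /y -exprM /w; congr (_ ^+ _); lia.
have := congr1 (fun x => x ^+ 3) (etrans (esym h) wE).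
rewrite /= [LHS]exprAC y3 opprK expr1n exprMn y3 opprK mulr1.
by rewrite -signr_odd /= expr1 => /absurd1.
Qed.

End Ljunggren.

(** * Irreducibility and simple roots of the trinomials *)

Section LjunggrenIrreducible.
Variables (R : realType) (n : nat).
Hypothesis n3 : (3 <= n)%N.
Local Notation f := (ljunggren n).
Local Notation c := ((-1) ^+ n.+1 : int).

Definition trinomial (u a v : int) j : {poly int} := u *: 'X^n + a *: 'X^j + v%:P.

Lemma revp_trinomial u a v j : (j <= n)%N ->
  revp n (trinomial u a v j) = trinomial v a u (n - j).
Proof.
move=> jn; apply/polyP => i; rewrite coef_revp !coefD !coefZ !coefXn !coefC.
case: leqP => lein; last first.
  have [-> [-> ->]] : (i == n) = false /\ (i == n - j)%N = false /\ (i == 0%N) = false.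
    by lia.
  by rewrite !mulr0 !addr0.
have -> : (n - i == n)%N = (i == 0%N) by lia.
have -> : (n - i == j)%N = (i == n - j)%N by lia.
have -> : (n - i == 0)%N = (i == n)%N by lia.
by case: (i == 0%N); case: (i == n); rewrite ?mulr1 ?mulr0; ring.
Qed.

Lemma coef_mul_trinomial u a v j i : (j <= n)%N -> (0 < i < n)%N ->
  (trinomial u a v j * trinomial v a u (n - j))`_i =
  (i == j)%:R * (a * u) + (i == n - j)%N%:R * (a * v).
Proof.
move=> jn /andP[i0 lein].
(* The multiples of X^n are collected apart: they do not contribute in degree i < n. *)
have -> : trinomial u a v j * trinomial v a u (n - j) =
    'X^n * (u *: trinomial v a u (n - j) + v *: (a *: 'X^j + v%:P) + (a ^+ 2)%:P) +
    ((a * u) *: 'X^j + (a * v) *: 'X^(n - j) + (v * u)%:P).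
  have -> : 'X^n = 'X^j * 'X^(n - j) :> {poly int} by rewrite -exprD subnKC.
  rewrite /trinomial -(subnKC jn) (_ : (j + (n - j) - j = n - j)%N); last by lia.
  rewrite exprD -!mul_polyC !rmorphM /=; ring.
rewrite coefD coefXnM lein add0r !coefD !coefZ !coefXn coefC (gtn_eqF i0) addr0.
by rewrite mulrC [(a * v) * _]mulrC.
Qed.

Lemma ljunggrenE : f = trinomial 1 (-1) c 2.
Proof. by rewrite /trinomial scale1r scaleN1r. Qed.

Lemma size_revp_monic (p : {poly int}) e : p \is monic -> size p = e.+1 ->
  (revp e p)`_0 = 1 /\ (revp e p)`_e = p`_0.
Proof.
move=> /monicP pm sp; rewrite !coef_revp leqnn subnn subn0; split => //.
by rewrite leq0n -pm lead_coefE sp.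
Qed.

Lemma int_sqr1 (a : int) : a ^+ 2 = 1 -> a = 1 \/ a = -1.
Proof. by move/eqP; rewrite sqrf_eq1 => /orP[] /eqP ->; [left|right]. Qed.

(* The sum of the squares of the coefficients of K is the middle coefficient of
   K * revp n K. *)
Lemma ljunggren_trinomial (K : {poly int}) : (size K <= n.+1)%N ->
    K * revp n K = f * revp n f ->
  exists (u : int) , u ^+ 2 = 1 /\ (K = u *: f \/ K = u *: revp n f).
Proof.
move=> sK KK.
have n2 : (n == 2%N) = false by move: n3; case: n => [|[|[|]]].
have n0 : (n == 0%N) = false by move: n3; case: n.
have c2 : c ^+ 2 = 1 by rewrite sqrr_sign.
have ff k : (f * revp n f)`_k = (K * revp n K)`_k by rewrite KK.
have K0n : K`_0 * K`_n = c.
  have := ff 0%N; rewrite !coef0M !coef_revp /= !subn0 => <-.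
  rewrite !coef_ljunggren n0 !eqxx [(0%N == n)]eq_sym n0 n2 /=. ring.
have Kn2 : K`_n ^+ 2 = 1.
  have : K`_n \is a GRing.unit.
    have e : K`_n * (c * K`_0) = 1 by rewrite mulrCA [K`_n * _]mulrC K0n -expr2.
    by apply/unitrP; exists (c * K`_0); rewrite mulrC e.
  by rewrite unfold_in => /orP[] /eqP ->.
have K0 : K`_0 = c * K`_n by rewrite -K0n -mulrA -expr2 Kn2 mulr1.
have S3 : \sum_(k < n.+1) K`_k ^+ 2 = 3.
  rewrite -coef_mul_revp -ff coef_mul_revp.
  under eq_bigr => k _ do rewrite coef_ljunggren.
  rewrite big_ord_recr /= eqxx n2 n0 (bigD1 (Ordinal (ltnW (ltnW n3) : (0 < n)%N))) //=.
  rewrite (bigD1 (Ordinal (n3 : (2 < n)%N))) //= big1 => [|k /andP[k0 k2]].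
    rewrite [(0%N == n)]eq_sym [(2%N == n)]eq_sym n0 n2 /=.
    move: c2; move: c => d d2.
    by rewrite !(sub0r, subr0, mul0r, addr0, add0r, mul1r) sqrrN expr1n d2.
  rewrite -!(inj_eq val_inj) /= in k0 k2.
  by rewrite (ltn_eqF (ltn_ord k)) (negPf k0) (negPf k2) subr0 mul0r addr0 expr0n.
(* The two end coefficients are units and use up 2 of the 3, so exactly one inner coefficient is
   nonzero, and it is 1 or -1. *)
have T1 : \sum_(k < n.+1 | (0 < k < n)%N) K`_k ^+ 2 = 1.
  move: S3; rewrite (bigD1 ord0) //= (bigD1 ord_max) /=; last by rewrite -lt0n ltnW // ltnW.
  rewrite K0 exprMn c2 Kn2 mul1r addrA (eq_bigl (fun k : 'I_n.+1 => (0 < k < n)%N)).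
    by move=> h; apply: (addrI 2); rewrite [LHS]h.
  move=> k; rewrite -!(inj_eq val_inj) /= lt0n; congr (_ && _).
  by rewrite ltn_neqAle -ltnS ltn_ord andbT.
have [j /andP[/andP[j0 jn] Kj0]] : exists j : 'I_n.+1, (0 < j < n)%N && (K`_j != 0).
  apply/existsP; rewrite -[[exists _, _]]negbK; apply/negP => /existsPn H.
  move: T1; rewrite big1 // => k kn; have := H k; rewrite kn /= negbK => /eqP ->.
  by rewrite expr0n.
have [Kj Ki] : K`_j ^+ 2 = 1 /\ forall i, (0 < i < n)%N -> i != j -> K`_i = 0.
  move: T1; rewrite (bigD1 j) ?j0 //=; set T := \sum_(_ | _) _ => T1.
  have T0 : 0 <= T by apply: sumr_ge0 => k _; apply: sqr_ge0.
  have Kj2 : 1 <= K`_j ^+ 2 by rewrite -gtz0_ge1 exprn_even_gt0.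
  have Kj1 : K`_j ^+ 2 = 1 by apply/eqP; rewrite eq_le Kj2 andbT -T1 lerDl.
  split => // i /andP[i0 iltn] ij.
  have /eqP : T = 0 by apply: (addrI (K`_j ^+ 2)); rewrite addr0 T1.
  rewrite psumr_eq0 => [|k _]; last exact: sqr_ge0.
  have iSn : (i < n.+1)%N by apply: ltnW.
  move/allP/(_ (Ordinal iSn)); rewrite mem_index_enum => /(_ isT).
  rewrite i0 iltn -(inj_eq val_inj) /= ij sqrf_eq0 => /eqP.
  by [].
set u := K`_n in K0 Kn2 *; set a := K`_j in Kj Kj0.
have KE i : K`_i = (i == n)%:R * u + (i == j :> nat)%:R * a + (i == 0%N)%:R * (c * u).
  have [->|i0'] := eqVneq i 0%N.
    by rewrite [(0%N == n)]eq_sym n0 [(0%N == j)]eq_sym (gtn_eqF j0) !mul0r !add0r mul1r.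
  have [->|in'] := eqVneq i n.
    by rewrite [(n == j :> nat)]eq_sym (ltn_eqF jn) mul1r !mul0r !addr0.
  have [->|ij] := eqVneq i j; first by rewrite !mul0r mul1r add0r addr0.
  rewrite !mul0r !addr0; have [lein|ltni] := leqP i n.
    by apply: Ki => //; lia.
  by rewrite nth_default // (leq_trans sK).
have Kpoly : K = trinomial u a (c * u) j.
  apply/polyP => i; rewrite KE !coefD !coefZ !coefXn coefC.
  by case: (i == 0%N); rewrite ?mul1r ?mul0r; ring.
have jn' := ltnW jn.
(* Both products with the reversal are now explicit; comparing their inner coefficients places j at
   2 or n - 2. *)
have eqc i : (0 < i < n)%N ->
    (i == j)%N%:R * (a * u) + (i == n - j)%N%:R * (a * (c * u)) =
    (i == 2%N)%:R * (-1 * 1) + (i == n - 2)%N%:R * (-1 * c).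
  move=> h; have e1 := coef_mul_trinomial u a (c * u) jn' h.
  have e2 := coef_mul_trinomial 1 (-1) c (ltnW n3) h.
  rewrite -(revp_trinomial u a (c * u) jn') -Kpoly in e1.
  rewrite -(revp_trinomial 1 (-1) c (ltnW n3)) -ljunggrenE -KK in e2.
  by rewrite -e1 -e2.
have au : a * u = 1 \/ a * u = -1 by apply: int_sqr1; rewrite exprMn Kj Kn2.
have aE : a = (a * u) * u by rewrite -mulrA -expr2 Kn2 mulr1.
have cE : c = 1 /\ odd n \/ c = -1 /\ ~~ odd n.
  by rewrite -signr_odd /=; case: (odd n); [left|right].
have eq2 := eqc 2%N n3; have eqj : _ := eqc j; rewrite j0 jn in eqj.
have {}eqj := eqj isT.
have mainj : (j = 2%N :> nat /\ a * u = -1) \/ (j = (n - 2)%N :> nat /\ a * u = - c).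
  have jE : (j = 2%N :> nat) \/ (j = (n - 2)%N :> nat).
    apply: contrapT => /not_orP[/eqP j2 /eqP jn2].
    move: eqj eq2; rewrite eqxx (negPf j2) (negPf jn2) mulrA.
    have -> : (2%N == j) = false by rewrite eq_sym (negPf j2).
    have -> : (2%N == (n - j)%N) = false by lia.
    (* If n = 2 j, the two terms of [eqj] cancel, as n is even and c = -1; then [eq2] forces n = 4,
       that is j = 2. Otherwise [eqj] says a u = 0. *)
    have [jj|jj] := eqVneq (j : nat) (n - j)%N.
      case: cE => -[cE on]; first by lia.
      rewrite !mul0r add0r; case: eqP => n4; first by lia.
      by rewrite mul0r.
    by rewrite !mul0r mul1r; case: au => ->.
  have [n4|n4] := eqVneq n 4%N.
    have j2 : j = 2%N :> nat by case: jE => -> //; rewrite n4.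
    have n42 : (n - 2 = 2)%N by rewrite n4.
    have -> : c = -1 by case: cE => -[-> on] //; rewrite n4 in on.
    by rewrite opprK j2 n42; case: au => ->; [right|left].
  have [e1 e2] : (2%N == n - 2)%N = false /\ (n - 2 == 2)%N = false by clear -n3 n4; lia.
  have e3 : (n - (n - 2) = 2)%N by clear -n3; lia.
  case: jE => jE; [left|right]; split => //; move: eqj; rewrite jE eqxx ?e3 ?e1 ?e2.
    by rewrite !mul1r !mul0r !addr0.
  by rewrite !mul1r !mul0r addr0 add0r mulN1r.
rewrite Kpoly ljunggrenE (revp_trinomial _ _ _ (ltnW n3)).
case: mainj => -[jE auE]; rewrite jE aE auE.
  exists u; split => //; left; rewrite /trinomial !scalerDr !scalerA mulr1 mulN1r mulrN1.
  by rewrite scale_polyC [c * u]mulrC.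
have ccu : c * (u * c) = u by rewrite mulrCA -expr2 c2 mulr1.
exists (u * c); split; first by rewrite exprMn Kn2 c2.
right; rewrite /trinomial !scalerDr !scalerA -mulrA -expr2 c2 mulr1 mulrN1.
by rewrite scale_polyC mulr1 mulNr [c * u]mulrC.
Qed.

Lemma self_reciprocal_root (p : {poly int}) e (w : int) : p \is monic ->
    size p = e.+2 -> revp e.+1 p = w *: p -> w != 0 ->
  exists2 z : R[i], root (polyZC R p) z & root (polyZC R p) z^-1.
Proof.
move=> pm sp pE w0; have pm' := polyZC_monic R pm.
have sp' : size (polyZC R p) = e.+2 by rewrite size_polyZC.
have [|z zp _] := maxmod_attained pm'; first by rewrite sp'.
have rz : root (polyZC R p) z by rewrite -mem_croots.
exists z => //; have [pz1 pz2] := size_revp_monic pm sp.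
have p0 : p`_0 != 0.
  apply/eqP => p0; move: pz1; rewrite pE coefZ p0 mulr0 => /eqP.
  by rewrite eq_sym oner_eq0.
have z0 : z != 0.
  apply/eqP => z0; move: rz; rewrite z0 rootE horner_coef0 coef_polyZC intr_eq0.
  exact/negP.
have := @horner_revp _ e.+1 (polyZC R p) z; rewrite sp' => /(_ (leqnn _) z0).
rewrite (eqP rz) => /eqP; rewrite mulf_eq0 expf_eq0 (negPf z0) andbF orbF.
rewrite -[revp _ _]map_revp pE -/(polyZC R _) /polyZC map_polyZ hornerZ mulf_eq0.
by rewrite intr_eq0 (negPf w0).
Qed.

(** If f = g h, replacing h by its reversal gives K with the same product by its reversal as f. When
    K is f up to sign, h is self-reciprocal up to sign; when K is the reversal of f up to sign, g
    is. Either way f has a root together with its inverse. *)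
Lemma ljunggren_irreducible : irreducibleZ f.
Proof.
have fm := ljunggren_monic n3; have sf := size_ljunggren n3.
apply: irreducibleZ_monic => //; first by rewrite sf; lia.
move=> g h gm hm sg1 sh1 fE.
have [m sg] : exists m, size g = m.+2 by exists (size g - 2)%N; lia.
have [e sh] : exists e, size h = e.+2 by exists (size h - 2)%N; lia.
have nE : (m.+1 + e.+1 = n)%N.
  by apply/eq_add_S; rewrite -sf fE (size_monic_mul gm hm sg sh).
pose K := g * revp e.+1 h.
have srh : (size (revp e.+1 h) <= e.+2)%N by apply: size_poly.
have KK : K * revp n K = f * revp n f.
  rewrite fE /K -nE !revp_mul ?sg ?sh // revpK ?sh //; ring.
have sK : (size K <= n.+1)%N.
  rewrite (leq_trans (size_polyMleq _ _)) // sg.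
  by move: srh nE; move: (size _) => k; clear; lia.
have shared (p : {poly int}) d w : p \is monic -> size p = d.+2 ->
    (exists q, f = p * q) -> revp d.+1 p = w *: p -> w != 0 -> False.
  move=> pm sp [q fq] pE w0; have [z rz rzi] := self_reciprocal_root pm sp pE w0.
  by apply: (@ljunggren_no_reciprocal_roots R n n3 z);
    rewrite fq polyZC_mul rootM ?rz ?rzi.
have [u [u2 KE]] := ljunggren_trinomial sK KK.
have u0 : u != 0 by apply/eqP => u0; rewrite u0 expr0n in u2.
case: KE => KE.
  apply: (shared h e u hm sh) => //; first by exists g; rewrite mulrC.
  apply: (mulfI (monic_neq0 gm)).
  by rewrite -[LHS]/K KE fE scalerAr.
apply: (shared g m u gm sg) => //; first by exists h.
have rh0 : revp e.+1 h != 0.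
  apply/eqP => rh0; have [] := size_revp_monic hm sh.
  by rewrite rh0 coef0 => /eqP; rewrite eq_sym oner_eq0.
apply: (mulIf rh0); rewrite -scalerAl.
have -> : revp m.+1 g * revp e.+1 h = revp n f.
  by rewrite fE -nE revp_mul ?sg ?sh.
have : u *: K = revp n f by rewrite KE scalerA -expr2 u2 scale1r.
by move=> <-.
Qed.

(** Roots are counted with multiplicity, so a multiple one must be excluded. It would satisfy n z^n
    = 2 z^2 besides f(z) = 0, whence |z|^2 = n / (n - 2) > 1, while n |z|^n = 2 |z|^2 gives |z|^n <
    |z|^2. *)
Lemma ljunggren_simple_roots : uniq (croots (polyZC R f)).
Proof.
have fm := polyZC_monic R (ljunggren_monic n3).
rewrite -separable_prod_XsubC -[\prod_(_ <- _) _]/(prod_roots _) -croots_monic //.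
rewrite separable_poly.unlock; apply/Pdiv.ClosedField.coprimepP => z rz.
apply/negP => rz'; have e1 := root_ljunggren rz; have z0 := root_ljunggren_neq0 n3 rz.
have e2 : z ^+ n.-1 *+ n = z *+ 2.
  have : (polyZC R f)^`() = 'X^(n.-1) *+ n - 'X *+ 2.
    rewrite /polyZC /ljunggren !rmorphD rmorphN /= !map_polyXn map_polyC /=.
    by rewrite !derivD derivN !derivXn derivC addr0.
  move=> dE; move: rz'; rewrite dE hornerD hornerN !hornerMn hornerXn hornerX.
  by rewrite subr_eq0 => /eqP.
have e3 : n%:R * z ^+ n = 2%:R * z ^+ 2.
  have -> : z ^+ n = z * z ^+ n.-1 by rewrite -exprS prednK //; lia.
  by rewrite !mulr_natl -mulrnAr e2 mulrnAr.
have e4 : (n - 2)%:R * z ^+ 2 = n%:R * (-1) ^+ n.+1.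
  rewrite natrB; last by lia.
  apply/eqP; rewrite -subr_eq0; move: e3; rewrite e1 => /eqP.
  by rewrite -subr_eq0; apply: etrans; congr (_ == 0); ring.
have {e1 e2}m3 := congr1 (@cmod R) e3; have {e3}m4 := congr1 (@cmod R) e4.
have cmod_nat k : cmod (k%:R : R[i]) = k%:R.
  by rewrite -[k%:R]/((k%:Z)%:~R) cmod_int.
have cmod_sgn k : cmod ((-1) ^+ k : R[i]) = 1.
  by rewrite cmodX cmodN cmod1 expr1n.
rewrite [LHS]cmodM [RHS]cmodM !cmodX !cmod_nat in m3.
rewrite [LHS]cmodM [RHS]cmodM cmod_sgn mulr1 cmodX !cmod_nat natrB in m4; last by lia.
have n3r : 3%:R <= n%:R :> R by rewrite ler_nat.
have r0 := cmod_ge0 z; have r1 : 1 <= cmod z.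
  by rewrite leNgt; apply/negP => r1; have : cmod z ^+ 2 <= 1;
    [rewrite expr_le1 // ltW | nra].
have r2 : 1 <= cmod z ^+ 2 by rewrite exprn_ege1.
have : cmod z ^+ 2 <= cmod z ^+ n by rewrite ler_weXn2l //; lia.
by move: m3 r2 {m4}; move: (cmod z ^+ 2) (cmod z ^+ n) => x y; nra.
Qed.

End LjunggrenIrreducible.

(** * The two roots of maximal modulus of the trinomials *)

Section LjunggrenMaxmod.
Variables (R : realType) (n : nat).
Hypothesis n3 : (3 <= n)%N.
Local Notation f := (ljunggren n).
Local Notation F := (polyZC R f).

Lemma cmod_sqrE (z : R[i]) : cmod z ^+ 2 = complex.Re z ^+ 2 + complex.Im z ^+ 2.
Proof. by case: z => a b; rewrite /= sqr_sqrtr // addr_ge0 ?sqr_ge0. Qed.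

(** The moduli of z and z^2 - d determine the real part of z^2, hence the squares of the real and
    imaginary parts of z; only their signs remain free. *)
Lemma eq_cmod_sqr_sub (z w : R[i]) (d : R) : d != 0 -> cmod z = cmod w ->
    cmod (z ^+ 2 - d%:C%C) = cmod (w ^+ 2 - d%:C%C) ->
  w \in [:: z; (z^*)%C; - z; - (z^*)%C].
Proof.
move=> d0 e1 e2; have {}e1 := congr1 (fun x => x ^+ 2) e1.
have {}e2 := congr1 (fun x => x ^+ 2) e2; move: e1 e2; rewrite !cmod_sqrE.
case: z w => [a b] [a' b'] /=; rewrite !expr2 => e1 e2.
have e3 : (a * a - b * b) * d = (a' * a' - b' * b') * d by nra.
have {}e3 := mulIf d0 e3.
have a2 : a' ^+ 2 = a ^+ 2 by rewrite !expr2; lra.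
have b2 : b' ^+ 2 = b ^+ 2 by rewrite !expr2; lra.
move/eqP: a2; move/eqP: b2; rewrite !eqf_sqr !inE !eq_complex /= opprK.
by move=> /orP[] /eqP -> /orP[] /eqP ->; rewrite !eqxx ?orbT.
Qed.

(** The product of the moduli of the roots is the modulus 1 of the constant coefficient. *)
Lemma maxmod_ljunggren_ge1 : 1 <= maxmod F.
Proof.
have fm := polyZC_monic R (ljunggren_monic n3).
have r0 : 0 <= maxmod F.
  have [|z _ <-] := maxmod_attained fm; last exact: cmod_ge0.
  by rewrite size_polyZC size_ljunggren //; lia.
have : cmod F`_0 = 1.
  rewrite coef_polyZC coef_ljunggren cmod_int [(0%N == n)]eq_sym.
  rewrite (_ : (n == 0%N) = false) /=; last by lia.
  by rewrite subrr add0r mul1r normrX normrN1 expr1n.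
rewrite {1}(croots_monic fm) /prod_roots coef0_prod_XsubC cmodM cmodX cmodN cmod1.
rewrite expr1n mul1r cmod_prod => p1.
rewrite leNgt; apply/negP => r1.
have : \prod_(z <- croots F) cmod z <= \prod_(z <- croots F) maxmod F.
  rewrite big_seq [leRHS]big_seq; apply: ler_prod => z zF.
  by rewrite cmod_ge0 maxmod_ge.
rewrite p1 big_const_seq count_predT size_croots // size_polyZC size_ljunggren //=.
rewrite iter_mulr mulr1 leNgt => /negP; apply.
by rewrite exprn_ilt1 //; lia.
Qed.

Lemma nb_maxmod_of_pair (z w : R[i]) : z != w -> root F z -> root F w ->
    cmod z = maxmod F -> cmod w = maxmod F ->
    (forall x, root F x -> cmod x = maxmod F -> x \in [:: z; w]) ->
  nb_maxmod_roots F = 2%N.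
Proof.
move=> zw rz rw mz mw H; have fm := polyZC_monic R (ljunggren_monic n3).
have [s [t [pst sr tr <-]]] := maxmod_split F.
have us : uniq s.
  have := ljunggren_simple_roots R n3; rewrite -(perm_uniq pst) cat_uniq.
  by case/and3P.
have zs : z \in s by apply: (mem_maxmod_split pst tr) => //; rewrite mem_croots.
have ws : w \in s by apply: (mem_maxmod_split pst tr) => //; rewrite mem_croots.
apply/eqP; rewrite eqn_leq; apply/andP; split.
  apply: (@uniq_leq_size _ _ [:: z; w] us) => x xs; apply: H; last exact: sr.
  by rewrite -mem_croots // -(perm_mem pst) mem_cat xs.
apply: (@uniq_leq_size _ [:: z; w]); first by rewrite /= inE zw.
by move=> x; rewrite !inE => /orP[] /eqP ->.
Qed.

(** On the circle of radius r every root has |z^2 - 1| = |z^n| = r^n, so one extremal root leaves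
    only four candidates. Opposite numbers are not both roots for n odd, and a real root x with |x|
    >= 1 is impossible since x^n = x^2 - 1. *)
Lemma ljunggren_maxmod_odd : odd n -> nb_maxmod_roots F = 2%N.
Proof.
move=> on; have fm := polyZC_monic R (ljunggren_monic n3).
have [|z zf mz] := maxmod_attained fm; first by rewrite size_polyZC size_ljunggren //; lia.
have rz : root F z by rewrite -mem_croots.
have sgn1 : (-1) ^+ n.+1 = 1 :> R[i] by rewrite -signr_odd /= on.
have r1 := maxmod_ljunggren_ge1.
have noneg x : root F x -> ~~ root F (- x).
  move=> rx; apply/negP => rx'; have e1 := root_ljunggren rx.
  have e2 := root_ljunggren rx'; rewrite sgn1 in e1 e2; move: e2.
  rewrite sqrrN exprNn -signr_odd on expr1 mulN1r -e1 => /eqP.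
  rewrite eq_sym -subr_eq0 opprK -mulr2n mulrn_eq0 /= expf_eq0.
  by rewrite (negPf (root_ljunggren_neq0 n3 rx)) andbF.
have zJ : z != (z^*)%C.
  apply/eqP => zJ; have [x zx] : exists x : R, z = x%:C%C.
    case: z zJ {zf mz rz} => x y [] h; exists x.
    have y0 : y = 0 by lra.
    by rewrite y0.
  have := root_ljunggren rz; rewrite sgn1 zx => e1.
  have {}e1 : x ^+ n = x ^+ 2 - 1 by apply: complexI; rewrite rmorphXn rmorphB rmorphXn rmorph1.
  have x1 : 1 <= `|x| by rewrite -cmod_real -zx mz.
  have : `|x| ^+ 2 <= `|x| ^+ n by rewrite ler_weXn2l //; lia.
  rewrite -[X in _ <= X]normrX e1 real_normK ?num_real // => h.
  have : 1 <= `|x| ^+ 2 by rewrite exprn_ege1.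
  rewrite real_normK ?num_real // => x2.
  by move: h; rewrite ger0_norm; lra.
apply: (@nb_maxmod_of_pair z (z^*)%C) => //; rewrite ?cmodJ //.
  exact: root_polyZC_conj.
move=> x rx mx; have : x \in [:: z; (z^*)%C; - z; - (z^*)%C].
  apply: (@eq_cmod_sqr_sub z x 1); rewrite ?oner_eq0 // ?mz ?mx // rmorph1.
  rewrite -sgn1 -(root_ljunggren rz) -(root_ljunggren rx) !cmodX mz mx.
  by [].
rewrite !inE => /or4P[-> //|->|/eqP xz|/eqP xz]; rewrite ?orbT //.
  by have := noneg z rz; rewrite -xz rx.
by have := noneg _ (root_polyZC_conj rz); rewrite -xz rx.
Qed.

(** Let p be a root of x^n = x^2 + 1 with p >= 1. An extremal root x gives r^n = |x^2 + 1| <= r^2 +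
    1, which forces r = p; equality in the triangle inequality then makes x real. *)
Lemma ljunggren_maxmod_even : ~~ odd n -> nb_maxmod_roots F = 2%N.
Proof.
move=> on; have fm := polyZC_monic R (ljunggren_monic n3).
have sgn1 (S : pzRingType) : (-1) ^+ n.+1 = -1 :> S by rewrite -signr_odd /= on.
have r1 := maxmod_ljunggren_ge1; set r := maxmod F in r1.
have [p p1 pE] : exists2 p : R, 1 <= p & p ^+ n = p ^+ 2 + 1.
  have [||p] := @poly_ivt R ('X^n - 'X^2 - 1) 1 2; first by rewrite ler1n.
    rewrite !hornerE !expr1n subrr sub0r oppr_le0 ler01 /=.
    have : 2 ^+ 3 <= 2 ^+ n :> R by rewrite ler_weXn2l // ler1n.
    by rewrite !exprS expr0; lra.
  move=> /andP[p1 _]; rewrite rootE !hornerE => /eqP h.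
  by exists p => //; lra.
have rootp (x : R) : x ^+ n = x ^+ 2 + 1 -> root F x%:C%C.
  move=> h; rewrite rootE horner_ljunggren sgn1 -!rmorphXn h rmorphD rmorph1.
  by apply/eqP; ring.
have rp := rootp p pE.
have pr : p <= r.
  rewrite -[p]ger0_norm ?(le_trans ler01) // -cmod_real.
  by apply: maxmod_ge; rewrite mem_croots.
have cn (x : R[i]) : root F x -> cmod x = r ->
    r ^+ n = cmod (x ^+ 2 + 1) /\ r ^+ n <= r ^+ 2 + 1.
  move=> rx mx; have e : r ^+ n = cmod (x ^+ 2 + 1).
    by rewrite -mx -cmodX (root_ljunggren rx) sgn1 opprK.
  split => //; rewrite e -mx -cmodX -(cmod1 R).
  exact: ler_cmodD.
have [|z zf mz] := maxmod_attained fm; first by rewrite size_polyZC size_ljunggren //; lia.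
have rz : root F z by rewrite -mem_croots.
have [_ rn] := cn z rz mz.
have rE : r = p.
  apply/eqP; rewrite eq_le pr andbT leNgt; apply/negP => pr'.
  have nE : n = (2 + (n - 2))%N by rewrite (subnKC (ltnW n3)).
  rewrite nE !exprD in pE rn.
  have h1 : p ^+ (n - 2) <= r ^+ (n - 2) by rewrite lerXn2r ?nnegrE //; lra.
  have h2 : p ^+ 2 < r ^+ 2 by rewrite ltrXn2r ?nnegrE //; lra.
  have h3 : 1 <= p ^+ 2 by rewrite exprn_ege1.
  move: (p ^+ 2) (r ^+ 2) (p ^+ (n - 2)) (r ^+ (n - 2)) pE rn h1 h2 h3 => a b u v.
  move=> e1 e2 h1 h2 h3; have : 1 < u by nra.
  by nra.
apply: (@nb_maxmod_of_pair p%:C%C (- p)%:C%C) => //.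
- by apply/eqP => -[] h; lra.
- by apply: rootp; rewrite exprNn -signr_odd (negPf on) mul1r sqrrN.
- by rewrite cmod_real ger0_norm //; lra.
- by rewrite cmod_real normrN ger0_norm //; lra.
move=> x rx mx; have [e _] := cn x rx mx.
have rpn : r ^+ n = r ^+ 2 + 1 by rewrite rE.
rewrite rpn in e.
have := congr1 (fun x => x ^+ 2) e; have := congr1 (fun x => x ^+ 2) mx; rewrite !cmod_sqrE /=.
case: x rx {mx e} => a b rx /=; rewrite !expr2 => e1 e2.
rewrite -e1 in e2.
have b0 : b * b = 0 by nra.
have {}b0 : b = 0 by apply/eqP; rewrite -[_ == 0]orbb -mulf_eq0 b0.
rewrite b0 mulr0 addr0 -/r rE in e1.
have /eqP : a ^+ 2 = p ^+ 2 by rewrite !expr2.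
by rewrite eqf_sqr !inE !eq_complex /= b0 eqxx !andbT.
Qed.

Lemma ljunggren_maxmod : nb_maxmod_roots F = 2%N.
Proof.
have [on|on] := boolP (odd n); [exact: ljunggren_maxmod_odd|exact: ljunggren_maxmod_even].
Qed.

End LjunggrenMaxmod.

(** * The orders of growth in general degree *)

Section GeneralOrders.
Variable R : realType.

Lemma coef_mulXn_height (p : {poly int}) m H : (height p <= H)%N ->
  (height ('X^m * p) <= H)%N.
Proof.
move=> /height_leP pH; apply/height_leP => i; rewrite coefXnM.
by case: ifP => // _; rewrite absz0.
Qed.

Lemma prod_roots_nseq0 m : prod_roots (nseq m (0 : R[i])) = 'X^m.
Proof.
elim: m => [|m IH]; first by rewrite /prod_roots big_nil expr0.
by rewrite prod_roots_cons IH subr0 exprS.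
Qed.

Lemma nb_maxmod_mulXn (p : {poly int}) (s : seq R[i]) m (r : R) : 0 < r ->
    polyZC R p = prod_roots s -> s != [::] -> {in s, forall z, cmod z = r} ->
  nb_maxmod_roots (polyZC R ('X^m * p)) = size s.
Proof.
move=> r0 pE s0 sr; apply: (@nb_maxmod_unique _ _ s (nseq m 0) r) => //.
  apply: perm_croots; rewrite prod_roots_cat prod_roots_nseq0 -pE polyZC_mul mulrC.
  by rewrite /polyZC map_polyXn.
by move=> z /nseqP[-> _]; rewrite cmod0.
Qed.

Lemma reducibleZ_mulXn (p : {poly int}) m : p \is monic -> (1 < size p)%N ->
  reducibleZ ('X^(m.+1) * p).
Proof. by move=> pm sp; apply: reducibleZ_mul; rewrite ?monicXn ?size_polyXn. Qed.

Lemma monic_height_mulXn (p : {poly int}) m d H : p \is monic -> size p = d.+1 ->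
  (height p <= H)%N -> monic_height_le (m + d) H ('X^m * p).
Proof.
move=> pm sp hp; split; first by rewrite monicMl ?monicXn.
  by rewrite (size_monic_mul (monicXn _ _) pm (size_polyXn _ _) sp).
exact: coef_mulXn_height.
Qed.

Lemma reducible_one_maxmod n :
  same_order_from 1 (nb_reducible R n.+3 1) (fun H : R => H ^+ n.+2).
Proof.
apply: (@same_order_from_ext R 1 _ (fun x : R => x `^ n.+2%:R)).
  by move=> H _; rewrite powR_mulrn.
apply: (@same_order_from_powR R n.+3 (reducible_with R n.+3 1) n.+2%:R 4^-1 _) => //.
- exact: reducible_with_sub.
- apply: growth_le_sub _ _ (@growth_reducible R n.+3 isT).
    by move=> H _ f [fn red _].
  by rewrite -[n.+3]addn1 natrD; lra.
- exact: growth_reducible_one_maxmod_lower.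
move=> H H0; exists ('X^(n.+2) * ('X - 1)).
have pm : 'X - 1 \is @monic int by exact: monicXsubC.
have sp : size ('X - 1 : {poly int}) = 2%N by exact: size_XsubC.
split.
- rewrite -[n.+3]addn1; apply: monic_height_mulXn => //.
  apply/height_leP => i; rewrite coefB coefX coef1.
  by case: i => [|[|i]] /=; rewrite ?subr0 ?sub0r.
- by apply: reducibleZ_mulXn; rewrite ?sp.
- apply: (@nb_maxmod_mulXn _ [:: 1] _ 1) => //; last first.
    by move=> z; rewrite inE => /eqP ->; rewrite cmod1.
  by rewrite /polyZC rmorphB /= map_polyX rmorph1 /prod_roots big_seq1.
Qed.

Lemma irreducible_two_maxmod n :
  same_order_from 1 (nb_irreducible R n.+3 2) (fun H : R => H `^ (n.+3%:R - 1 / 2)).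
Proof.
have [H1 low _] := irreducible_two_maxmod_lower R n.
have n1 : 1 <= n.+3%:R :> R by rewrite ler1n.
apply: (@same_order_from_powR R n.+3 (irreducible_with R n.+3 2) _ 8^-1 H1) => //.
- lra.
- exact: irreducible_with_sub.
- apply: growth_le_sub _ (lexx _) (@growth_multiple_maxmod R n.+1).
  by move=> H _ f [fn _ nb]; split => //; rewrite nb.
move=> H H0; exists (ljunggren n.+3); split.
- split; [exact: ljunggren_monic|exact: size_ljunggren|].
  by rewrite ljunggren_height.
- exact: ljunggren_irreducible.
- exact: ljunggren_maxmod.
Qed.

Lemma reducible_two_maxmod n :
  same_order_from 1 (nb_reducible R n.+3 2) (fun H : R => H `^ (n.+3%:R - 3 / 2)).
Proof.
have n1 : 3%:R <= n.+3%:R :> R by rewrite ler_nat.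
apply: (@same_order_from_powR R n.+3 (reducible_with R n.+3 2) _ 4^-1 _) => //.
- lra.
- exact: reducible_with_sub.
- exact: growth_reducible_two_maxmod.
- exact: reducible_two_maxmod_lower.
move=> H H0; exists ('X^(n.+1) * ('X^2 + 1)).
have pm : 'X^2 + 1 \is @monic int by exact: monicXnaddC.
have sp : size ('X^2 + 1 : {poly int}) = 3%N by exact: size_XnaddC.
split.
- rewrite -[n.+3]addn2; apply: monic_height_mulXn => //.
  apply/height_leP => i; rewrite coefD coefXn coef1.
  by case: i => [|[|[|i]]] /=; rewrite ?addr0 ?add0r.
- by apply: reducibleZ_mulXn; rewrite ?sp.
- apply: (@nb_maxmod_mulXn _ [:: 'i; - 'i] _ 1) => //; last first.
    by move=> z; rewrite !inE => /orP[]/eqP ->; rewrite ?cmodN;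
      apply: complexI; rewrite cmodE normCi.
  rewrite /polyZC rmorphD /= map_polyXn rmorph1 /prod_roots big_cons big_seq1.
  rewrite polyCN opprK -subr_sqr -polyC_exp sqrCi polyCN opprK.
  by [].
Qed.

Lemma general_degree n : (3 <= n)%N ->
    [/\ asymp_equivalent (nb_irreducible R n 1) (fun H : R => (2 * H) ^+ n),
        same_order_from 1 (nb_reducible R n 1) (fun H : R => H ^+ n.-1),
        same_order_from 1 (nb_irreducible R n 2) (fun H : R => H `^ (n%:R - 1 / 2))
      & same_order_from 1 (nb_reducible R n 2) (fun H : R => H `^ (n%:R - 3 / 2))].
Proof.
move=> n3; split; first exact: irreducible_one_maxmod.
- by case: n n3 => [|[|[|n]]] // _; apply: reducible_one_maxmod.
- by case: n n3 => [|[|[|n]]] // _; apply: irreducible_two_maxmod.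
- by case: n n3 => [|[|[|n]]] // _; apply: reducible_two_maxmod.
Qed.

End GeneralOrders.

(** * Cubic polynomials with all roots of the same modulus *)

Section RealRoots.
Variable R : realType.

(** Supplies the length m of the parameter ranges in the lower bounds for cubics and quartics: m has
    order H^(1/q), and coefficients up to K m^q remain admissible. *)
Lemma nat_root_lower (q K : nat) : (0 < q)%N -> (0 < K)%N -> exists2 c : R, 0 < c &
  exists H1, forall H, (H1 <= H)%N -> exists m, [/\ (0 < m)%N, (K * m ^ q <= H)%N &
    c * H%:R `^ (q%:R^-1) <= m%:R].
Proof.
move=> q0 K0; have K0r : 0 < K%:R :> R by rewrite ltr0n.
have q0r : q%:R != 0 :> R by rewrite pnatr_eq0 -lt0n.
exists (2^-1 * (K%:R^-1) `^ (q%:R^-1)).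
  by rewrite mulr_gt0 ?invr_gt0 ?powR_gt0 ?invr_gt0.
exists (K * 2 ^ q)%N => H HH; pose x : R := (H%:R / K%:R) `^ (q%:R^-1).
have HK0 : 0 <= H%:R / K%:R :> R by rewrite divr_ge0.
have xq : x ^+ q = H%:R / K%:R.
  by rewrite -powR_mulrn ?powR_ge0 // -powRrM mulVf // powRr1.
have x0 : 0 <= x by rewrite powR_ge0.
have x2 : 2 <= x.
  rewrite -(ler_pXn2r q0) ?nnegrE // xq ler_pdivlMr // mulrC -natrX -natrM ler_nat.
  exact: HH.
have /andP[lo hi] := truncn_itv x0; set m := Num.trunc x in lo hi.
have m1 : x / 2 <= m%:R by move: hi; rewrite -[m.+1]addn1 natrD; lra.
exists m; split.
- by rewrite -(ltr0n R); lra.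
- rewrite -(ler_nat R) natrM natrX mulrC -ler_pdivlMr // -xq.
  by rewrite lerXn2r ?nnegrE.
- apply: le_trans m1; rewrite /x powRM ?invr_ge0 //.
  by rewrite le_eqVlt; apply/orP; left; apply/eqP; ring.
Qed.

Lemma abs_root_le (q : nat) (k : int) (H : R) : (0 < q)%N -> 0 <= H ->
  `|k|%:~R ^+ q <= H -> `|k|%:~R <= H `^ (q%:R^-1).
Proof.
move=> q0 H0; have q0r : q%:R != 0 :> R by rewrite pnatr_eq0 -lt0n.
have k0 : 0 <= `|k|%:~R :> R by rewrite ler0z.
have HE : (H `^ (q%:R^-1)) ^+ q = H.
  by rewrite -powR_mulrn ?powR_ge0 // -powRrM mulVf // powRr1.
by rewrite -{1}HE ler_pXn2r // ?nnegrE ?powR_ge0.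
Qed.

(** The discriminant is at most 0, so the roots are conjugate or a double real root, and their
    product is s. *)
Lemma quadratic_root_modulus (t s : R) (z : R[i]) : t ^+ 2 <= 4 * s ->
  z ^+ 2 + t%:C%C * z + s%:C%C = 0 -> cmod z ^+ 2 = s.
Proof.
move=> ts; rewrite cmod_sqrE; case: z => a b /eqP.
rewrite expr2 eq_complex /= => /andP[/eqP h1 /eqP h2].
have {}h1 : a * a - b * b + t * a + s = 0 by rewrite -h1; ring.
have {}h2 : b * (2 * a + t) = 0 by rewrite -h2; ring.
move/eqP: h2; rewrite mulf_eq0 => /orP[/eqP b0|/eqP at0].
  move: h1 ts; rewrite b0 !expr2 => h1 ts.
  have : (2 * a + t) ^+ 2 <= 0 by rewrite expr2; nra.
  rewrite real_exprn_even_le0 ?num_real //= => /eqP at0.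
  have tE : t = - (2 * a) by lra.
  by move: h1; rewrite tE; lra.
have tE : t = - (2 * a) by lra.
by move: h1; rewrite tE !expr2; lra.
Qed.

Lemma nb_maxmod_full (f : {poly R[i]}) : f \is monic ->
  nb_maxmod_roots f = (size f).-1 -> {in croots f, forall z, cmod z = maxmod f}.
Proof.
move=> fm; rewrite -size_croots // /nb_maxmod_roots => /eqP.
by rewrite -all_count => /allP h z /h /eqP.
Qed.

Lemma nb_maxmod_same (f : {poly R[i]}) (r : R) : f \is monic -> (1 < size f)%N ->
  (forall z, root f z -> cmod z = r) -> nb_maxmod_roots f = (size f).-1.
Proof.
move=> fm sf fr; rewrite -size_croots //.
apply: (@nb_maxmod_unique _ _ _ [::] r) => //; first by rewrite cats0.
  by rewrite -size_eq0 size_croots //; case: (size f) sf => [|[|]].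
by move=> z; rewrite mem_croots // => /fr.
Qed.

Lemma conj_prod (z : R[i]) (r : R) : cmod z = r -> z * (z^*)%C = (r ^+ 2)%:C%C.
Proof. by move=> <-; rewrite cmod_sqr. Qed.

Lemma coef_prod_roots3 (a b c : R[i]) : let p := prod_roots [:: a; b; c] in
  [/\ p`_2 = - (a + b + c), p`_1 = a * b + a * c + b * c & p`_0 = - (a * b * c)].
Proof.
have -> : prod_roots [:: a; b; c] = 'X^3 + (- (a + b + c)) *: 'X^2 +
    (a * b + a * c + b * c) *: 'X + (- (a * b * c))%:P.
  rewrite /prod_roots !big_cons big_nil -!mul_polyC !rmorphN !rmorphD !rmorphM /=; ring.
by rewrite /= !coefD !coefZ !coefXn !coefX !coefC /=; split; ring.
Qed.

Lemma seq3E (T : Type) (s : seq T) : size s = 3%N -> exists a b c, s = [:: a; b; c].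
Proof. by case: s => [|a [|b [|c []]]] // _; exists a, b, c. Qed.

(* Every root z of modulus r satisfies conj z = r^2 / z, so that conjugating the
   sum of the roots relates it to the second symmetric function. *)
Lemma cubic_same_modulus (f : {poly int}) (r : R) : f \is monic -> size f = 4%N ->
    (forall z, root (polyZC R f) z -> cmod z = r) ->
  [/\ (f`_1)%:~R * r ^+ 2 = (f`_0)%:~R * (f`_2)%:~R, (f`_0)%:~R ^+ 2 = r ^+ 6 &
      `|f`_2|%:~R <= 3 * r].
Proof.
move=> fm sf fr; have fm' := polyZC_monic R fm.
have [|a [b [c abc]]] := @seq3E _ (croots (polyZC R f)).
  by rewrite size_croots // size_polyZC sf.
have mem z : z \in [:: a; b; c] -> cmod z = r.
  by rewrite -abc mem_croots //; apply: fr.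
have ma : cmod a = r by apply: mem; rewrite !inE eqxx.
have mb : cmod b = r by apply: mem; rewrite !inE eqxx orbT.
have mc : cmod c = r by apply: mem; rewrite !inE eqxx !orbT.
have [e2 e1 e0] := coef_prod_roots3 a b c.
rewrite -abc -croots_monic // !coef_polyZC in e2 e1 e0.
have ca := conj_prod ma; have cb := conj_prod mb; have cc := conj_prod mc.
split.
- apply: complexI; rewrite !rmorphM /= !rmorph_int.
  have -> : (f`_2)%:~R = - ((a^*)%C + (b^*)%C + (c^*)%C) :> R[i].
    by rewrite -!rmorphD -rmorphN -e2 rmorph_int.
  rewrite e1 e0; set x := (a^*)%C in ca *; set y := (b^*)%C in cb *; set z := (c^*)%C in cc *.
  rewrite [RHS](_ : _ = b * c * (a * x) + a * c * (b * y) + a * b * (c * z)); last by ring.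
  by rewrite ca cb cc; ring.
- have := congr1 (fun z => cmod z ^+ 2) e0.
  rewrite /= cmod_int cmodN !cmodM ma mb mc intr_norm real_normK ?num_real //.
  by move=> ->; ring.
- rewrite -cmod_int e2 cmodN (le_trans (ler_cmodD _ _)) // mc.
  have := ler_cmodD a b; rewrite ma mb; lra.
Qed.

(** Let u, v, w be the coefficients of X^2, X and 1. Eliminating r gives v^3 = w u^3 when u and w
    are nonzero, so u divides v; then k = v / u satisfies w = k^3 and |k| = r, and -k is an integer
    root. *)
Lemma cubic_same_modulus_int (f : {poly int}) (r : R) : f \is monic -> size f = 4%N ->
    (forall z, root (polyZC R f) z -> cmod z = r) ->
  (f`_2 = 0 /\ f`_1 = 0) \/
  exists k : int, [/\ f`_1 = f`_2 * k, f`_0 = k ^+ 3 & `|f`_2| <= 3 * `|k|].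
Proof.
move=> fm sf fr; have [e1 e2 e3] := cubic_same_modulus fm sf fr.
set u := f`_2 in e1 e3 *; set v := f`_1 in e1 *; set w := f`_0 in e1 e2 *.
have r0 : 0 <= r.
  have [|z zf _] := maxmod_attained (polyZC_monic R fm); first by rewrite size_polyZC sf.
  by rewrite -(fr z) ?cmod_ge0 // -mem_croots ?polyZC_monic.
have vw : v ^+ 3 * w ^+ 2 = w ^+ 3 * u ^+ 3.
  apply: (@intr_inj R); rewrite [LHS]rmorphM [RHS]rmorphM /= !rmorphXn /= e2.
  have -> : r ^+ 6 = (r ^+ 2) ^+ 3 by rewrite -exprM.
  by rewrite -exprMn e1 exprMn.
have [u0|u0] := eqVneq u 0.
  left; split => //; have [r00|r00] := eqVneq r 0; last first.
    move: e1; rewrite u0 mulr0 => /eqP; rewrite mulf_eq0 expf_eq0 /= (negPf r00) orbF.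
    by rewrite intr_eq0 => /eqP.
  have [|a [b [c abc]]] := @seq3E _ (croots (polyZC R f)).
    by rewrite size_croots ?polyZC_monic // size_polyZC sf.
  have z0 z : z \in [:: a; b; c] -> z = 0.
    rewrite -abc mem_croots ?polyZC_monic // => /fr; rewrite r00 => /eqP.
    by rewrite cmod_eq0 => /eqP.
  have [_ h _] := coef_prod_roots3 a b c.
  rewrite -abc -croots_monic ?polyZC_monic // coef_polyZC in h.
  have a0 : a = 0 by apply: z0; rewrite !inE eqxx.
  have b0 : b = 0 by apply: z0; rewrite !inE eqxx orbT.
  rewrite a0 b0 !mul0r !addr0 in h.
  by apply/eqP; rewrite -(intr_eq0 R[i]) h.
right; have [w0|w0] := eqVneq w 0.
  have r00 : r = 0.
    by move/eqP: e2; rewrite w0 expr0n eq_sym expf_eq0 /= => /eqP.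
  move: e3; rewrite r00 mulr0 lerz0 normr_le0 => /eqP h.
  by rewrite h eqxx in u0.
have {}vw : v ^+ 3 = w * u ^+ 3.
  apply: (mulIf (expf_neq0 2 w0)); rewrite vw; ring.
have uv : (u %| v)%Z.
  have : (u ^+ 3 %| v ^+ 3)%Z by rewrite vw dvdz_mull.
  by rewrite !dvdzE !abszX dvdn_pexp2r.
have [k vE] := dvdzP uv; have wE : w = k ^+ 3.
  by apply: (mulIf (expf_neq0 3 u0)); rewrite -vw vE exprMn.
exists k; split => //; first by rewrite vE mulrC.
have rk : r = `|k|%:~R.
  have h : r ^+ 6 = `|k|%:~R ^+ 6.
    rewrite -e2 wE -rmorphXn -exprM /= -rmorphXn; congr (_%:~R).
    by rewrite -(normrX 6) ger0_norm // (exprM k 3 2) sqr_ge0.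
  by apply/eqP; rewrite -(eqrXn2 (n := 6)) ?ler0z //; apply/eqP.
by move: e3; rewrite rk -[3]/(3%:~R) -rmorphM ler_int.
Qed.

End RealRoots.

(** * Counting cubics with all roots of the same modulus *)

Section Cubics.
Variable R : realType.

Lemma normr_coef_le_height (f : {poly int}) H i :
  (height f <= H)%N -> `|f`_i|%:~R <= H%:R :> R.
Proof. by move=> /height_leP fH; rewrite -abszE; apply: etrans (ler_nat _ _ _) (fH i). Qed.

Definition int_iota (a l : nat) : seq int := [seq i%:Z | i <- iota a l].

Lemma mem_int_iota a l (x : int) : (x \in int_iota a l) = (a%:Z <= x < (a + l)%:Z).
Proof.
rewrite /int_iota; apply/mapP/idP => [[i1]|h].
  by rewrite mem_iota => h ->; lia.
by exists (absz x); rewrite ?mem_iota; lia.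
Qed.

Lemma int_iota_uniq a l : uniq (int_iota a l).
Proof. by rewrite map_inj_uniq ?iota_uniq // => x y []. Qed.

Lemma size_int_iota a l : size (int_iota a l) = l.
Proof. by rewrite size_map size_iota. Qed.

Lemma monic3E (f : {poly int}) : f \is monic -> size f = 3%N ->
  f = 'X^2 + f`_1 *: 'X + (f`_0)%:P.
Proof.
move=> /monicP fm sf; apply/polyP => i; rewrite !coefD !coefZ !coefXn !coefX !coefC.
rewrite lead_coefE sf /= in fm.
case: i => [|[|[|i]]] /=; last by rewrite nth_default ?sf // !(mulr0, addr0).
all: by rewrite ?fm !(mulr0, mulr1, addr0, add0r).
Qed.

Lemma monic4E (f : {poly int}) : f \is monic -> size f = 4%N ->
  f = 'X^3 + f`_2 *: 'X^2 + f`_1 *: 'X + (f`_0)%:P.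
Proof.
move=> /monicP fm sf; apply/polyP => i; rewrite !coefD !coefZ !coefXn !coefX !coefC.
rewrite lead_coefE sf /= in fm.
case: i => [|[|[|[|i]]]] /=; last by rewrite nth_default ?sf // !(mulr0, addr0).
all: by rewrite ?fm !(mulr0, mulr1, addr0, add0r).
Qed.

Lemma monic2E (f : {poly int}) : f \is monic -> size f = 2%N -> f = 'X + (f`_0)%:P.
Proof.
move=> /monicP fm sf; apply/polyP => i; rewrite !coefD !coefX !coefC.
rewrite lead_coefE sf /= in fm.
case: i => [|[|i]] /=; last by rewrite nth_default ?sf // addr0.
all: by rewrite ?fm ?addr0 ?add0r.
Qed.

Definition quadratic (t s : int) : {poly int} := 'X^2 + t *: 'X + s%:P.

Lemma size_quadratic t s : size (quadratic t s) = 3%N.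
Proof.
rewrite /quadratic -addrA size_polyDl size_polyXn //.
apply: leq_ltn_trans (size_polyD _ _) _; rewrite gtn_max.
rewrite (leq_ltn_trans (size_scale_leq _ _)) ?size_polyX //=.
by rewrite (leq_ltn_trans (size_polyC_leq1 _)).
Qed.

Lemma quadratic_monic t s : quadratic t s \is monic.
Proof.
rewrite monicE lead_coefE size_quadratic !coefD !coefZ !coefXn !coefX !coefC /=.
by rewrite mulr0 !addr0.
Qed.

Lemma root_quadratic t s (z : R[i]) : root (polyZC R (quadratic t s)) z ->
  z ^+ 2 + (t%:~R)%:C%C * z + (s%:~R)%:C%C = 0.
Proof.
rewrite /polyZC /quadratic !rmorphD /= map_polyZ /= map_polyXn map_polyX map_polyC /=.
by rewrite rootE !hornerE !rmorph_int => /eqP.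
Qed.

Lemma root_linear (b : int) (z : R[i]) :
  root (polyZC R ('X + b%:P)) z -> z = - b%:~R.
Proof.
rewrite /polyZC rmorphD /= map_polyX map_polyC /= rootE !hornerE.
by rewrite addr_eq0 => /eqP.
Qed.

Lemma linear_monic (b : int) : 'X + b%:P \is monic.
Proof. by rewrite -[b]opprK polyCN monicXsubC. Qed.

Lemma size_linear (b : int) : size ('X + b%:P) = 2%N.
Proof. by rewrite -[b]opprK polyCN size_XsubC. Qed.

Lemma reducible_cubic (f : {poly int}) : f \is monic -> size f = 4%N -> reducibleZ f ->
  exists b t s, f = ('X + b%:P) * quadratic t s.
Proof.
move=> fm sf /(reducibleZ_factor fm sf)[g [h [m [e [[gm hm fE] sg sh me mE]]]]].
have [m1 e2] : m = 1%N /\ e = 2%N by lia.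
exists g`_0, h`_1, h`_0; rewrite /quadratic -monic3E // -?monic2E //.
- by rewrite sg m1.
- by rewrite sh e2.
Qed.

Lemma cubic_product_coef (b t s : int) : let f := ('X + b%:P) * quadratic t s in
  [/\ f`_0 = b * s, f`_1 = s + b * t & f`_2 = t + b].
Proof.
have -> : ('X + b%:P) * quadratic t s =
    'X^3 + (t + b) *: 'X^2 + (s + b * t) *: 'X + (b * s)%:P.
  by rewrite /quadratic -!mul_polyC !rmorphD !rmorphM /=; ring.
by rewrite /= !coefD !coefZ !coefXn !coefX !coefC /=; split; ring.
Qed.

Lemma cubic_product_monic (b t s : int) : let f := ('X + b%:P) * quadratic t s in
  f \is monic /\ size f = 4%N.
Proof.
split; first by rewrite monicMl ?linear_monic ?quadratic_monic.
by rewrite (size_monic_mul (linear_monic b) (quadratic_monic t s) (size_linear b)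
  (size_quadratic t s)).
Qed.

Lemma cubic_product_reducible (b t s : int) : reducibleZ (('X + b%:P) * quadratic t s).
Proof.
by apply: reducibleZ_mul; rewrite ?linear_monic ?quadratic_monic ?size_linear ?size_quadratic.
Qed.

Definition cubic (w : int) : {poly int} := 'X^3 + w%:P.

Lemma cubic_monic w : cubic w \is monic. Proof. exact: monicXnaddC. Qed.

Lemma size_cubic w : size (cubic w) = 4%N. Proof. exact: size_XnaddC. Qed.

Lemma coef_cubic w i : (cubic w)`_i = (i == 3%N)%:R + (if i == 0%N then w else 0).
Proof. by rewrite coefD coefXn coefC. Qed.

Lemma cubic_height w H : (0 < H)%N -> (absz w <= H)%N -> (height (cubic w) <= H)%N.
Proof.
move=> H0 wH; apply/height_leP => i; rewrite coef_cubic.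
by case: i => [|[|[|[|i]]]] /=; rewrite ?addr0 ?add0r.
Qed.

Lemma root_cubic w (z : R[i]) : root (polyZC R (cubic w)) z -> cmod z ^+ 3 = `|w|%:~R.
Proof.
rewrite /polyZC /cubic rmorphD /= map_polyXn map_polyC /= rootE !hornerE addr_eq0.
by move=> /eqP h; rewrite -cmodX h cmodN cmod_int.
Qed.

Lemma nb_maxmod_cubic w : nb_maxmod_roots (polyZC R (cubic w)) = 3%N.
Proof.
have fm := polyZC_monic R (cubic_monic w).
have [|x xf mx] := maxmod_attained fm; first by rewrite size_polyZC size_cubic.
rewrite (@nb_maxmod_same _ _ (cmod x)) ?size_polyZC ?size_cubic // => z rz.
have rx : root (polyZC R (cubic w)) x by rewrite -mem_croots.
apply/eqP; rewrite -(eqrXn2 (n := 3)) ?cmod_ge0 //.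
by rewrite (root_cubic rz) (root_cubic rx).
Qed.

Lemma nb_full_root (f : {poly int}) n z : f \is monic -> size f = n.+1 ->
    nb_maxmod_roots (polyZC R f) = n -> root (polyZC R f) z ->
  cmod z = maxmod (polyZC R f).
Proof.
move=> fm sf nb rz; apply: nb_maxmod_full; rewrite ?polyZC_monic ?size_polyZC ?sf //.
by rewrite mem_croots ?polyZC_monic.
Qed.

Lemma irreducible_cubic_maxmod (f : {poly int}) : f \is monic -> size f = 4%N ->
    irreducibleZ f -> nb_maxmod_roots (polyZC R f) = 3%N -> f = cubic f`_0.
Proof.
move=> fm sf irr nb; have fE := monic4E fm sf.
have := @cubic_same_modulus_int R f (maxmod (polyZC R f)) fm sf.
case=> [z|[u0 v0]|[k [vE wE _]]]; first exact: (nb_full_root fm sf nb).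
  by rewrite {1}fE u0 v0 !scale0r !addr0.
exfalso; apply: (irreducibleZ_nonfactor irr (linear_monic k)
  (quadratic_monic (f`_2 - k) (k ^+ 2))); rewrite ?size_linear ?size_quadratic //.
rewrite {1}fE vE wE /quadratic -!mul_polyC !rmorphB !rmorphM /=; ring.
Qed.

Lemma cubic_irreducible w : (forall k, w <> k ^+ 3) -> irreducibleZ (cubic w).
Proof.
move=> wk; have [|//|red] := reducibleZ_dec (cubic_monic w); first by rewrite size_cubic.
have [b [t [s fE]]] := reducible_cubic (cubic_monic w) (size_cubic w) red.
have [e0 e1 e2] := cubic_product_coef b t s; rewrite -fE !coef_cubic /= in e0 e1 e2.
exfalso; apply: (wk b).
have tE : t = - b by lia.
have sE : s = b ^+ 2 by rewrite expr2; move: e1; rewrite tE; lia.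
by move: e0; rewrite sE add0r => ->; ring.
Qed.

(** The polynomials are the X^3 + w with w not a cube; there are O(H^(1/3)) cubes, within the
    admissible error O(sqrt H). *)
Lemma irreducible_cubic_asymp : asymp_equivalent (nb_irreducible R 3 3) (fun H : R => 2 * H).
Proof.
apply: (@asymp_equivalent_intro R _ _ 1) => H H0.
- by rewrite mulr_gt0 // ltr0n.
- have H1 : 1 <= H%:R :> R by rewrite ler1n.
  have s1 := sqrt_nat_ge1 R H0.
  have s2 : Num.sqrt H%:R * Num.sqrt H%:R = H%:R :> R by rewrite -expr2 sqr_sqrtr.
  apply: card_at_least_fset_set (finite_irreducible_with R 3 3 H) _.
  pose A := [set cubic w | w in [set` int_range (H%:R : R)]].
  pose x : R := H%:R `^ 3%:R^-1.
  pose B := [set f | f \in [seq cubic (k ^+ 3) | k <- int_range x]].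
  have x0 : 0 <= x by rewrite powR_ge0.
  have Alow : card_at_least A (2 * H%:R + 1 : R).
    exists [seq cubic w | w <- int_range (H%:R : R)]; split.
    - rewrite map_inj_uniq ?int_range_uniq // => w w' /(congr1 (coefp 0)).
      by rewrite /= !coef_cubic /= !add0r.
    - by move=> f /mapP[w wH ->]; exists w.
    - by rewrite size_map size_int_range_nat natr_doubleS.
  have Bup : card_at_most B (2 * x + 1).
    exists [seq cubic (k ^+ 3) | k <- int_range x]; split => //.
    by rewrite size_map size_int_range_le.
  apply: card_at_least_sub _ _ (card_at_leastD Alow Bup).
    move=> f [[w /= wH <-] nB]; rewrite mem_int_range // -abszE ler_nat in wH.
    split; [split|apply: cubic_irreducible|exact: nb_maxmod_cubic].
    - exact: cubic_monic.
    - exact: size_cubic.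
    - exact: cubic_height.
    move=> k wE; apply: nB; rewrite wE; change (cubic (k ^+ 3) \in [seq cubic (k ^+ 3) | k <- int_range x]).
    apply/mapP; exists k => //.
    rewrite mem_int_range //; apply: abs_root_le => //; rewrite -(rmorphXn (intr : int -> R)) -normrX -wE -abszE.
    by rewrite ler_nat.
  have xs : x <= Num.sqrt H%:R.
    by rewrite -powR12_sqrt // /x ler_powR_nat //; lra.
  have e : 1 / Num.sqrt H%:R * (2 * H%:R) = 2 * Num.sqrt H%:R :> R.
    by rewrite -[X in _ * (2 * X)]s2; field; lra.
  by rewrite mulrBl e; lra.
- have H1 : 1 <= H%:R :> R by rewrite ler1n.
  have s1 := sqrt_nat_ge1 R H0.
  have s2 : Num.sqrt H%:R * Num.sqrt H%:R = H%:R :> R by rewrite -expr2 sqr_sqrtr.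
  apply: le_trans (_ : 2 * H%:R + 1 <= _); last first.
    have e : 1 / Num.sqrt H%:R * (2 * H%:R) = 2 * Num.sqrt H%:R :> R.
      by rewrite -[X in _ * (2 * X)]s2; field; lra.
    by rewrite [leRHS]mulrDl e; lra.
  apply: card_at_most_fset_set; exists [seq cubic w | w <- int_range (H%:R : R)].
  split; last by rewrite size_map size_int_range_nat natr_doubleS.
  move=> f [[fm sf fH] irr nb]; rewrite (irreducible_cubic_maxmod fm sf irr nb).
  by rewrite map_f // mem_int_range //; apply: normr_coef_le_height.
Qed.

(** Such a cubic is X^3 + u X^2 + u k X + k^3 with |k| <= H^(1/3) and |u| <= 3 |k|: two parameters
    of size O(H^(1/3)). *)
Lemma reducible_cubic_growth : growth_le (reducible_with R 3 3) (2 / 3 : R).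
Proof.
exists 27 => // H H0; have H1 : 1 <= H%:R :> R by rewrite ler1n.
pose x : R := H%:R `^ 3%:R^-1; have x1 : 1 <= x by rewrite powR_nat_ge1.
pose F (k u : int) : {poly int} := 'X^3 + u *: 'X^2 + (u * k) *: 'X + (k ^+ 3)%:P.
exists [seq F k u | k <- int_range x, u <- int_range (3 * x)]; split; last first.
  rewrite size_allpairs natrM.
  have -> : H%:R `^ (2 / 3) = x * x.
    rewrite /x -powRD; first by congr (_ `^ _); lra.
    by apply/implyP => _; rewrite pnatr_eq0 -lt0n.
  rewrite [leRHS](_ : _ = (3 * x) * (3 * (3 * x))); last by ring.
  by apply: ler_pM => //; apply: size_int_range_le3; lra.
move=> f [[fm sf fH] red nb]; have fE := monic4E fm sf.
have kx (k : int) : f`_0 = k ^+ 3 -> `|k|%:~R <= x.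
  move=> e; apply: abs_root_le => //.
  rewrite -(rmorphXn (intr : int -> R)) -normrX -e.
  exact: normr_coef_le_height.
(* A reducible X^3 + w also has this form, with u = 0: its linear factor X + b forces w = b^3. *)
have [k [vE wE uk]] : exists k : int, [/\ f`_1 = f`_2 * k, f`_0 = k ^+ 3 &
    `|f`_2| <= 3 * `|k|].
  have := @cubic_same_modulus_int R f (maxmod (polyZC R f)) fm sf.
  case=> [z|[u0 v0]|//]; first exact: (nb_full_root fm sf nb).
  have [b [t [s fb]]] := reducible_cubic fm sf red.
  have [e0 e1 e2] := cubic_product_coef b t s; rewrite -fb in e0 e1 e2.
  exists b; rewrite u0 v0 mul0r normr0; split => //.
  have tE : t = - b by apply/eqP; rewrite -addr_eq0 -e2 u0.
  have sE : s = b ^+ 2 by apply/eqP; rewrite expr2 -subr_eq0 -mulrN -tE -e1 v0.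
  by rewrite e0 sE; ring.
apply/allpairsP; exists (k, f`_2); split => /=.
- by rewrite mem_int_range ?kx //; lra.
- rewrite mem_int_range; last by lra.
  apply: le_trans (_ : 3 * `|k|%:~R <= _).
    by rewrite -[3]/(3%:~R) -rmorphM ler_int.
  by have := kx k wE; lra.
- by rewrite {1}fE vE wE.
Qed.

Lemma allpairs_card_at_least (S T : eqType) (U : choiceType) (s : seq S) (t : seq T)
    (F : S -> T -> U) (A : set U) : uniq s -> uniq t ->
    (forall a b a' b', a \in s -> b \in t -> a' \in s -> b' \in t ->
       F a b = F a' b' -> a = a' /\ b = b') ->
    (forall a b, a \in s -> b \in t -> A (F a b)) ->
  card_at_least A ((size s)%:R * (size t)%:R : R).
Proof.
move=> us ut Finj FA; exists [seq F a b | a <- s, b <- t]; split.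
- apply: allpairs_uniq => // -[a b] [a' b'] /allpairsP[[x y] /= [xs yt [-> ->]]].
  move=> /allpairsP[[x' y'] /= [xs' yt' [-> ->]]] e.
  by have [-> ->] := Finj _ _ _ _ xs yt xs' yt' e.
- by move=> f /allpairsP[[a b] /= [ha hb ->]]; apply: FA.
- by rewrite size_allpairs natrM.
Qed.

Lemma cubic_product_maxmod (k t : int) : t ^+ 2 <= 4 * k ^+ 2 ->
  nb_maxmod_roots (polyZC R (('X + k%:P) * quadratic t (k ^+ 2))) = 3%N.
Proof.
move=> tk; have [fm sf] := cubic_product_monic k t (k ^+ 2).
rewrite (@nb_maxmod_same _ _ `|k|%:~R) ?polyZC_monic ?size_polyZC ?sf // => z.
rewrite polyZC_mul rootM => /orP[/root_linear ->|/root_quadratic rz].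
  by rewrite cmodN cmod_int.
have := @quadratic_root_modulus R (t%:~R) ((k ^+ 2)%:~R) z _ rz.
move=> /(_ _) h; apply/eqP; rewrite -(eqrXn2 (n := 2)) ?cmod_ge0 ?ler0z //.
rewrite h; last by rewrite -rmorphXn -[4]/(4%:~R) -rmorphM ler_int.
by rewrite -rmorphXn real_normK ?num_real.
Qed.

(** For the lower bound, (X + k)(X^2 + t X + k^2) with m < k <= 2 m and 0 <= t < m has all roots of
    modulus k, as t^2 <= 4 k^2. This makes m^2 polynomials with m of order H^(1/3); the condition 8
    m^3 <= H bounds k^3. *)
Lemma reducible_three_maxmod :
  same_order_from 1 (nb_reducible R 3 3) (fun H : R => H `^ (2 / 3)).
Proof.
have [c c0 [H1 Hm]] := @nat_root_lower R 3 8 isT isT.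
apply: (@same_order_from_powR R 3 (reducible_with R 3 3) _ (c ^+ 2) H1) => //.
- by rewrite exprn_gt0.
- exact: reducible_with_sub.
- exact: reducible_cubic_growth.
- move=> H HH; have [m [m0 mH cm]] := Hm H HH.
  apply: card_at_least_sub _ _ (@allpairs_card_at_least _ _ _ (int_iota m.+1 m) (int_iota 0 m)
    (fun k t => ('X + k%:P) * quadratic t (k ^+ 2)) _ _ _ _ _); first by move=> f; exact.
  + rewrite !size_int_iota -expr2 (_ : _ `^ _ = (H%:R `^ 3%:R^-1) ^+ 2).
      by rewrite -exprMn lerXn2r ?nnegrE ?mulr_ge0 ?powR_ge0 // ltW.
    rewrite -powR_mulrn ?powR_ge0 // -powRrM; congr (_ `^ _); lra.
  + exact: int_iota_uniq.
  + exact: int_iota_uniq.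
  + move=> k t k' t'; rewrite !mem_int_iota => hk ht hk' ht' e.
    have [e0 _ e2] := cubic_product_coef k t (k ^+ 2).
    have [e0' _ e2'] := cubic_product_coef k' t' (k' ^+ 2).
    rewrite e e0' -!exprS in e0; rewrite e e2' in e2.
    have kk : k = k'.
      by apply/eqP; rewrite eq_sym -(eqrXn2 (n := 3)) ?e0 //; lia.
    by split => //; lia.
  + move=> k t; rewrite !mem_int_iota => hk ht.
    have [fm sf] := cubic_product_monic k t (k ^+ 2).
    have [e0 e1 e2] := cubic_product_coef k t (k ^+ 2).
    split; last 1 first.
    * by apply: cubic_product_maxmod; rewrite !expr2; nia.
    * split => //; apply/height_leP => i.
      have [i3|i3] := leqP i 3; last by rewrite nth_default // sf.
      have m3 : (8 * (m * m * m) <= H)%N by move: mH; rewrite !expnS expn0 muln1 -[(m * m * m)%N]mulnA.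
      have kb : (absz k <= 2 * m)%N by lia.
      have tb : (absz t <= m)%N by lia.
      have k3 : (absz k * absz k * absz k <= (2 * m) * (2 * m) * (2 * m))%N.
        by rewrite !leq_mul.
      have kt : (absz k * absz t <= (2 * m) * m)%N by rewrite leq_mul.
      have k2 : (absz k * absz k <= (2 * m) * (2 * m))%N by rewrite leq_mul.
      case: i i3 => [|[|[|[|//]]]] _.
      -- rewrite e0 !expr2 !abszM; nia.
      -- rewrite e1 expr2; apply: leq_trans (_ : absz k * absz k + absz k * absz t <= _)%N.
           by rewrite -!abszM; move: (k * k) (k * t) => x y; lia.
         nia.
      -- rewrite e2; nia.
      -- by move/monicP: fm; rewrite lead_coefE sf => ->; nia.
    * exact: cubic_product_reducible.
- move=> H H0; exists ('X^3 : {poly int}); split.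
  + split; rewrite ?monicXn ?size_polyXn //; apply/height_leP => i.
    by rewrite coefXn; case: (i == 3%N).
  + rewrite exprS; apply: reducibleZ_mul; rewrite ?monicX ?monicXn ?size_polyX ?size_polyXn //.
  + by rewrite -[X in polyZC _ X]addr0 -[0]polyC0; apply: nb_maxmod_cubic.
Qed.

End Cubics.

(** * Quartic polynomials with all roots of the same modulus *)

Section QuarticsFour.
Variable R : realType.

Lemma same_modulus_coef (f : {poly int}) n (r : R) : f \is monic -> size f = n.+2 ->
    (forall z, root (polyZC R f) z -> cmod z = r) ->
  [/\ 0 <= r, `|f`_0|%:~R = r ^+ n.+1 &
      forall i, (i <= n.+1)%N -> `|f`_i|%:~R <= 2 ^+ n.+1 * r ^+ (n.+1 - i)].
Proof.
move=> fm sf fr; have fm' := polyZC_monic R fm.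
have sf' : size (polyZC R f) = n.+2 by rewrite size_polyZC.
have [|z zf mz] := maxmod_attained fm'; first by rewrite sf'.
have mr : maxmod (polyZC R f) = r by rewrite -mz fr // -mem_croots.
split; first by rewrite -mr -mz cmod_ge0.
- rewrite -cmod_int -coef_polyZC {1}(croots_monic fm') /prod_roots coef0_prod_XsubC.
  rewrite cmodM cmodX cmodN cmod1 expr1n mul1r cmod_prod.
  transitivity (\prod_(z <- croots (polyZC R f)) r).
    by apply: eq_big_seq => x; rewrite mem_croots // => /fr.
  by rewrite big_const_seq count_predT size_croots // sf' iter_mulr mulr1.
- move=> i lei; rewrite -cmod_int -coef_polyZC -mr.
  exact: coef_le_maxmod.
Qed.

Lemma coef_prod_roots4 (a b c d : R[i]) : let p := prod_roots [:: a; b; c; d] in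
  [/\ p`_3 = - ((a + b + c) + d), p`_2 = (a * b + a * c + b * c) + d * (a + b + c),
      p`_1 = - (a * b * c + d * (a * b + a * c + b * c)) & p`_0 = d * (a * b * c)].
Proof.
have -> : prod_roots [:: a; b; c; d] = 'X^4 + (- ((a + b + c) + d)) *: 'X^3 +
    ((a * b + a * c + b * c) + d * (a + b + c)) *: 'X^2 +
    (- (a * b * c + d * (a * b + a * c + b * c))) *: 'X + (d * (a * b * c))%:P.
  rewrite /prod_roots !big_cons big_nil -!mul_polyC !rmorphN !rmorphD !rmorphM /=; ring.
by rewrite /= !coefD !coefZ !coefXn !coefX !coefC /=; split; ring.
Qed.

Lemma seq4E (T : Type) (s : seq T) : size s = 4%N -> exists a b c d, s = [:: a; b; c; d].
Proof. by case: s => [|a [|b [|c [|d []]]]] // _; exists a, b, c, d. Qed.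

Lemma quartic_same_modulus (f : {poly int}) (r : R) : f \is monic -> size f = 5%N ->
    (forall z, root (polyZC R f) z -> cmod z = r) ->
  (f`_1)%:~R * r ^+ 2 = (f`_0)%:~R * (f`_3)%:~R.
Proof.
move=> fm sf fr; have fm' := polyZC_monic R fm.
have [|a [b [c [d abcd]]]] := @seq4E _ (croots (polyZC R f)).
  by rewrite size_croots // size_polyZC sf.
have mem z : z \in [:: a; b; c; d] -> cmod z = r.
  by rewrite -abcd mem_croots //; apply: fr.
have ma : cmod a = r by apply: mem; rewrite !inE eqxx.
have mb : cmod b = r by apply: mem; rewrite !inE eqxx orbT.
have mc : cmod c = r by apply: mem; rewrite !inE eqxx !orbT.
have md : cmod d = r by apply: mem; rewrite !inE eqxx !orbT.
have [e3 _ e1 e0] := coef_prod_roots4 a b c d.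
rewrite -abcd -croots_monic // !coef_polyZC in e3 e1 e0.
have ca := conj_prod ma; have cb := conj_prod mb.
have cc := conj_prod mc; have cd := conj_prod md.
apply: complexI; rewrite !rmorphM /= !rmorph_int.
have -> : (f`_3)%:~R = - ((a^*)%C + (b^*)%C + (c^*)%C + (d^*)%C) :> R[i].
  by rewrite -!rmorphD -rmorphN -e3 rmorph_int.
rewrite e1 e0; set x := (a^*)%C in ca *; set y := (b^*)%C in cb *.
set z := (c^*)%C in cc *; set t := (d^*)%C in cd *.
rewrite [RHS](_ : _ = - (b * c * d * (a * x) + a * c * d * (b * y) +
  a * b * d * (c * z) + a * b * c * (d * t))); last by ring.
by rewrite ca cb cc cd; ring.
Qed.

Definition quartic (A B C D : int) : {poly int} :=
  'X^4 + A *: 'X^3 + B *: 'X^2 + C *: 'X + D%:P.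

Lemma coef_quartic A B C D i : (quartic A B C D)`_i = (i == 4%N)%:R + A * (i == 3%N)%:R +
  B * (i == 2%N)%:R + C * (i == 1%N)%:R + (if i == 0%N then D else 0).
Proof. by rewrite !coefD !coefZ !coefXn !coefX !coefC. Qed.

Lemma monic5E (f : {poly int}) : f \is monic -> size f = 5%N ->
  f = quartic f`_3 f`_2 f`_1 f`_0.
Proof.
move=> /monicP fm sf; apply/polyP => i; rewrite coef_quartic.
rewrite lead_coefE sf /= in fm.
case: i => [|[|[|[|[|i]]]]] /=; last by rewrite nth_default ?sf // !(mulr0, addr0).
all: by rewrite ?fm !(mulr0, mulr1, addr0, add0r).
Qed.

Lemma quartic_monic_size A B C D : quartic A B C D \is monic /\ size (quartic A B C D) = 5%N.
Proof.
have sz : size (quartic A B C D) = 5%N.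
  apply/eqP; rewrite eqn_leq; apply/andP; split.
    apply/leq_sizeP => j j5; rewrite coef_quartic.
    by case: j j5 => [|[|[|[|[|j]]]]] //= _; rewrite !(mulr0, addr0).
  rewrite ltnNge; apply/negP => /leq_sizeP/(_ 4%N (leqnn _)).
  by rewrite coef_quartic /= !(mulr0, addr0) => /eqP; rewrite oner_eq0.
split => //; rewrite monicE lead_coefE sz coef_quartic /=.
by rewrite !(mulr0, addr0).
Qed.

Lemma quartic_height A B C D H : (0 < H)%N -> (absz A <= H)%N -> (absz B <= H)%N ->
  (absz C <= H)%N -> (absz D <= H)%N -> (height (quartic A B C D) <= H)%N.
Proof.
move=> H0 hA hB hC hD; apply/height_leP => i; rewrite coef_quartic.
case: i => [|[|[|[|[|i]]]]] /=; rewrite !(mulr0, mulr1, addr0, add0r) //.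
Qed.

Lemma mul_quadratic a s b t :
  quadratic a s * quadratic b t = quartic (a + b) (s + t + a * b) (a * t + b * s) (s * t).
Proof. by rewrite /quadratic /quartic -!mul_polyC !rmorphD !rmorphM /=; ring. Qed.

Lemma size_allpairs_pair (S T : Type) (s : seq S) (t : seq T) (x y : R) :
    (size s)%:R <= x -> (size t)%:R <= y ->
  (size [seq (a, b) | a <- s, b <- t])%:R <= x * y.
Proof. by move=> sx ty; rewrite size_allpairs natrM ler_pM. Qed.

(** Write A, B, C, D for the coefficients from X^3 down. If A = 0, then C = 0 and (B, D) ranges over
    O(sqrt H) times O(H) pairs. Otherwise C^2 = |D| A^2 makes C = s A and |D| = s^2, and A, B, s are
    each O(sqrt H). *)
Lemma four_maxmod_growth :
  growth_le (fun H => [set f | monic_height_le 4 H f /\ nb_maxmod_roots (polyZC R f) = 4%N])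
    (3 / 2 : R).
Proof.
exists (48 * 3 + 48 * 48 * 6); first by rewrite addr_gt0 ?mulr_gt0 ?ltr0n.
move=> H H0; have H1 : 1 <= H%:R :> R by rewrite ler1n.
set x := Num.sqrt (H%:R : R); have x1 : 1 <= x := sqrt_nat_ge1 R H0.
have x2 : x * x = H%:R by rewrite -expr2 sqr_sqrtr.
pose F1 (p : int * int) := quartic 0 p.1 0 p.2.
pose F2 (p : (int * int) * (int * int)) := quartic p.1.1 p.1.2 (p.1.1 * p.2.1) (p.2.2 * p.2.1 ^+ 2).
pose l1 := [seq (B, D) | B <- int_range (16 * x), D <- int_range (H%:R : R)].
pose l2 := [seq (p, q) | p <- [seq (A, B) | A <- int_range (16 * x), B <- int_range (16 * x)],
  q <- [seq (s, e) | s <- int_range x, e <- [:: 1; -1 : int]]].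
have s16 : (size (int_range (16 * x)))%:R <= 3 * (16 * x) by apply: size_int_range_le3; lra.
have sx : (size (int_range x))%:R <= 3 * x by apply: size_int_range_le3.
have sH : (size (int_range (H%:R : R)))%:R <= 3 * (x * x).
  by rewrite x2; apply: size_int_range_le3.
have hE : H%:R `^ (3 / 2) = x * x * x.
  have -> : 3 / 2 = 2%:R - 1 / 2 :> R by lra.
  by rewrite -powR_half ?ltr0n // expr1 x2.
exists (map F1 l1 ++ map F2 l2); split; last first.
  rewrite size_cat !size_map natrD hE mulrDl; apply: lerD.
    apply: le_trans (size_allpairs_pair s16 sH) _.
    by rewrite le_eqVlt; apply/orP; left; apply/eqP; ring.
  apply: le_trans (size_allpairs_pair (size_allpairs_pair s16 s16)
    (size_allpairs_pair sx (_ : (size [:: 1; -1 : int])%:R <= 2))) _ => //.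
  by rewrite le_eqVlt; apply/orP; left; apply/eqP; ring.
move=> f [[fm sf fH] nb]; have fE := monic5E fm sf.
pose r := maxmod (polyZC R f).
have fr z : root (polyZC R f) z -> cmod z = r by apply: (nb_full_root fm sf nb).
have [r0 e0 ei] := same_modulus_coef fm sf fr.
have eC := quartic_same_modulus fm sf fr.
have rH : (r ^+ 2) ^+ 2 <= x ^+ 2.
  by rewrite -exprM -e0 expr2 x2; apply: normr_coef_le_height.
have rx : r ^+ 2 <= x.
  by rewrite -(ler_pXn2r (n := 2)) ?nnegrE ?exprn_ge0 //; lra.
have rx1 : r <= x.
  have [r1|/ltW r1] := leP r 1; first by lra.
  by apply: le_trans rx; rewrite expr2; nra.
have hB : f`_2 \in int_range (16 * x).
  rewrite mem_int_range; last by lra.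
  by have := ei 2%N isT; rewrite (_ : 2 ^+ 4 = 16 :> R); [lra | ring].
have hA : f`_3 \in int_range (16 * x).
  rewrite mem_int_range; last by lra.
  by have := ei 3%N isT; rewrite (_ : 2 ^+ 4 = 16 :> R) ?expr1; [lra | ring].
have hD : f`_0 \in int_range (H%:R : R).
  by rewrite mem_int_range //; apply: normr_coef_le_height.
rewrite mem_cat; have [A0|A0] := eqVneq (f`_3) 0.
  apply/orP; left; apply/mapP; exists (f`_2, f`_0).
    by apply/allpairsP; exists (f`_2, f`_0).
  rewrite {1}fE /F1 /= A0; congr (quartic _ _ _ _).
  have [r00|r00] := eqVneq r 0.
    have := ei 1%N isT; rewrite r00 expr0n mulr0 lerz0 normr_le0.
    by move=> /eqP.
  move/eqP: eC; rewrite A0 mulr0 mulf_eq0 expf_eq0 /= (negPf r00) orbF intr_eq0.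
  by move=> /eqP.
apply/orP; right.
have r00 : r != 0.
  apply: contra_neq A0 => r00; have := ei 3%N isT.
  by rewrite r00 expr0n mulr0 lerz0 normr_le0 => /eqP.
have C2 : f`_1 ^+ 2 = `|f`_0| * f`_3 ^+ 2.
  apply: (@intr_inj R); rewrite [RHS]rmorphM /= e0 !rmorphXn /=.
  apply: (mulIf (expf_neq0 2 (expf_neq0 2 r00))).
  have D2 : ((f`_0)%:~R : R) ^+ 2 = (r ^+ 4) ^+ 2.
    by rewrite -e0 intr_norm real_normK ?num_real.
  by rewrite -exprMn eC exprMn D2; ring.
have dvd : (f`_3 %| f`_1)%Z.
  have : (f`_3 ^+ 2 %| f`_1 ^+ 2)%Z by rewrite C2 dvdz_mull.
  by rewrite !dvdzE !abszX dvdn_pexp2r.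
have [s sE] := dvdzP dvd.
have s2 : `|f`_0| = s ^+ 2.
  by apply: (mulIf (expf_neq0 2 A0)); rewrite -C2 sE exprMn.
apply/mapP; exists ((f`_3, f`_2), (s, Num.sg f`_0)).
  apply/allpairsP; exists ((f`_3, f`_2), (s, Num.sg f`_0)); split => //.
    by apply/allpairsP; exists (f`_3, f`_2).
  apply/allpairsP; exists (s, Num.sg f`_0); split => //=.
    rewrite mem_int_range; last by lra.
    rewrite -(ler_pXn2r (n := 2)) ?nnegrE ?ler0z //; last by lra.
    have -> : (`|s|%:~R : R) ^+ 2 = r ^+ 4.
      by rewrite intr_norm real_normK ?num_real // -e0 s2 rmorphXn.
    by rewrite (exprM r 2 2).
  rewrite !inE; case: sgrP => //= f0.
  move: e0; rewrite f0 normr0 => /esym/eqP; rewrite expf_eq0 /= (negPf r00).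
  by [].
rewrite {1}fE /F2 /= -s2 sE; congr (quartic _ _ _ _).
  by rewrite mulrC.
by rewrite -numEsg.
Qed.

End QuarticsFour.

(** * Irreducible quartics with four roots of maximal modulus *)

Section QuarticsFourOrders.
Variable R : realType.

Lemma irreducible_poly_irreducibleZ (f : {poly int}) : f \is monic ->
  irreducible_poly f -> irreducibleZ f.
Proof.
move=> fm [sf irr]; apply: irreducibleZ_monic => // g h gm hm sg sh fE.
have gf : Pdiv.Idomain.dvdp g f by rewrite fE Pdiv.Idomain.dvdp_mulr.
have g1 : size g != 1%N by rewrite gtn_eqF.
have /Pdiv.Idomain.eqp_size e := irr g g1 gf.
have : size f = (size g + size h).-1 by rewrite fE size_Mmonic ?monic_neq0.
by rewrite -(e : size g = size f); move: sg sh; clear; lia.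
Qed.

Lemma biquadratic_irreducible u v : irreducibleZ (quartic 0 (2 * u) 0 (4 * v + 2)).
Proof.
have [fm sf] := quartic_monic_size 0 (2 * u) 0 (4 * v + 2).
apply: irreducible_poly_irreducibleZ => //.
apply: (@eisenstein_crit 2) => //; first by rewrite sf.
- by rewrite (monicP fm).
- rewrite coef_quartic /= !mulr0 !add0r; apply/negP => /dvdzP[q]; lia.
move=> i; rewrite sf coef_quartic; case: i => [|[|[|[|]]]] //= _.
- rewrite !mulr0 !add0r; apply/dvdzP; exists (2 * v + 1); ring.
- by rewrite !(mulr0, mul0r, addr0, add0r) dvdz0.
- by rewrite !(mulr0, mul0r, mulr1, addr0, add0r) dvdz_mulr.
- by rewrite !(mulr0, mul0r, mulr1, addr0, add0r) dvdz0.
Qed.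

Lemma biquadratic_maxmod (p q : int) : 0 <= q -> p ^+ 2 <= 4 * q ->
  nb_maxmod_roots (polyZC R (quartic 0 p 0 q)) = 4%N.
Proof.
move=> q0 pq; have [fm sf] := quartic_monic_size 0 p 0 q.
pose r : R := Num.sqrt (Num.sqrt q%:~R).
rewrite (@nb_maxmod_same _ _ r) ?polyZC_monic ?size_polyZC ?sf // => z.
rewrite rootE /polyZC /quartic !scale0r !addr0 !rmorphD /= map_polyZ /=.
rewrite !map_polyXn map_polyC /= !hornerD hornerZ !hornerXn hornerC => /eqP h.
have := @quadratic_root_modulus R p%:~R q%:~R (z ^+ 2).
rewrite -!rmorphXn /= -exprM !rmorph_int h => /(_ _ erefl) e.
have e4 : cmod z ^+ 4 = q%:~R.
  rewrite (exprM _ 2 2) -cmodX e // -[4]/(4%:~R) -rmorphM ler_int.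
  by [].
apply/eqP; rewrite -(eqrXn2 (n := 4)) ?cmod_ge0 ?sqrtr_ge0 // e4 (exprM _ 2 2).
by rewrite !sqr_sqrtr ?sqrtr_ge0 ?ler0z.
Qed.

(** For the lower bound, X^4 + 2 u X^2 + 4 v + 2 is Eisenstein at 2, and for u < m, m^2 <= v < 2 m^2
    it has negative discriminant as a quadratic in X^2. This makes m^3 polynomials with m of order
    sqrt H. *)
Lemma irreducible_four_maxmod :
  same_order_from 1 (nb_irreducible R 4 4) (fun H : R => H `^ (3 / 2)).
Proof.
have [c c0 [H1 Hm]] := @nat_root_lower R 2 10 isT isT.
apply: (@same_order_from_powR R 4 (irreducible_with R 4 4) _ (c ^+ 3) H1).
- lra.
- by rewrite exprn_gt0.
- exact: irreducible_with_sub.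
- by apply: growth_le_sub _ (lexx _) (four_maxmod_growth R) => H _ f [].
- move=> H HH; have [m [m0 mH cm]] := Hm H HH.
  apply: card_at_least_sub _ _ (@allpairs_card_at_least R _ _ _ (int_iota 0 m)
    (int_iota (m * m) (m * m)) (fun u v => quartic 0 (2 * u) 0 (4 * v + 2)) _ _ _ _ _);
    first by move=> f; exact.
  + rewrite !size_int_iota natrM (_ : _ `^ _ = (H%:R `^ 2%:R^-1) ^+ 3).
      rewrite -exprMn [leRHS](_ : _ = m%:R ^+ 3); last by ring.
      by rewrite lerXn2r ?nnegrE ?mulr_ge0 ?powR_ge0 // ltW.
    by rewrite -powR_mulrn ?powR_ge0 // -powRrM; congr (_ `^ _); lra.
  + exact: int_iota_uniq.
  + exact: int_iota_uniq.
  + move=> u v u' v' _ _ _ _ e; have := congr1 (coefp 0) e; have := congr1 (coefp 2) e.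
    rewrite /= !coef_quartic /= !(mulr0, mul0r, mulr1, addr0, add0r) => e2 e0.
    by split; lia.
  + move=> u v; rewrite !mem_int_iota => hu hv.
    have [fm sf] := quartic_monic_size 0 (2 * u) 0 (4 * v + 2).
    have mH' : (10 * (m * m) <= H)%N by move: mH; rewrite expnS expn1.
    split; [split => //|exact: biquadratic_irreducible|].
    * by apply: quartic_height => //; nia.
    * by apply: biquadratic_maxmod; rewrite ?expr2; nia.
(* X^4 + 1 has no real root, and a product of two quadratics would give an integer a with a^2 = 2 or
   a^2 = -2. *)
- move=> H H0; exists (quartic 0 0 0 1); have [fm sf] := quartic_monic_size 0 0 0 1.
  split.
  + by split => //; apply: quartic_height.
  + apply: irreducibleZ_monic => //; first by rewrite sf.
    move=> g h gm hm sg sh fE.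
    have red : reducibleZ (quartic 0 0 0 1) by rewrite fE; apply: reducibleZ_mul.
    have [g' [h' [m [e [[gm' hm' fE'] sg' sh' me mE]]]]] := reducibleZ_factor fm sf red.
    have : (m = 1 /\ e = 3)%N \/ (m = 2 /\ e = 2)%N by lia.
    case=> -[m1 e1]; rewrite m1 e1 in sg' sh'.
      have gE := monic2E gm' sg'; set b := g'`_0 in gE.
      have h0 : (quartic 0 0 0 1).[- b] = 0.
        by rewrite fE' hornerM gE hornerD hornerX hornerC addNr mul0r.
      rewrite /quartic !hornerD !hornerZ !hornerXn hornerX hornerC !mul0r !addr0 in h0.
      have := sqr_ge0 ((- b) ^+ 2); rewrite -exprM -(lerD2r 1) h0 add0r.
      by [].
    have gE := monic3E gm' sg'; have hE := monic3E hm' sh'.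
    set a := g'`_1 in gE; set s := g'`_0 in gE; set b := h'`_1 in hE; set t := h'`_0 in hE.
    move: fE'; rewrite gE hE -!/(quadratic _ _) mul_quadratic => fE'.
    have := congr1 (coefp 0) fE'; have := congr1 (coefp 1) fE'.
    have := congr1 (coefp 2) fE'; have := congr1 (coefp 3) fE'.
    rewrite /= !coef_quartic /= !(mulr0, mul0r, mulr1, addr0, add0r) => q3 q2 q1 q0.
    have bE : b = - a by lia.
    have sE : s = 1 /\ t = 1 \/ s = -1 /\ t = -1.
      have : s \is a GRing.unit by apply/unitrP; exists t; rewrite mulrC -q0.
      by rewrite unfold_in => /orP[] /eqP se; rewrite se in q0 *; [left|right]; split => //; lia.
    rewrite bE in q2.
    have a2 : a * a = 2 \/ a * a = -2 by case: sE => -[s1 t1]; rewrite s1 t1 in q2; [left|right]; lia.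
    have : (absz a <= 1)%N by nia.
    move=> a1; have a3 : a = 0 \/ a = 1 \/ a = -1 by lia.
    by case: a3 a2 => [->|[->|->]] [].
  + by apply: biquadratic_maxmod.
Qed.

End QuarticsFourOrders.

(** * Reducible quartics with four roots of maximal modulus *)

Section ReducibleFour.
Variable R : realType.

Lemma product_quadratics_maxmod (a b s : int) : a ^+ 2 <= 4 * s -> b ^+ 2 <= 4 * s ->
  nb_maxmod_roots (polyZC R (quadratic a s * quadratic b s)) = 4%N.
Proof.
move=> ha hb; have fm : quadratic a s * quadratic b s \is monic.
  by rewrite monicMl ?quadratic_monic.
have sf := size_monic_mul (quadratic_monic a s) (quadratic_monic b s)
  (size_quadratic a s) (size_quadratic b s).
pose r : R := Num.sqrt s%:~R.
have s0 : 0 <= s by have := sqr_ge0 a; lia.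
have main (c : int) z : c ^+ 2 <= 4 * s -> root (polyZC R (quadratic c s)) z -> cmod z = r.
  move=> hc /root_quadratic rz.
  have := @quadratic_root_modulus R c%:~R s%:~R z _ rz => h.
  apply/eqP; rewrite -(eqrXn2 (n := 2)) ?cmod_ge0 ?sqrtr_ge0 // h.
    by rewrite sqr_sqrtr ?ler0z.
  by rewrite -rmorphXn -[4]/(4%:~R) -rmorphM ler_int.
rewrite (@nb_maxmod_same _ _ r) ?polyZC_monic ?size_polyZC ?sf // => z.
by rewrite polyZC_mul rootM => /orP[]; apply: main.
Qed.

Lemma int_sg_norm (w : int) (k : int) : `|w| = k -> w = Num.sg w * k.
Proof. by move=> <-; rewrite -numEsg. Qed.

Lemma mem_sg (w : int) : Num.sg w \in [:: 0; 1; -1 : int].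
Proof. by rewrite !inE; case: sgrP. Qed.

(** The common modulus r is at most x = H^(1/4), and each factor has constant coefficient of
    absolute value a power of r, so one constant coefficient determines the other up to sign. The
    free coefficients have sizes x, x, x^2 for both splittings of the degree, which makes O(x^4). *)
Lemma reducible_four_growth : growth_le (reducible_with R 4 4) (1 : R).
Proof.
exists (3 * 24 * (24 * 3) + 12 * 12 * (3 * 3)); first by rewrite addr_gt0 ?mulr_gt0 ?ltr0n.
move=> H H0; have H1 : 1 <= H%:R :> R by rewrite ler1n.
pose x : R := H%:R `^ 4%:R^-1; have x1 : 1 <= x by rewrite powR_nat_ge1.
have x4 : x ^+ 4 = H%:R by rewrite /x -powR_mulrn ?powR_ge0 // -powRrM mulVf // powRr1.
have x2 : 1 <= x ^+ 2 by rewrite exprn_ege1.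
have e8 : 2 ^+ 3 = 8 :> R by rewrite !exprS expr0; lra.
have e4 : 2 ^+ 2 = 4 :> R by rewrite !exprS expr0; lra.
pose F1 (p : (int * int) * (int * int)) : {poly int} := ('X + (p.1.1)%:P) *
  ('X^3 + p.1.2 *: 'X^2 + p.2.1 *: 'X + (p.2.2 * `|p.1.1| ^+ 3)%:P).
pose F2 (p : (int * int) * (int * int)) :=
  quadratic p.1.1 p.2.1 * quadratic p.1.2 (p.2.2 * `|p.2.1|).
pose l1 := [seq (p, q) | p <- [seq (b, u) | b <- int_range x, u <- int_range (8 * x)],
  q <- [seq (v, e) | v <- int_range (8 * x ^+ 2), e <- [:: 0; 1; -1 : int]]].
pose l2 := [seq (p, q) | p <- [seq (a, b) | a <- int_range (4 * x), b <- int_range (4 * x)],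
  q <- [seq (s, e) | s <- int_range (x ^+ 2), e <- [:: 0; 1; -1 : int]]].
have s3 : (size [:: 0; 1; -1 : int])%:R <= 3 :> R by [].
have sx : (size (int_range x))%:R <= 3 * x by apply: size_int_range_le3.
have sx2 : (size (int_range (x ^+ 2)))%:R <= 3 * x ^+ 2 by apply: size_int_range_le3.
have s4 : (size (int_range (4 * x)))%:R <= 3 * (4 * x) by apply: size_int_range_le3; lra.
have s8 : (size (int_range (8 * x)))%:R <= 3 * (8 * x) by apply: size_int_range_le3; lra.
have s82 : (size (int_range (8 * x ^+ 2)))%:R <= 3 * (8 * x ^+ 2).
  by apply: size_int_range_le3; lra.
exists (map F1 l1 ++ map F2 l2); split; last first.
  rewrite powRr1 // -x4 size_cat !size_map natrD mulrDl.
  have x40 : 0 <= x ^+ 4 by rewrite exprn_ge0 //; lra.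
  apply: lerD.
    apply: le_trans (size_allpairs_pair (size_allpairs_pair sx s8) (size_allpairs_pair s82 s3)) _.
    rewrite [leLHS](_ : _ = (3 * 24 * (24 * 3)) * x ^+ 4); last by ring.
    by rewrite ler_wpM2r //; lra.
  apply: le_trans (size_allpairs_pair (size_allpairs_pair s4 s4) (size_allpairs_pair sx2 s3)) _.
  rewrite [leLHS](_ : _ = (12 * 12 * (3 * 3)) * x ^+ 4); last by ring.
  by rewrite ler_wpM2r //; lra.
move=> f [[fm sf fH] red nb]; pose r := maxmod (polyZC R f).
have fr z : root (polyZC R f) z -> cmod z = r by apply: (nb_full_root fm sf nb).
have [r0 e0 _] := same_modulus_coef fm sf fr.
have rx : r <= x.
  rewrite -(ler_pXn2r (n := 4)) ?nnegrE ?powR_ge0 // x4 -e0.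
  exact: normr_coef_le_height.
have rx2 : r ^+ 2 <= x ^+ 2 by rewrite lerXn2r ?nnegrE //; lra.
have [g [h [m [e [[gm hm fE] sg sh me mE]]]]] := reducibleZ_factor fm sf red.
have gr z : root (polyZC R g) z -> cmod z = r.
  by move=> rz; apply: fr; rewrite fE polyZC_mul rootM rz.
have hr z : root (polyZC R h) z -> cmod z = r.
  by move=> rz; apply: fr; rewrite fE polyZC_mul rootM rz orbT.
have : (m = 1 /\ e = 3)%N \/ (m = 2 /\ e = 2)%N by move: me mE; clear; lia.
rewrite mem_cat; case=> -[m1 e1]; rewrite m1 e1 in sg sh; apply/orP; [left|right].
  have [_ g0 _] := same_modulus_coef gm sg gr.
  have [_ h0 hi] := same_modulus_coef hm sh hr.
  have w3 : `|h`_0| = `|g`_0| ^+ 3.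
    by apply: (@intr_inj R); rewrite h0 rmorphXn /= g0 expr1.
  apply/mapP; exists ((g`_0, h`_2), (h`_1, Num.sg h`_0)).
    apply/allpairsP; exists ((g`_0, h`_2), (h`_1, Num.sg h`_0)); split => //.
      apply/allpairsP; exists (g`_0, h`_2); split => //=.
        by rewrite mem_int_range ?g0 ?expr1 //; lra.
      rewrite mem_int_range; last by lra.
      by have := hi 2%N isT; rewrite e8 ?expr1; lra.
    apply/allpairsP; exists (h`_1, Num.sg h`_0); split => //=; last exact: mem_sg.
    rewrite mem_int_range; last by lra.
    by have := hi 1%N isT; rewrite e8; lra.
  rewrite /F1 /= -(int_sg_norm w3) -monic4E // -monic2E //.
have [_ g0 gi] := same_modulus_coef gm sg gr.
have [_ h0 hi] := same_modulus_coef hm sh hr.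
have st : `|h`_0| = `|g`_0| by apply: (@intr_inj R); rewrite h0 g0.
apply/mapP; exists ((g`_1, h`_1), (g`_0, Num.sg h`_0)).
  apply/allpairsP; exists ((g`_1, h`_1), (g`_0, Num.sg h`_0)); split => //.
    apply/allpairsP; exists (g`_1, h`_1); split => //=.
      rewrite mem_int_range; last by lra.
      by have := gi 1%N isT; rewrite e4 ?expr1; lra.
    rewrite mem_int_range; last by lra.
    by have := hi 1%N isT; rewrite e4 ?expr1; lra.
  apply/allpairsP; exists (g`_0, Num.sg h`_0); split => //=; last exact: mem_sg.
  by rewrite mem_int_range ?g0 //; lra.
by rewrite /F2 /= -(int_sg_norm st) /quadratic -!monic3E.
Qed.

Lemma sum_prod_unique (a b a' b' m : int) : a < m -> m <= b -> a' < m -> m <= b' ->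
  a + b = a' + b' -> a * b = a' * b' -> a = a' /\ b = b'.
Proof.
move=> am mb am' mb' eS eP.
have : (a - a') * (a - b') = 0.
  rewrite (_ : _ * _ = a * (a + b) - a * b - a * (a' + b') + a' * b'); last by ring.
  by rewrite eS eP; ring.
by move/eqP; rewrite mulf_eq0 !subr_eq0 => /orP[/eqP e|/eqP e]; split; lia.
Qed.

(** For the lower bound, (X^2 + a X + s)(X^2 + b X + s) with 0 <= a < m <= b < 2 m and m^2 <= s < 2
    m^2 makes m^4 polynomials with m of order H^(1/4). The disjoint ranges of a and b allow them to
    be recovered from their sum and product. *)
Lemma reducible_four_maxmod :
  same_order_from 1 (nb_reducible R 4 4) (fun H : R => H).
Proof.
apply: (@same_order_from_ext R 1 _ (fun x : R => x `^ 1)).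
  by move=> H _; rewrite powRr1.
have [c c0 [H1 Hm]] := @nat_root_lower R 4 6 isT isT.
apply: (@same_order_from_powR R 4 (reducible_with R 4 4) _ (c ^+ 4) H1) => //.
- by rewrite exprn_gt0.
- exact: reducible_with_sub.
- exact: reducible_four_growth.
- move=> H HH; have [m [m0 mH cm]] := Hm H HH.
  pose s1 := [seq (a, b) | a <- int_iota 0 m, b <- int_iota m m].
  have mem1 (p : int * int) : p \in s1 -> 0 <= p.1 < m%:Z /\ m%:Z <= p.2 < (m + m)%:Z.
    by move=> /allpairsP[[a b] /= []]; rewrite !mem_int_iota => ha hb ->.
  apply: card_at_least_sub _ _ (@allpairs_card_at_least R _ _ _ s1 (int_iota (m * m) (m * m))
    (fun p s => quadratic p.1 s * quadratic p.2 s) _ _ _ _ _);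
    first by move=> f; exact.
  + rewrite /s1 size_allpairs !size_int_iota !natrM (_ : _ `^ _ = (H%:R `^ 4%:R^-1) ^+ 4).
      rewrite -exprMn [leRHS](_ : _ = m%:R ^+ 4); last by ring.
      by rewrite lerXn2r ?nnegrE ?mulr_ge0 ?powR_ge0 // ltW.
    by rewrite -powR_mulrn ?powR_ge0 // -powRrM; congr (_ `^ _); lra.
  + by apply: allpairs_uniq; rewrite ?int_iota_uniq // => -[a b] [a' b'] _ _ /= [-> ->].
  + exact: int_iota_uniq.
  + move=> [a b] s [a' b'] s' /mem1 /= [ha hb]; rewrite mem_int_iota => hs.
    move=> /mem1 /= [ha' hb']; rewrite mem_int_iota => hs'; rewrite !mul_quadratic => e.
    have := congr1 (coefp 0) e; have := congr1 (coefp 2) e; have := congr1 (coefp 3) e.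
    rewrite /= !coef_quartic /= !(mulr0, mul0r, mulr1, addr0, add0r) => e3 e2 e0.
    have ss : s = s' by nia.
    have eP : a * b = a' * b' by move: e2; rewrite ss; lia.
    have [-> ->] : a = a' /\ b = b'.
      by apply: (@sum_prod_unique a b a' b' m%:Z _ _ _ _ e3 eP); lia.
    by [].
  + move=> [a b] s /mem1 /= [ha hb]; rewrite mem_int_iota => hs.
    have mH' : (6 * (m * m * (m * m)) <= H)%N.
      by move: mH; rewrite !expnS expn0 muln1 !mulnA.
    split.
    * rewrite mul_quadratic.
      have [fm sf] := quartic_monic_size (a + b) (s + s + a * b) (a * s + b * s) (s * s).
      have m2 : (m <= m * m)%N by rewrite leq_pmulr.
      have m4 : (m * m <= m * m * (m * m))%N by rewrite leq_pmulr // muln_gt0 m0.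
      have sb : (absz s <= 2 * (m * m))%N by lia.
      have ab : (absz a <= m)%N by lia.
      have bb : (absz b <= 2 * m)%N by lia.
      have abb : (absz (a * b)%R <= 2 * (m * m))%N.
        by rewrite abszM mulnCA leq_mul.
      have ssb : (absz (s * s)%R <= 4 * (m * m * (m * m)))%N.
        by rewrite abszM (leq_trans (leq_mul sb sb)) // mulnACA.
      have asb : (absz ((a + b) * s)%R <= 6 * (m * m * (m * m)))%N.
        have hab : (absz (a + b)%R <= 3 * (m * m))%N by lia.
        by rewrite abszM (leq_trans (leq_mul hab sb)) // mulnACA.
      split => //; apply: quartic_height; first by lia.
      - lia.
      - lia.
      - by rewrite -mulrDl; lia.
      - lia.
    * by apply: reducibleZ_mul; rewrite ?quadratic_monic ?size_quadratic.
    * by apply: product_quadratics_maxmod; rewrite !expr2; nia.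
- move=> H H0; exists (quadratic 0 0 * quadratic 0 0); split.
  + rewrite mul_quadratic; have [fm sf] := quartic_monic_size (0 + 0) (0 + 0 + 0 * 0) (0 * 0 + 0 * 0) (0 * 0).
    by split => //; apply: quartic_height.
  + by apply: reducibleZ_mul; rewrite ?quadratic_monic ?size_quadratic.
  + by apply: product_quadratics_maxmod.
Qed.

End ReducibleFour.

(** * Quartic polynomials with three roots of maximal modulus *)

Section QuarticThree.
Variable R : realType.

Lemma real_of_conj (z : R[i]) : (z^*)%C = z -> exists x : R, z = x%:C%C.
Proof.
case: z => x y [] h; exists x; have y0 : y = 0 by lra.
by rewrite y0.
Qed.

(* [be] is the root of smaller modulus; the cubic with the three other roots is
   X^3 + u X^2 - al u X - al^3, so [al] is one of them. *)
Definition quartic_three_data (f : {poly int}) (r al be u : R) :=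
  [/\ `|be| < r, al ^+ 2 = r ^+ 2, `|u| <= 3 * r,
      [/\ (f`_3)%:~R = u - be, (f`_2)%:~R = - (al * u) - be * u,
          (f`_1)%:~R = - al ^+ 3 + al * be * u & (f`_0)%:~R = al ^+ 3 * be] &
      forall z, root (polyZC R f) z -> z = be%:C%C \/ cmod z = r].

(** The fourth root d is real, since its conjugate has smaller modulus as well; hence the elementary
    symmetric functions of the other three are real, and conjugation relates them as for cubics. *)
Lemma three_maxmod_quartic (f : {poly int}) : f \is monic -> size f = 5%N ->
    nb_maxmod_roots (polyZC R f) = 3%N ->
  exists r al be u : R, quartic_three_data f r al be u /\
    exists s, perm_eq (be%:C%C :: s) (croots (polyZC R f)) /\
      {in s, forall z, cmod z = r}.
Proof.
move=> fm sf nb; have fm' := polyZC_monic R fm.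
have [s [t [pst sr tr ns]]] := maxmod_split (polyZC R f).
set r := maxmod (polyZC R f) in sr tr; rewrite nb in ns.
have nt : size t = 1%N.
  have := perm_size pst; rewrite size_cat size_croots // size_polyZC sf ns /= => h.
  by apply: (@addnI 3).
have [d tE] : exists d, t = [:: d] by case: t nt {pst tr} => [|d []] //; exists d.
rewrite tE in pst tr.
have [a [b [c sE]]] := seq3E ns.
have dr : cmod d < r by apply: tr; rewrite mem_head.
have rd : root (polyZC R f) d.
  by rewrite -mem_croots // -(perm_mem pst) mem_cat mem_head orbT.
have dJ : (d^*)%C = d.
  have : (d^*)%C \in s ++ [:: d].
    by rewrite (perm_mem pst) mem_croots //; apply: root_polyZC_conj.
  rewrite mem_cat inE => /orP[/sr h|/eqP //].
  by rewrite cmodJ in h; rewrite h ltxx in dr.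
have [be dE] := real_of_conj dJ.
have fE : polyZC R f = prod_roots [:: a; b; c; d].
  by rewrite {1}(croots_monic fm') -(prod_roots_perm pst) sE.
have ma : cmod a = r by apply: sr; rewrite sE !inE eqxx.
have mb : cmod b = r by apply: sr; rewrite sE !inE eqxx orbT.
have mc : cmod c = r by apply: sr; rewrite sE !inE eqxx !orbT.
have r0 : 0 < r by apply: le_lt_trans dr; apply: cmod_ge0.
have [e3 e2 e1 e0] := coef_prod_roots4 a b c d.
rewrite -fE !coef_polyZC in e3 e2 e1 e0.
have ca := conj_prod ma; have cb := conj_prod mb; have cc := conj_prod mc.
have [u uD] : exists u : R, u = (f`_3)%:~R + be by eexists.
have uE : a + b + c = - u%:C%C.
  by rewrite uD rmorphD /= rmorph_int e3 dE; ring.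
have [v vD] : exists v : R, v = (f`_2)%:~R + be * u by eexists.
have vE : a * b + a * c + b * c = v%:C%C.
  by rewrite vD rmorphD rmorphM /= rmorph_int e2 uE dE; ring.
have [w wD] : exists w : R, w = - ((f`_1)%:~R + be * v) by eexists.
have wE : a * b * c = w%:C%C.
  by rewrite wD rmorphN rmorphD rmorphM /= rmorph_int e1 vE dE; ring.
have w2 : w ^+ 2 = r ^+ 6.
  rewrite -(real_normK (num_real w)) -cmod_real -wE !cmodM ma mb mc; ring.
have vr : v * r ^+ 2 = - (w * u).
  apply: complexI; rewrite rmorphN !rmorphM /= -vE -wE.
  have -> : u%:C%C = - ((a^*)%C + (b^*)%C + (c^*)%C).
    have := congr1 (@conjc R) uE; rewrite !rmorphD rmorphN /= oppr0 => ->.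
    by rewrite opprK.
  set x := (a^*)%C in ca *; set y := (b^*)%C in cb *; set z := (c^*)%C in cc *.
  rewrite [RHS](_ : _ = b * c * (a * x) + a * c * (b * y) + a * b * (c * z)); last by ring.
  by rewrite ca cb cc; ring.
have rn : r != 0 by rewrite gt_eqF.
(* The product w of the three roots is real with |w| = r^3, so w / r^2 is its real cube root, equal
   to r or -r. *)
pose al := w / r ^+ 2.
have al2 : al ^+ 2 = r ^+ 2.
  rewrite /al expr_div_n w2 -exprM -expfB //.
have alw : w = al ^+ 3.
  by rewrite exprS al2 /al divfK // expf_neq0.
have alv : v = - (al * u).
  by apply: (mulIf (expf_neq0 2 rn)); rewrite vr /al; field.
exists r, al, be, u; split; last first.
  exists s; split => //; rewrite -dE; apply: perm_trans pst.
  by rewrite -cat1s perm_catC.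
split => //.
- by rewrite -cmod_real -dE.
- rewrite -cmod_real -cmodN -uE (le_trans (ler_cmodD _ _)) // mc.
  by have := ler_cmodD a b; rewrite ma mb; lra.
- split.
  + by rewrite uD; ring.
  + by rewrite -alv vD; ring.
  + have -> : al * be * u = - (be * v) by rewrite alv; ring.
    by rewrite -alw wD; ring.
  + apply: complexI; rewrite rmorphM /= rmorph_int e0 -alw -wE dE; ring.
- move=> z; rewrite -mem_croots // -(perm_mem pst) mem_cat inE => /orP[/sr|/eqP ->].
    by right.
  by left.
Qed.

Definition polyZR (f : {poly int}) : {poly R} := map_poly (intr : int -> R) f.

Lemma root_polyZR (f : {poly int}) (x : R) : root (polyZC R f) x%:C%C = root (polyZR f) x.
Proof.
have -> : polyZC R f = map_poly (real_complex R) (polyZR f).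
  rewrite /polyZC /polyZR -map_poly_comp; apply: eq_map_poly => c /=.
  by rewrite rmorph_int.
exact: fmorph_root.
Qed.

Lemma polyZR_rat (f : {poly int}) :
  polyZR f = map_poly (ratr : rat -> R) (map_poly (intr : int -> rat) f).
Proof. by rewrite -map_poly_comp; apply: eq_map_poly => c /=; rewrite ratr_int. Qed.

(** Gauss's lemma: a rational divisor of f is a scalar multiple of an integral one. *)
Lemma irreducibleZ_rat (f : {poly int}) : f \is monic -> (1 < size f)%N ->
  irreducibleZ f -> irreducible_poly (map_poly (intr : int -> rat) f).
Proof.
move=> fm sf [_ _ irr]; split; first by rewrite size_rat_int_poly.
move=> q q1 dq; have [p [a a0 qE] [s fE]] := dvdpP_rat_int dq.
have sq : size q = size p by rewrite qE size_scale // size_rat_int_poly.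
case: (irr p s fE); rewrite poly_unitE => /andP[/eqP h _].
  by rewrite sq h in q1.
rewrite -dvdp_size_eqp // sq size_rat_int_poly fE.
have [c cE] : exists c, s = c%:P by exists s`_0; apply: size1_polyC; rewrite h.
have c0 : c != 0 by apply: contra_eq_neq h => c0; rewrite cE c0 size_poly0.
by rewrite cE mulrC mul_polyC size_scale.
Qed.

(** The substitute for Galois conjugation: a common root makes the gcd over the rationals
    nonconstant, so the irreducible f divides g and every root of f satisfies the same relation. *)
Lemma irreducible_shared_root (f g : {poly int}) (x y : R) : f \is monic ->
    (1 < size f)%N -> irreducibleZ f -> root (polyZR f) x -> root (polyZR g) x ->
  root (polyZR f) y -> root (polyZR g) y.
Proof.
move=> fm sf irr; rewrite !polyZR_rat.
have [_ irrQ] := irreducibleZ_rat fm sf irr.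
set F := map_poly _ f in irrQ *; set G := map_poly _ g => fx gx fy.
have dF : gcdp F G %| F by apply: dvdp_gcdl.
have [d1|d1] := eqVneq (size (gcdp F G)) 1%N.
  have co : coprimep (map_poly (ratr : rat -> R) F) (map_poly ratr G).
    by rewrite coprimep_map /coprimep d1.
  by have := coprimep_root co fx; rewrite -rootE gx.
have /eqp_dvdl e := irrQ _ d1 dF.
have FG : F %| G by rewrite -e dvdp_gcdr.
by apply: root_dvdp fy; rewrite dvdp_map.
Qed.

Lemma root_quarticE (f : {poly int}) (x : R) : f \is monic -> size f = 5%N ->
  (polyZR f).[x] = x ^+ 4 + (f`_3)%:~R * x ^+ 3 + (f`_2)%:~R * x ^+ 2 +
    (f`_1)%:~R * x + (f`_0)%:~R.
Proof.
move=> fm sf; rewrite {1}(monic5E fm sf) /polyZR /quartic !rmorphD /= !map_polyZ /=.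
by rewrite !map_polyXn map_polyX map_polyC /= !hornerD !hornerZ !hornerXn hornerX hornerC.
Qed.

Lemma quartic_three_root_al f r al be u : f \is monic -> size f = 5%N ->
  quartic_three_data f r al be u -> root (polyZR f) al /\ root (polyZR f) be.
Proof.
move=> fm sf [_ _ _ [eA eB eC eD] _]; rewrite !rootE !root_quarticE // eA eB eC eD.
by split; apply/eqP; ring.
Qed.

(* If x is a root whose square is, up to order, the product of two other roots,
   then the remaining root is - q3 / x^2, where the q_i are the coefficients of
   f / (X - x); eliminating it gives this polynomial relation on x. *)
Definition product_resolvent (f : {poly int}) : {poly int} :=
  let q1 := (f`_3)%:P + 'X in let q2 := (f`_2)%:P + 'X * q1 in
  let q3 := (f`_1)%:P + 'X * q2 in
  (q2 - 'X^2) * 'X^4 - (q1 * 'X^2 - q3) * q3.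

Lemma no_irreducible_three_maxmod (f : {poly int}) : f \is monic -> size f = 5%N ->
  irreducibleZ f -> nb_maxmod_roots (polyZC R f) <> 3%N.
Proof.
move=> fm sf irr nb.
have [r [al [be [u [D _]]]]] := three_maxmod_quartic fm sf nb.
have [ra rb] := quartic_three_root_al fm sf D.
case: D => ber al2 ur [eA eB eC eD] _.
have hE (x : R) : (polyZR (product_resolvent f)).[x] =
    let q1 := (f`_3)%:~R + x in let q2 := (f`_2)%:~R + x * q1 in
    let q3 := (f`_1)%:~R + x * q2 in
    (q2 - x ^+ 2) * x ^+ 4 - (q1 * x ^+ 2 - q3) * q3.
  rewrite /polyZR /product_resolvent /= !(rmorphD, rmorphN, rmorphM) /= !map_polyX !map_polyC /=.
  rewrite !(hornerD, hornerN, hornerM, hornerX, hornerC) /=; ring.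
have Pa : root (polyZR (product_resolvent f)) al.
  by rewrite rootE hE /= eA eB eC; apply/eqP; ring.
have sf1 : (1 < size f)%N by rewrite sf.
have := irreducible_shared_root fm sf1 irr ra Pa rb.
rewrite rootE hE /= eA eB eC => /eqP h.
(* The value of the resolvent at [be]. With x = al^2 > y = be^2 and al u >= -3 x, the second factor
   is at least (x - y)^2 > 0. *)
have {h} : (al ^+ 2 - be ^+ 2) * (al ^+ 4 + al ^+ 2 * be ^+ 2 + be ^+ 4 + al * u * be ^+ 2) = 0.
  by rewrite -h; ring.
have r0 : 0 < r by apply: le_lt_trans ber.
have bea : be ^+ 2 < al ^+ 2.
  by rewrite al2 -(real_normK (num_real be)) ltrXn2r ?nnegrE // ltW.
have alr : `|al| = r.
  apply/eqP; rewrite -(eqrXn2 (n := 2)) ?normr_ge0 ?(ltW r0) //.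
  by rewrite real_normK ?num_real // al2.
have alu : - (3 * al ^+ 2) <= al * u.
  have : `|al * u| <= 3 * al ^+ 2.
    by rewrite normrM alr al2 expr2; have := ler_wpM2l (ltW r0) ur; lra.
  by rewrite ler_norml => /andP[].
move/eqP; rewrite mulf_eq0 subr_eq0 (gt_eqF bea) /= => /eqP h.
have b0 : 0 <= be ^+ 2 by apply: sqr_ge0.
have e4 : al ^+ 4 = al ^+ 2 * al ^+ 2 by rewrite -exprD.
have e4' : be ^+ 4 = be ^+ 2 * be ^+ 2 by rewrite -exprD.
rewrite e4 e4' in h; move: (al ^+ 2) (be ^+ 2) (al * u) h bea alu b0 => x y z h h1 h2 h3.
have : 0 <= (z + 3 * x) * y by rewrite mulr_ge0 //; lra.
have : 0 < (x - y) * (x - y) by rewrite mulr_gt0 // subr_gt0.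
by lra.
Qed.

Lemma irreducible_quartic_three H : nb_irreducible R 4 3 H = 0%N.
Proof.
apply/eqP; rewrite -leqn0 -(ler_nat R); apply: card_at_most_fset_set.
exists [::]; split => // f [[fm sf _] irr nb].
by have := no_irreducible_three_maxmod fm sf irr nb.
Qed.

End QuarticThree.

(** * Factorisation of reducible quartics with three roots of maximal modulus *)

Section ReducibleThree.
Variable R : realType.

(** By Gauss's lemma a multiple of X - p/q with integer coefficients divides f over the integers,
    and its leading coefficient divides 1. *)
Lemma rational_root_int (f : {poly int}) (x : R) (p q : int) : f \is monic ->
    root (polyZR R f) x -> q != 0 -> q%:~R * x = p%:~R ->
  exists b : int, x = b%:~R.
Proof.
move=> fm rx q0 qx; pose y : rat := p%:~R / q%:~R.
have xy : x = ratr y.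
  rewrite /y fmorph_div /= !ratr_int -qx mulrC mulKf // intr_eq0.
  exact: q0.
have ry : root (map_poly (intr : int -> rat) f) y.
  by move: rx; rewrite polyZR_rat xy fmorph_root.
have : 'X - y%:P %| map_poly (intr : int -> rat) f by rewrite dvdp_XsubCl.
case/dvdpP_rat_int=> g [a a0 gE] [h fE].
have sg : size g = 2%N.
  by rewrite -(size_rat_int_poly g) -(size_scale _ a0) -gE size_XsubC.
have lg : lead_coef g = 1 \/ lead_coef g = -1.
  have : lead_coef g \is a GRing.unit.
    apply/unitrP; exists (lead_coef h); rewrite mulrC -lead_coefM -fE.
    by split; apply/monicP.
  by rewrite unfold_in => /orP[] /eqP ->; [left|right].
have gy : (map_poly (intr : int -> rat) g).[y] = 0.
  have := congr1 (fun s => s.[y]) gE; rewrite hornerXsubC subrr hornerZ => /esym/eqP.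
  by rewrite mulf_eq0 (negPf a0) => /eqP.
have gX : map_poly (intr : int -> rat) g = (lead_coef g)%:~R *: 'X + ((g`_0)%:~R)%:P.
  apply/polyP => i; rewrite coef_map coefD coefZ coefX coefC /= lead_coefE sg /=.
  case: i => [|[|i]] /=; rewrite ?mulr0 ?mulr1 ?add0r ?addr0 //.
  by rewrite nth_default // sg.
move: gy; rewrite gX hornerD hornerZ hornerX hornerC => gy.
have [b yb] : exists b : int, y = b%:~R.
  case: lg => lg; rewrite lg in gy; [exists (- g`_0)|exists g`_0].
    by rewrite rmorphN /=; apply/eqP; rewrite -addr_eq0 -gy mul1r.
  by apply/eqP; rewrite -subr_eq0 -oppr_eq0 opprB addrC -mulN1r -gy.
by exists b; rewrite xy yb ratr_int.
Qed.

(** The other root al' = -a - be of g = X^2 + a X + s is real. If al' = be, then be = -a / 2; if s =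
    0, then be = 0. Otherwise |al'| = r and comparing constant coefficients gives |h_0| = r^2 = (a +
    be)^2, so a be = |h_0| + s - a^2, with a nonzero because |be| < r. Thus be is rational. *)
Lemma quadratic_factor_int_root (f g h : {poly int}) (r al be u : R) :
    f \is monic -> size f = 5%N -> quartic_three_data f r al be u ->
    g \is monic -> h \is monic -> size g = 3%N -> f = g * h -> size h = 3%N ->
    root (polyZR R g) be ->
  exists b : int, be = b%:~R.
Proof.
move=> fm sf D gm hm sg fE sh rg; have [_ rb] := quartic_three_root_al fm sf D.
have [ber al2 ur [eA eB eC eD] fr] := D.
have gE := monic3E gm sg; set a := g`_1 in gE; set s := g`_0 in gE.
have f0 : f`_0 = s * h`_0 by rewrite fE coef0M.
have r0 : 0 < r by apply: le_lt_trans ber.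
have evalg (x : R) : (polyZR R g).[x] = x ^+ 2 + a%:~R * x + s%:~R.
  rewrite gE /polyZR !rmorphD /= map_polyZ /= map_polyXn map_polyX map_polyC /=.
  by rewrite !hornerD hornerZ hornerXn hornerX hornerC.
have be2 : be ^+ 2 + a%:~R * be + s%:~R = 0 by rewrite -evalg; apply/eqP.
pose al' := - a%:~R - be.
have rg' : root (polyZR R g) al'.
  by rewrite rootE evalg /al' -be2; apply/eqP; ring.
have rf' : root (polyZC R f) al'%:C%C.
  by rewrite root_polyZR fE /polyZR rmorphM rootM [root _ _]rg'.
have [|alr] := fr _ rf'.
  move=> /complexI e; apply: (@rational_root_int f be (- a) 2 fm rb) => //.
  by rewrite rmorphN /=; rewrite /al' in e; lra.
rewrite cmod_real in alr.
have al'2 : al' ^+ 2 = r ^+ 2 by rewrite -(real_normK (num_real al')) alr.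
have [s0|s0] := eqVneq s 0.
  have : be * al' = 0 by rewrite /al' mulrBr -expr2; rewrite s0 in be2; lra.
  move/eqP; rewrite mulf_eq0 => /orP[/eqP ->|/eqP e]; first by exists 0.
  by move: alr r0; rewrite e normr0 => <-; rewrite ltxx.
have sE : s%:~R = be * al' :> R by rewrite /al' mulrBr -expr2; lra.
have t2 : `|h`_0|%:~R = r ^+ 2 :> R.
  have s0r : `|s%:~R : R| != 0 by rewrite normr_eq0 intr_eq0.
  have st : s%:~R * (h`_0)%:~R = al ^+ 3 * be :> R by rewrite -eD f0 rmorphM.
  apply: (mulfI s0r); rewrite intr_norm -normrM st sE !normrM alr.
  have alnr : `|al| = r.
    apply/eqP; rewrite -(eqrXn2 (n := 2)) ?normr_ge0 ?(ltW r0) //.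
    by rewrite real_normK ?num_real // al2.
  by rewrite alnr; ring.
have [a0|a0] := eqVneq a 0.
  have : `|al'| = `|be| by rewrite /al' a0 oppr0 sub0r normrN.
  by rewrite alr => e; move: ber; rewrite -e ltxx.
apply: (@rational_root_int f be (`|h`_0| + s - a ^+ 2) a fm rb a0).
rewrite rmorphB rmorphD /= t2 rmorphXn /= -al'2 /al'.
have := be2; rewrite !expr2 => h1.
by lra.
Qed.

(** Rationality of be is enough. A linear factor X + c either has root be, or |c| = r; in the latter
    case al is c or -c, and be = f_0 / al^3. Quadratic factors are handled by
    [quadratic_factor_int_root], applied to the one that vanishes at be. *)
Lemma reducible_three_int_root (f : {poly int}) (r al be u : R) :
    f \is monic -> size f = 5%N -> quartic_three_data f r al be u ->
    reducibleZ f -> exists b : int, be = b%:~R.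
Proof.
move=> fm sf D red; have [_ rb] := quartic_three_root_al fm sf D.
have [ber al2 ur [eA eB eC eD] fr] := D.
have r0 : 0 < r by apply: le_lt_trans ber.
have [g [h [m [e [[gm hm fE] sg sh me mE]]]]] := reducibleZ_factor fm sf red.
have : (m = 1 /\ e = 3)%N \/ (m = 2 /\ e = 2)%N by move: me mE; clear; lia.
case=> -[m1 e1]; rewrite m1 e1 in sg sh.
  have gE := monic2E gm sg; set c := g`_0 in gE.
  have rc : root (polyZC R f) (- c%:~R).
    rewrite fE polyZC_mul rootM gE /polyZC rmorphD /= map_polyX map_polyC /=.
    by rewrite rootE hornerD hornerX hornerC addNr eqxx.
  have [cb|cr] := fr _ rc.
    exists (- c); apply: complexI; rewrite -cb rmorph_int.
    by rewrite rmorphN.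
  rewrite cmodN cmod_int in cr.
  have c0 : c != 0.
    by apply/eqP => c0; move: cr r0; rewrite c0 normr0 => <-; rewrite ltxx.
  have c2 : (c%:~R : R) ^+ 2 = al ^+ 2.
    by rewrite al2 -cr intr_norm real_normK ?num_real.
  have : (al == c%:~R) || (al == - c%:~R) by rewrite -eqf_sqr c2.
  case/orP => /eqP alE.
    apply: (@rational_root_int f be f`_0 (c ^+ 3) fm rb); first by rewrite expf_neq0.
    by rewrite rmorphXn /= -alE -eD.
  apply: (@rational_root_int f be f`_0 ((- c) ^+ 3) fm rb); first by rewrite expf_neq0 ?oppr_eq0.
  by rewrite rmorphXn rmorphN /= -alE -eD.
move: rb; rewrite fE /polyZR rmorphM rootM => /orP[rg|rh].
  exact: (quadratic_factor_int_root fm sf D gm hm sg fE sh rg).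
by apply: (quadratic_factor_int_root fm sf D hm gm sh _ sg rh); rewrite mulrC.
Qed.

Lemma reducible_three_factor (f : {poly int}) : f \is monic -> size f = 5%N ->
    reducibleZ f -> nb_maxmod_roots (polyZC R f) = 3%N ->
  exists b w, (w != 0 /\ f = ('X + b%:P) * cubic w) \/
    exists u, [/\ w != 0, `|u| <= 3 * `|w| &
      f = ('X + b%:P) * (('X + w%:P) * quadratic (u - w) (w ^+ 2))].
Proof.
move=> fm sf red nb; have [r [al [be [u [D [s [ps sr]]]]]]] := three_maxmod_quartic fm sf nb.
have [c cE] := reducible_three_int_root fm sf D red.
have [ber al2 ur _ fr] := D; have r0 : 0 < r by apply: le_lt_trans ber.
have rc : root f c.
  have [_ rb] := quartic_three_root_al fm sf D.
  move: rb; rewrite cE /polyZR rootE horner_map /= intr_eq0.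
  by [].
have [h hE] := factor_theorem f c rc; rewrite mulrC in hE.
have hm : h \is monic.
  by move: fm; rewrite hE monicMl // monicXsubC.
have sh : size h = 4%N.
  have := sf; rewrite hE size_Mmonic ?monicXsubC ?polyXsubC_eq0 //.
  by rewrite size_XsubC /= => -[].
have hr z : root (polyZC R h) z -> cmod z = r.
  rewrite -mem_croots ?polyZC_monic // => zh; apply: sr.
  have ph : perm_eq (be%:C%C :: croots (polyZC R h)) (croots (polyZC R f)).
    apply: perm_croots; rewrite hE polyZC_mul prod_roots_cons.
    rewrite -croots_monic ?polyZC_monic //; congr (_ * _).
    rewrite /polyZC rmorphB /= map_polyX map_polyC /= cE.
    by congr ('X - _%:P); rewrite [RHS]rmorph_int.
  have : perm_eq (be%:C%C :: croots (polyZC R h)) (be%:C%C :: s).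
    by apply: perm_trans ph _; rewrite perm_sym.
  by rewrite perm_cons => /perm_mem <-.
have [_ h0 _] := same_modulus_coef hm sh hr.
have h00 : h`_0 != 0.
  apply/eqP => h00; move: h0; rewrite h00 normr0 => /esym/eqP.
  by rewrite expf_eq0 /= (gt_eqF r0).
have lin : 'X - c%:P = 'X + (- c)%:P by rewrite polyCN.
have := cubic_same_modulus_int hm sh hr; case=> [[h2 h1]|[k [h1 h0k h2]]].
  exists (- c), h`_0; left; split => //; rewrite hE lin; congr (_ * _).
  by rewrite [LHS](monic4E hm sh) h2 h1 !scale0r !addr0.
exists (- c), k; right; exists h`_2; split => //.
  by apply: contra_neq h00 => k0; rewrite h0k k0 expr0n.
rewrite hE lin; congr (_ * _); rewrite {1}(monic4E hm sh) h1 h0k /quadratic.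
by rewrite -!mul_polyC !rmorphB !rmorphM /=; ring.
Qed.

End ReducibleThree.

(** * Harmonic sums and the order H log H *)

Section ReducibleThreeOrder.
Variable R : realType.

Lemma ln_le_harmonic H : ln (H.+1%:R : R) <= \sum_(i < H) i.+1%:R^-1.
Proof.
elim: H => [|H IH]; first by rewrite big_ord0 ln1.
rewrite big_ord_recr /=; apply: le_trans (lerD IH (lexx _)).
have H0 : 0 < H.+1%:R :> R by rewrite ltr0n.
have -> : H.+2%:R = H.+1%:R * (1 + H.+1%:R^-1) :> R.
  by rewrite mulrDr mulr1 divff ?gt_eqF // -[H.+2]addn1 natrD.
have h0 : 0 < H.+1%:R^-1 :> R by rewrite invr_gt0.
set h := H.+1%:R^-1 in h0 *.
have h1 : 0 < 1 + h by rewrite addr_gt0.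
have h2 : ln (1 + h) <= h by apply: le_ln1Dx; lra.
by rewrite lnM ?posrE // lerD2l.
Qed.

Lemma harmonic_le_ln H : (0 < H)%N -> \sum_(i < H) i.+1%:R^-1 <= 1 + ln (H%:R : R).
Proof.
case: H => // H _; elim: H => [|H IH]; first by rewrite big_ord_recr big_ord0 /= ln1 invr1 add0r addr0.
rewrite big_ord_recr /=; apply: le_trans (lerD IH (lexx _)) _.
rewrite -addrA lerD2l.
have H0 : 0 < H.+1%:R :> R by rewrite ltr0n.
have H2 : 0 < H.+2%:R :> R by rewrite ltr0n.
have e : H.+1%:R = H.+2%:R * (1 - H.+2%:R^-1) :> R.
  by rewrite mulrBr mulr1 divff ?gt_eqF // -[H.+2]addn1 natrD addrK.
have h0 : 0 < 1 - H.+2%:R^-1 :> R by rewrite -(pmulr_rgt0 _ H2) -e.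
rewrite e lnM ?posrE // -addrA gerDl; set h := H.+2%:R^-1 in h0 *.
have h1 : ln (1 - h) <= - h by apply: le_ln1Dx; lra.
lra.
Qed.

Lemma size_allpairs_dep_sum (T U : Type) (F : nat -> T -> U) H (t : nat -> seq T)
    (x : nat -> R) : (forall i, (i < H)%N -> (size (t i))%:R <= x i) ->
  (size [seq F i p | i <- iota 0 H, p <- t i])%:R <= \sum_(i < H) x i.
Proof.
move=> tx; rewrite size_allpairs_dep sumnE big_map natr_sum.
rewrite -{1}[H]subn0 -/(index_iota 0 H) big_mkord.
by apply: ler_sum => i _; apply: tx.
Qed.

Definition signs : seq int := [:: 1; -1].

Lemma int_sign_pred (w : int) : w != 0 -> exists e i, [/\ e \in signs,
  w = e * i.+1%:Z & absz w = i.+1].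
Proof.
move=> w0; exists (Num.sg w), (absz w).-1; split.
- by rewrite !inE; case: sgrP w0.
- by rewrite prednK ?absz_gt0 // abszE -numEsg.
- by rewrite prednK ?absz_gt0.
Qed.

Lemma coef_linear_cubic b u v w : let f := ('X + b%:P) *
    ('X^3 + u *: 'X^2 + v *: 'X + w%:P) in
  f = quartic (u + b) (v + b * u) (w + b * v) (b * w).
Proof. by rewrite /= /quartic -!mul_polyC !rmorphD !rmorphM /=; ring. Qed.

Lemma linear_cubicE b w : ('X + b%:P) * cubic w = quartic b 0 w (b * w).
Proof.
have := coef_linear_cubic b 0 0 w; rewrite /= !scale0r !addr0 => ->.
by rewrite !mulr0 !addr0 add0r.
Qed.

Lemma linear_product_quadraticE b k u :
  ('X + b%:P) * (('X + k%:P) * quadratic (u - k) (k ^+ 2)) =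
  quartic (u + b) (u * k + b * u) (k ^+ 3 + b * (u * k)) (b * k ^+ 3).
Proof.
have <- : 'X^3 + u *: 'X^2 + (u * k) *: 'X + (k ^+ 3)%:P =
    ('X + k%:P) * quadratic (u - k) (k ^+ 2).
  by rewrite /quadratic -!mul_polyC !rmorphB !rmorphM /=; ring.
exact: coef_linear_cubic.
Qed.

Lemma mem_range_div (b : int) (d H : nat) : (0 < d)%N -> (absz b * d <= H)%N ->
  b \in int_range (H%:R / d%:R : R).
Proof.
move=> d0 bd; have d0r : 0 < d%:R :> R by rewrite ltr0n.
rewrite mem_int_range ?divr_ge0 // ler_pdivlMr // -abszE -natrM.
by apply: etrans (ler_nat _ _ _) bd.
Qed.

Lemma size_range_div (d H : nat) : (0 < d <= H)%N ->
  (size (int_range (H%:R / d%:R : R)))%:R <= 3 * (H%:R / d%:R) :> R.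
Proof.
move=> /andP[d0 dH]; apply: size_int_range_le3.
by rewrite ler_pdivlMr ?ltr0n // mul1r ler_nat.
Qed.

(** The products (X + b)(X^3 + w) are counted by |w| = i + 1, with O(H / |w|) choices of b, which
    sum to O(H log H). In the other shape, |k| = i + 1 leaves O(k) values u and O(H / |k|^3) values
    b, thus O(H / k^2), which is bounded by the same harmonic terms. The constant is 60 = 6 + 54. *)
Lemma reducible_quartic_three_upper H : (0 < H)%N ->
  card_at_most (reducible_with R 4 3 H) (60 * H%:R * (1 + ln (H%:R : R))).
Proof.
move=> H0.
pose F1 (i : nat) (p : int * int) : {poly int} := ('X + (p.2)%:P) * cubic (p.1 * i.+1%:Z).
pose t1 (i : nat) := [seq (e, b) | e <- signs, b <- int_range (H%:R / i.+1%:R : R)].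
pose F2 (i : nat) (p : (int * int) * int) : {poly int} :=
  let k := p.1.1 * i.+1%:Z in
  ('X + (p.2)%:P) * (('X + k%:P) * quadratic (p.1.2 - k) (k ^+ 2)).
pose t2 (i : nat) := if (i.+1 ^ 3 <= H)%N then
  [seq (q, b) | q <- [seq (e, u) | e <- signs, u <- int_range ((3 * i.+1)%:R : R)],
    b <- int_range (H%:R / (i.+1 ^ 3)%:R : R)] else [::].
pose l1 := [seq F1 i p | i <- iota 0 H, p <- t1 i].
pose l2 := [seq F2 i p | i <- iota 0 H, p <- t2 i].
have sgn2 : (size signs)%:R <= 2 :> R by [].
exists (l1 ++ l2); split; last first.
  have h1 : (size l1)%:R <= \sum_(i < H) (6 * H%:R * i.+1%:R^-1 : R).
    apply: (size_allpairs_dep_sum F1 (x := fun i => 6 * H%:R * i.+1%:R^-1)) => i iH.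
    apply: le_trans (size_allpairs_pair sgn2 (size_range_div (_ : (0 < i.+1 <= H)%N))) _ => //.
    by rewrite le_eqVlt; apply/orP; left; apply/eqP; ring.
  have h2 : (size l2)%:R <= \sum_(i < H) (54 * H%:R * i.+1%:R^-1 : R).
    apply: (size_allpairs_dep_sum F2 (x := fun i => 54 * H%:R * i.+1%:R^-1)) => i iH; rewrite /t2.
    have i0 : 1 <= i.+1%:R :> R by rewrite ler1n.
    have i00 : 0 <= i.+1%:R^-1 :> R by rewrite invr_ge0.
    have [i3|i3] := leqP (i.+1 ^ 3) H; last by apply: mulr_ge0 => //; apply: mulr_ge0.
    have s3 : (size (int_range ((3 * i.+1)%:R : R)))%:R <= 3 * (3 * i.+1%:R) :> R.
      by rewrite natrM; apply: size_int_range_le3; lra.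
    apply: le_trans (size_allpairs_pair (size_allpairs_pair sgn2 s3)
      (size_range_div (_ : (0 < i.+1 ^ 3 <= H)%N))) _; first by rewrite expn_gt0 i3.
    rewrite natrX [leLHS](_ : _ = (54 * H%:R * i.+1%:R^-1) * i.+1%:R^-1); last first.
      by field; lra.
    rewrite ler_piMr ?mulr_ge0 // invf_le1 ?ltr0n //; lra.
  rewrite size_cat natrD; apply: le_trans (lerD h1 h2) _.
  rewrite -!mulr_sumr -mulrDl; apply: le_trans (_ : 60 * H%:R * \sum_(i < H) i.+1%:R^-1 <= _).
    by rewrite le_eqVlt; apply/orP; left; apply/eqP; ring.
  by rewrite ler_wpM2l ?mulr_ge0 // harmonic_le_ln.
move=> f [[fm sf /height_leP fH] red nb]; rewrite mem_cat; apply/orP.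
have [b [w [[w0 fE]|[u [w0 uw fE]]]]] := reducible_three_factor fm sf red nb.
  left; have [e [i [es wE wi]]] := int_sign_pred w0.
  have cf := linear_cubicE b w; rewrite -fE in cf.
  have hw := fH 1%N; have hb := fH 3%N; have hbw := fH 0%N.
  rewrite cf !coef_quartic /= !(mulr0, mulr1, addr0, add0r) in hw hb hbw.
  rewrite wi in hw; rewrite abszM wi in hbw.
  apply/allpairsPdep; exists i, (e, b); split.
  - by rewrite mem_iota add0n.
  - by apply/allpairsP; exists (e, b); split => //; apply: mem_range_div.
  - by rewrite /F1 /= -wE.
right; have [e [i [es wE wi]]] := int_sign_pred w0.
have cf := linear_product_quadraticE b w u; rewrite -fE in cf.
have h0 := fH 0%N; have h1 := fH 1%N.
rewrite cf !coef_quartic /= !(mulr0, mulr1, addr0, add0r) in h0 h1.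
rewrite abszM abszX wi in h0.
(* For b = 0 the constant coefficient b w^3 gives no information, but the coefficient of X is then
   w^3. *)
have w3 : (i.+1 ^ 3 <= H)%N.
  have [b0|b0] := eqVneq b 0; first by rewrite b0 mul0r addr0 abszX wi in h1.
  by apply: leq_trans h0; rewrite leq_pmull // absz_gt0.
have iH : (i < H)%N by apply: leq_trans w3; rewrite -{1}[i.+1]expn1 leq_pexp2l.
apply/allpairsPdep; exists i, ((e, u), b); split.
- by rewrite mem_iota add0n.
- rewrite /t2 w3; apply/allpairsP; exists ((e, u), b); split => //.
    apply/allpairsP; exists (e, u); split => //.
    rewrite mem_int_range // -abszE; apply: etrans (ler_nat _ _ _) _.
    by rewrite -wi /= -lez_nat PoszM abszE abszE; apply: uw.
  by apply: mem_range_div => //; rewrite expn_gt0.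
- by rewrite /F2 /= -wE.
Qed.

Lemma linear_cubic_maxmod (b c : int) : (absz b ^ 3 < absz c)%N ->
  nb_maxmod_roots (polyZC R (('X + b%:P) * cubic c)) = 3%N.
Proof.
move=> bc; rewrite polyZC_mul.
have gm := polyZC_monic R (linear_monic b); have hm := polyZC_monic R (cubic_monic c).
have sg : (1 < size (polyZC R ('X + b%:P)))%N by rewrite size_polyZC size_linear.
have sh : (1 < size (polyZC R (cubic c)))%N by rewrite size_polyZC size_cubic.
have [z zg mz] := maxmod_attained gm sg; have [w wh mw] := maxmod_attained hm sh.
rewrite mem_croots // in zg; rewrite mem_croots // in wh.
have lt : maxmod (polyZC R ('X + b%:P)) < maxmod (polyZC R (cubic c)).
  rewrite -mz -mw -(ltr_pXn2r (n := 3)) ?nnegrE ?cmod_ge0 // (root_cubic wh).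
  rewrite (root_linear zg) cmodN cmod_int -!abszE -natrX.
  by apply: etrans (ltr_nat _ _ _) bc.
have [[lt' _]|[_ ->]|[e _]] := nb_maxmod_mul gm hm sg sh.
- by have := lt_trans lt lt'; rewrite ltxx.
- exact: nb_maxmod_cubic.
- by move: lt; rewrite e ltxx.
Qed.

(** The family is (X - j)(X^3 + c) with 1 <= j <= m and l < c <= 2 l for l the integer part of H /
    (2 j). Then c j <= H, and c > H / (2 j) >= 2 j^3 leaves the maximal modulus to the cubic. Since
    l >= H / (4 j), summing over j produces the logarithm. *)
Lemma reducible_quartic_three_lower m H : (4 * m ^ 4 <= H)%N ->
  card_at_least (reducible_with R 4 3 H) (H%:R / 4 * ln (m.+1%:R : R)).
Proof.
move=> mH; pose l j := (H %/ (2 * j.+1))%N.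
pose F (j i : nat) : {poly int} := ('X + (- j.+1%:Z)%:P) * cubic ((l j).+1 + i)%N%:Z.
have jH j : (j < m)%N -> (4 * (j.+1 * j.+1 * j.+1 * j.+1) <= H)%N.
  move=> jm; apply: leq_trans mH; rewrite leq_mul2l /= !expnS expn0 muln1 -!mulnA.
  by rewrite !leq_mul.
exists [seq F j i | j <- iota 0 m, i <- iota 0 (l j)]; split.
- apply: allpairs_uniq_dep => [|j _|[j i] [j' i'] _ _ /=]; rewrite ?iota_uniq //.
  rewrite /F !linear_cubicE => e; have := congr1 (coefp 3) e; have := congr1 (coefp 1) e.
  rewrite /= !coef_quartic /= !(mulr0, mulr1, addr0, add0r) => e1 e3.
  have jj : j = j' by lia.
  have ii : i = i' by move: e1; rewrite jj; lia.
  by rewrite jj ii.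
- move=> f /allpairsPdep[j [i [hj hi ->]]]; rewrite !mem_iota /= add0n in hj hi.
  have h4 := jH j hj.
  have jle : (j.+1 <= H)%N by move: h4; clear; nia.
  have lj : (l j * (2 * j.+1) <= H)%N := leq_trunc_div _ _.
  have lj2 : (H < (l j).+1 * (2 * j.+1))%N by rewrite ltn_ceil.
  have big : (j.+1 ^ 3 < (l j).+1 + i)%N.
    rewrite !expnS expn0 muln1; apply: leq_trans (leq_addr _ _).
    rewrite -(ltn_pmul2r (_ : 0 < 2 * j.+1)%N) //; apply: leq_ltn_trans lj2.
    apply: leq_trans h4; move: (j.+1) => x; nia.
  have cle : ((l j).+1 + i <= 2 * l j)%N by lia.
  have cH : (((l j).+1 + i) * j.+1 <= H)%N.
    by apply: leq_trans (leq_mul cle (leqnn _)) _; rewrite [(2 * _)%N]mulnC -mulnA.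
  have fE := linear_cubicE (- j.+1%:Z) ((l j).+1 + i)%N%:Z.
  split.
  + rewrite /F fE; have [fm sf] := quartic_monic_size (- j.+1%:Z) 0 ((l j).+1 + i)%N%:Z
      (- j.+1%:Z * ((l j).+1 + i)%N%:Z).
    split => //; apply: quartic_height => //.
    * exact: leq_trans jle.
    * by rewrite /= (leq_trans _ cH) // leq_pmulr.
  + apply: reducibleZ_mul; rewrite ?linear_monic ?cubic_monic ?size_linear ?size_cubic //.
  + by apply: linear_cubic_maxmod; rewrite abszN.
rewrite size_allpairs_dep sumnE big_map natr_sum.
under [leRHS]eq_bigr => j _ do rewrite size_iota.
rewrite -{2}[m]subn0 -/(index_iota 0 m) big_mkord.
apply: le_trans (_ : H%:R / 4 * \sum_(j < m) j.+1%:R^-1 <= _).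
  by rewrite ler_wpM2l ?divr_ge0 // ln_le_harmonic.
rewrite mulr_sumr; apply: ler_sum => j _.
have h4 := jH j (ltn_ord j).
have lj2 : (H < (l j).+1 * (2 * j.+1))%N by rewrite ltn_ceil.
have l0 : (0 < l j)%N by rewrite divn_gt0 //; move: h4; clear; nia.
have lj3 : (H <= l j * (4 * j.+1))%N.
  apply: leq_trans (ltnW lj2) _; have -> : (4 * j.+1 = 2 * (2 * j.+1))%N by rewrite mulnA.
  by rewrite [leqRHS]mulnA leq_mul2r /=; move: l0; clear; move: (l j) => x; lia.
have j0 : 0 < j.+1%:R :> R by rewrite ltr0n.
rewrite -mulrA -invfM ler_pdivrMr ?mulr_gt0 //.
by rewrite -natrM -natrM ler_nat.
Qed.

Lemma reducible_quartic_three :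
  same_order_from 2 (nb_reducible R 4 3) (fun H : R => H * ln H).
Proof.
have [c c0 [H1 Hm]] := @nat_root_lower R 4 4 isT isT.
have l2 : 0 < ln 2 :> R by rewrite ln_gt0 // ltr1n.
(* From H2 on, c H^(1/8) >= 1, so m >= c H^(1/4) >= H^(1/8) and ln (m + 1) >= (ln H) / 8; with the
   factor 1/4 of the lower bound this makes the constant 1/32. *)
pose H2 := (Num.trunc ((c^-1) ^+ 8)).+1.
have lnH H : (2 <= H)%N -> ln 2 <= ln (H%:R : R).
  by move=> h; rewrite ler_ln ?posrE ?ltr0n ?ler_nat //; lia.
apply: (@same_order_from_intro R 2 _ _ (32^-1) (60 * ((ln 2)^-1 + 1)) (maxn 1 (maxn H1 H2))).
- by rewrite invr_gt0.
- by rewrite mulr_gt0 ?addr_gt0 ?invr_gt0.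
- by move=> H h; rewrite mulr_ge0 // (le_trans (ltW l2)) // lnH.
- move=> H H' h hh; have h' := leq_trans h hh.
  apply: ler_pM => //; first by rewrite (le_trans (ltW l2)) // lnH.
    by rewrite ler_nat.
  by rewrite ler_ln ?posrE ?ltr0n ?ler_nat //; lia.
- move=> H h; have H0 : (0 < H)%N by lia.
  apply: le_trans (card_at_most_fset_set (reducible_quartic_three_upper H0)) _.
  have h1 : 1 <= (ln 2)^-1 * ln (H%:R : R).
    by rewrite mulrC ler_pdivlMr // mul1r lnH.
  rewrite -!mulrA ler_wpM2l // [leRHS]mulrCA ler_wpM2l //.
  by rewrite mulrDl mul1r lerD2r.
- move=> H; rewrite !geq_max => /and3P[H0 HH1 HH2].
  have [m [m0 mH cm]] := Hm H HH1.
  apply: card_at_least_fset_set (finite_reducible_with R 4 3 H) _.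
  apply: card_at_least_sub (@subset_refl _ _) _ (reducible_quartic_three_lower mH).
  suff h : 8^-1 * ln (H%:R : R) <= ln m.+1%:R.
    apply: le_trans (ler_wpM2l (_ : 0 <= H%:R / 4) h); last exact: divr_ge0.
    by rewrite le_eqVlt; apply/orP; left; apply/eqP; field.
  rewrite -ln_powR.
  have Hr : 0 < H%:R :> R by rewrite ltr0n.
  rewrite ler_ln ?posrE ?powR_gt0 ?ltr0n //.
  apply: le_trans (_ : m%:R <= _); last by rewrite ler_nat.
  apply: le_trans cm.
  have -> : H%:R `^ 4%:R^-1 = H%:R `^ 8^-1 * H%:R `^ 8^-1 :> R.
    rewrite -powRD; first by congr (_ `^ _); lra.
    by rewrite (gt_eqF Hr) implybT.
  rewrite mulrA ler_peMl ?powR_ge0 // mulrC -ler_pdivrMr // div1r.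
  rewrite -(ler_pXn2r (n := 8)) ?nnegrE ?powR_ge0 ?invr_ge0 ?(ltW c0) //.
  rewrite -[(_ `^ _) ^+ 8]powR_mulrn ?powR_ge0 // -powRrM mulVf // powRr1 ?ltW //.
  by apply: lt_le_trans (truncnS_gt _) _; rewrite ler_nat.
- move=> H h; rewrite -(ltr0n R); apply: lt_le_trans ltr01 _.
  apply: card_at_least_fset_set (finite_reducible_with R 4 3 H) _.
  apply: (@card_at_least1 _ _ _ (('X + 0%:P) * cubic 1)); split.
  + rewrite linear_cubicE; have [fm sf] := quartic_monic_size 0 0 1 (0 * 1).
    by split => //; apply: quartic_height; rewrite ?mul0r //; lia.
  + apply: reducibleZ_mul; rewrite ?linear_monic ?cubic_monic ?size_linear ?size_cubic //.
  + exact: linear_cubic_maxmod.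
Qed.

End ReducibleThreeOrder.

Theorem theorem1p4 (R : realType) :
  (forall n : nat, (3 <= n)%N ->
    [/\ asymp_equivalent (nb_irreducible R n 1) (fun H : R => (2 * H) ^+ n),
        same_order_from 1 (nb_reducible R n 1) (fun H : R => H ^+ n.-1),
        same_order_from 1 (nb_irreducible R n 2)
          (fun H : R => H `^ (n%:R - 1 / 2))
      & same_order_from 1 (nb_reducible R n 2)
          (fun H : R => H `^ (n%:R - 3 / 2))]) /\
  (asymp_equivalent (nb_irreducible R 3 3) (fun H : R => 2 * H) /\
   same_order_from 1 (nb_reducible R 3 3) (fun H : R => H `^ (2 / 3))) /\
  ((forall H : nat, (1 <= H)%N -> nb_irreducible R 4 3 H = 0%N) /\
   same_order_from 2 (nb_reducible R 4 3) (fun H : R => H * ln H)) /\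
  (same_order_from 1 (nb_irreducible R 4 4) (fun H : R => H `^ (3 / 2)) /\
   same_order_from 1 (nb_reducible R 4 4) (fun H : R => H)).
Proof.
split; first exact: general_degree.
split; first by split; [exact: irreducible_cubic_asymp|exact: reducible_three_maxmod].
split; first by split; [move=> H _; exact: irreducible_quartic_three|
  exact: reducible_quartic_three].
by split; [exact: irreducible_four_maxmod|exact: reducible_four_maxmod].
Qed.
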